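(* Let $X=\mathbb{A}^3_{\mathbb{C}}$ and let $D$ be the divisor given by $y(yz^2-x^2z+x^3+y^3)^2=0$. Let $\pi:Y\to X$ be the log resolution of $(X,D)$ obtained by blowing up the origin first, with exceptional divisor $E_1$, followed by two line blow-ups; $E_1$ has multiplicity $a=7$ in $\pi^*D$. Then $E_1$ contributes the jumping number $\frac37$ to $(X,D)$, but $1-\frac1a=\frac67$ is not a jumping number of $(X,D)$ (in particular, it is not contributed by $E_1$).
   Context: Varieties are integral schemes of finite type over $\mathbb{C}$, and $\lfloor\sum a_iF_i\rfloor=\sum\lfloor a_i\rfloor F_i$. Log resolution: for a smooth variety $X$ and a divisor $D$, a proper birational morphism $\pi:Y\to X$ with $Y$ smooth, $\pi^{-1}(D)$ a strict normal crossings divisor, and $\pi$ an isomorphism outside $\pi^{-1}(D)$. Multiplier ideals, jumping numbers and contribution: for $D$ effective on a smooth variety $X$, $K_\pi=K_Y-\pi^*K_X$ is the (effective, exceptionally supported) relative canonical divisor, and $\mathcal{J}(X,cD)=\pi_*\mathcal{O}_Y(K_\pi-\lfloor c\pi^*D\rfloor)$ for $c\in\mathbb{Q}_{>0}$. The jumping numbers of $(X,D)$ are the positive rationals $\lambda$ with $\mathcal{J}(X,\lambda D)\subsetneq\mathcal{J}(X,(\lambda-\varepsilon)D)$ for all sufficiently small $\varepsilon>0$. Write $\pi^*D=\sum_{i\in I} a_iE_i$ and $K_\pi=\sum_{i\in I} k_iE_i$ with $E_i$ the irreducible components of $\pi^{-1}(D)$. Candidate jumping numbers are the numbers $(k_i+n)/a_i$,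 $i\in I$, $n\in\mathbb{Z}_{>0}$. For a reduced divisor $E$ that is a sum of some of the $E_i$, a candidate jumping number $\lambda$ is a candidate for $E$ if $\lambda a_i\in\mathbb{Z}$ for every component $E_i$ of $E$. A reduced exceptional divisor $E$ contributes $\lambda$ as a jumping number to $(X,D)$ if $\lambda$ is a candidate jumping number for $E$ and $\mathcal{J}(X,\lambda D)\subsetneq\pi_*\mathcal{O}_Y(K_\pi-\lfloor\lambda\pi^*D\rfloor+E)$. *)

(* Defs.v *)
From HB Require Import structures.
From mathcomp Require Import all_boot all_order all_algebra.
From mathcomp Require Import fraction complex mpoly.
From mathcomp Require Import boolp classical_sets reals.

Set Implicit Arguments.
Unset Strict Implicit.
Unset Printing Implicit Defensive.

Import Order.TTheory GRing.Theory Num.Theory.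
Local Open Scope classical_set_scope.
Local Open Scope ring_scope.

(** Varieties with function field K = k(x_1, .., x_n), in the language of
    Zariski and Chevalley: such a variety is the set of its local rings, which
    are subrings of K.  A scheme point is its local ring; R is a specialization
    of R' (R' lies on every open set containing R) iff R is included in R'; a
    birational morphism Y -> X that is the identity on K maps the point R' of Y
    to the unique point of X that R' dominates. *)

Section Models.
Variables (n : nat) (k : numClosedFieldType).

Definition ratfun := {fraction {mpoly k[n]}}.
Implicit Types (A R p q S V E L : set ratfun) (f g h t : ratfun).
Implicit Types (X Y M : set (set ratfun)).

Definition cst (c : k) : ratfun := tofrac c%:MP.
Definition coord (i : 'I_n) : ratfun := tofrac 'X_i.

(* The partial derivative d/dx_i of K, by the quotient rule. *)
Definition fderiv (i : 'I_n) (h : ratfun) : ratfun :=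
  let a := (frac (repr h)).1 in let b := (frac (repr h)).2 in
  tofrac (a^`M(i) * b - a * b^`M(i)) / tofrac b ^+ 2.

(* dw_1 /\ .. /\ dw_n = jac w * dx_1 /\ .. /\ dx_n in Omega^n_{K/k}. *)
Definition jac (w : 'I_n -> ratfun) : ratfun :=
  \det (\matrix_(i, j) fderiv i (w j)).

(* The k-subalgebra of K generated by S. *)
Inductive subalg (S : set ratfun) : ratfun -> Prop :=
| subalg_cst c : subalg S (cst c)
| subalg_gen f : S f -> subalg S f
| subalg_add f g : subalg S f -> subalg S g -> subalg S (f + g)
| subalg_mul f g : subalg S f -> subalg S g -> subalg S (f * g).

(* The ideal of A generated by S. *)
Inductive ideal_of (A S : set ratfun) : ratfun -> Prop :=
| ideal_of0 : ideal_of A S 0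
| ideal_of_gen a f : A a -> S f -> ideal_of A S (a * f)
| ideal_of_add f g : ideal_of A S f -> ideal_of A S g -> ideal_of A S (f + g).

Definition prime_ideal_of A p :=
  [/\ p `<=` A, p 0, ~ p 1 &
   [/\ forall a b, p a -> p b -> p (a + b),
       forall a b, A a -> p b -> p (a * b) &
       forall a b, A a -> A b -> p (a * b) -> p a \/ p b]].

Definition localize A p : set ratfun :=
  [set h | exists a b, [/\ A a, A b, ~ p b & h = a / b]].

Definition spec A : set (set ratfun) :=
  [set R | exists2 p, prime_ideal_of A p & R = localize A p].

Definition affine_space : set (set ratfun) := spec (subalg (range coord)).

Definition runit R f := [/\ f != 0, R f & R f^-1].
Definition maxid R : set ratfun := [set f | R f /\ ~ runit R f].
Definition dominates V R := R `<=` V /\ maxid R `<=` maxid V.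

Definition valuation_ring V :=
  [/\ V 1, forall f g, V f -> V g -> V (f - g) /\ V (f * g)
    & forall f, V f \/ V f^-1].

(* Integral separated k-scheme of finite type with function field K. *)
Definition variety Y :=
  [/\ Y setT,
      exists ss : seq (seq ratfun),
        Y = [set R | exists2 s, s \in ss & spec (subalg [set` s]) R]
    & forall V R1 R2, valuation_ring V -> Y R1 -> Y R2 ->
        dominates V R1 -> dominates V R2 -> R1 = R2].

(* The identity of K is a birational morphism Y -> X, and it is proper by the
   valuative criterion (valuation rings of K suffice, as Y and X are integral
   of finite type with function field K); uniqueness of the centre is part of
   [variety]. *)
Definition proper_birational Y X :=
  (forall R', Y R' -> exists2 R, X R & dominates R' R) /\
  (forall V R, valuation_ring V -> X R -> dominates V R ->
     exists2 R', Y R' & dominates V R').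

(* By the Nullstellensatz, the points of a variety with residue field k are
   the closed points. *)
Definition closed_point Y R :=
  Y R /\ forall f, R f -> exists c : k, maxid R (f - cst c).

(* The variety having dimension n, a closed point is smooth iff its maximal
   ideal has n generators; these form a regular system of parameters. *)
Definition regular_params R (u : 'I_n -> ratfun) :=
  maxid R = ideal_of R (range u).

Definition smooth Y :=
  forall R, closed_point Y R -> exists u, regular_params R u.

(* The stalk at R of the ideal sheaf of the closure of the point L. *)
Definition ideal_stalk L R : set ratfun :=
  [set f | R f /\ (R `<=` L -> maxid L f)].

(* The blow-up of M along the closure of its point L: above a point R with
   ideal stalk I, it is covered by the spectra of the algebras R[I/g], g in I. *)
Definition blowup M L : set (set ratfun) :=
  [set R' | exists R g q,
     let B := subalg (R `|` [set f / g | f in ideal_stalk L R]) in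
     [/\ M R, ideal_stalk L R g /\ g != 0, prime_ideal_of B q,
         maxid R `<=` q & R' = localize B q]].

Definition uniformizer E t :=
  maxid E t /\ forall f, f != 0 -> exists m : int, runit E (f / t ^ m).

(* On a normal variety, the generic points of prime divisors are the points
   whose local ring is a discrete valuation ring. *)
Definition prime_divisor Y E := Y E /\ exists2 t, t != 0 & uniformizer E t.

Definition ord E f : int :=
  xget 0 [set m : int | forall t, uniformizer E t -> runit E (f / t ^ m)].

(* In what follows D is the effective divisor f = 0 on X = affine_space, with
   f a nonzero polynomial, and Y -> X is a log resolution of (X, D).  The
   multiplicity of E in pi^*D is ord E f. *)

(* E is an irreducible component of pi^-1(D). *)
Definition component Y f E := prime_divisor Y E /\ 0 < ord E f.

(* pi^-1(D) has strict normal crossings: near every closed point of Y there are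
   local parameters such that each component through the point is the zero
   locus of one of them.  The component E passes through R iff R is included
   in E, and its ideal there is the contraction of maxid E. *)
Definition snc Y f :=
  forall R, closed_point Y R -> exists2 u, regular_params R u &
    forall E, component Y f E -> R `<=` E ->
      exists j, R `&` maxid E = ideal_of R [set u j].

Definition log_resolution Y f :=
  [/\ variety Y, proper_birational Y affine_space, smooth Y, snc Y f
    & [set R | Y R /\ runit R f] = [set R | affine_space R /\ runit R f]].

(* The multiplicity of E in K_pi = K_Y - pi^*K_X.  As dx_1 /\ .. /\ dx_n
   generates the canonical sheaf of X, K_pi is the divisor of this form on Y.
   The stalk at E of the canonical sheaf of Y, as a submodule of
   Omega^n_{K/k} = K dx_1 /\ .. /\ dx_n, is generated by the forms
   dw_1 /\ .. /\ dw_n with w_i in E, so it is the set of g dx_1 /\ .. /\ dx_n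
   with ord_E g >= -m, where m is the required multiplicity. *)
Definition relcan E : int :=
  xget 0 [set m : int |
    (forall w, (forall i, E (w i)) -> jac w != 0 -> - m <= ord E (jac w)) /\
    (exists w, [/\ forall i, E (w i), jac w != 0 & ord E (jac w) = - m])].

(* Global sections of O_Y(N), for N a divisor given by its multiplicities.
   As X is affine, a coherent subsheaf of the constant sheaf K on X, such as
   pi_* O_Y(N), is identified with its module of global sections. *)
Definition sections Y (N : set ratfun -> int) : set ratfun :=
  [set h | h = 0 \/ forall E, prime_divisor Y E -> 0 <= ord E h + N E].

(* K_pi - floor(c pi^*D) *)
Definition multiplier_divisor f (c : rat) (E : set ratfun) : int :=
  relcan E - Num.floor (c * (ord E f)%:~R).

Definition multiplier_ideal Y f (c : rat) : set ratfun :=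
  sections Y (multiplier_divisor f c).

Definition jumping_number Y f (lam : rat) :=
  0 < lam /\ exists2 e0 : rat, 0 < e0 <= lam &
    forall e : rat, 0 < e < e0 ->
      multiplier_ideal Y f lam `<` multiplier_ideal Y f (lam - e).

Definition candidate Y f (lam : rat) :=
  exists E, component Y f E /\ exists2 m : int, 0 < m &
    lam = (relcan E + m)%:~R / (ord E f)%:~R.

(* F is the set of components of a reduced exceptional divisor. *)
Definition contributes Y f (F : set (set ratfun)) (lam : rat) :=
  [/\ forall E, F E -> component Y f E /\ ~ affine_space E,
      candidate Y f lam,
      forall E, F E -> lam * (ord E f)%:~R \is a Num.int
    & multiplier_ideal Y f lam `<`
      sections Y (fun E => multiplier_divisor f lam E + (E \in F)%:Z)].

End Models.

Section Example.
Variable R : realType.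
Local Notation K := (ratfun 3 R[i]).

Local Notation x := (coord R[i] (@Ordinal 3 0 isT) : K).
Local Notation y := (coord R[i] (@Ordinal 3 1 isT) : K).
Local Notation z := (coord R[i] (@Ordinal 3 2 isT) : K).

Definition eqD : K := y * (y * z ^+ 2 - x ^+ 2 * z + x ^+ 3 + y ^+ 3) ^+ 2.

(* The point of the chart Spec k[s] with prime ideal generated by l. *)
Definition chart_point (s l : seq K) : set K :=
  let A := subalg [set` s] in localize A (ideal_of A [set` l]).

Definition X3 : set (set K) := @affine_space 3 R[i].
Definition origin : set K := chart_point [:: x; y; z] [:: x; y; z].
Definition Y1 : set (set K) := blowup X3 origin.

(* The strict transforms on Y1 of the two components of D are tangent along
   the strict transform of the line x = y = 0, which has the same generic
   point as that line. *)
Definition line1 : set K := chart_point [:: x; y; z] [:: x; y].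
Definition Y2 : set (set K) := blowup Y1 line1.

(* On Y2 these strict transforms meet the new exceptional divisor along a
   common line, whose generic point is line2.  In the chart with coordinates x, y/x, z, which is valid away
   from z = 0, this divisor is x = 0 and the strict transforms are
   v = 0 and v z^2 - x z + x^2 + v^3 x^2 = 0 with v = y/x. *)
Definition line2 : set K := chart_point [:: x; y / x; z] [:: x; y / x].
Definition Y3 : set (set K) := blowup Y2 line2.

End Example.

Arguments eqD : clear implicits.
Arguments origin : clear implicits.
Arguments Y1 : clear implicits.
Arguments Y2 : clear implicits.
Arguments Y3 : clear implicits.

(* Main.v *)
Require Import Defs.
From HB Require Import structures.
From mathcomp Require Import all_boot all_order all_algebra.
From mathcomp Require Import fraction complex mpoly.
From mathcomp Require Import boolp classical_sets reals.
From mathcomp Require Import ring zify lra.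

(** The surface [y C^2 = 0], where [C = y z^2 - x^2 z + x^3 + y^3], is resolved by a toric
    modification: Y3 is covered by five affine charts whose coordinates [w] are monomials
    in [x, y, z].  In each of them [y C^2] is [prod w_i^(e_i) * g^2] with [g] the strict
    transform of [C], and the Jacobian determinant of [x, y, z] with respect to [w] is
    [prod w_i^(kap_i)].  The pairs (e, kap) are (7,2) for E1, (3,1) and (6,2) for the other
    two exceptional divisors, (1,0) for [y = 0] and (2,0) for [C = 0].

    For 3/7 the divisor [K - floor(3/7 D)] is -1 at E1 and nonnegative at the other
    components, so that the constant 1 is gained by adding E1.

    For 6/7, let [h] satisfy the conditions imposed by all divisors other than E1.  As the
    polynomial ring is factorial, [h] is a polynomial, and it is divisible by [C].  The
    order of [C] along the divisor E3 with data (6,2) is 2 while 3 is required of [h], so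
    [h / C] vanishes along the centre of E3, a line through the origin; hence [h / C]
    vanishes at the origin and [h] has order at least 3 + 1 = 4 along E1, which is the
    condition at E1. *)

Set Implicit Arguments.
Unset Strict Implicit.
Unset Printing Implicit Defensive.

Import Order.TTheory GRing.Theory Num.Theory.
Local Open Scope classical_set_scope.
Local Open Scope ring_scope.

(** The notions of [Defs] are restated over an abstract field with the operations they use,
    because unification inside [{fraction {mpoly k[n]}}] unfolds the quotient construction
    and does not terminate in practice.  On the field of rational functions both versions
    are convertible. *)
Module AbstractField.

(** Of the multiplicities 1, 2, 3, 6, 7 of the components, only 7 becomes an integer when multiplied
    by 6/7. Off E1 the divisors for 6/7 and for 6/7 - e with small e therefore coincide, and adding
    E1 also changes the conditions at E1 only. Both negative statements thus reduce to one
    implication: the conditions off E1 force the condition at E1. The conditions range over all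
    discrete valuation rings among the points of Y3, while orders, canonical multiplicities and
    blow-ups are defined from local rings alone. The link is the notion of a chart with coordinates
    [w]: a component of D that meets the chart is the localization at some [w i] or at [g], because
    a discrete valuation ring has no overring but itself and the field. For this [g] has to be prime
    in each chart, which is deduced from the primality of C in k[x, y, z]. The local rings of E1
    found in the five charts are identified by separatedness. *)

Record function_field (n : nat) (k : numClosedFieldType) := FunctionField {
  ff_sort :> fieldType;
  cst : {rmorphism k -> ff_sort};
  coord : 'I_n -> ff_sort;
  fderiv : 'I_n -> ff_sort -> ff_sort;
  subalg : set ff_sort -> set ff_sort;
  ideal_of : set ff_sort -> set ff_sort -> set ff_sort;
  fderiv_cst : forall i c, fderiv i (cst c) = 0;
  fderivD : forall i f g, fderiv i (f + g) = fderiv i f + fderiv i g;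
  fderivM : forall i f g, fderiv i (f * g) = fderiv i f * g + f * fderiv i g;
  fderiv_coord : forall i j, fderiv i (coord j) = (i == j)%:R;
  frac_coord : forall h, exists p q : {mpoly k[n]},
    mmap cst coord q != 0 /\ h = mmap cst coord p / mmap cst coord q;
  subalg_cst : forall S c, subalg S (cst c);
  subalg_gen : forall S, S `<=` subalg S;
  subalg_add : forall S f g, subalg S f -> subalg S g -> subalg S (f + g);
  subalg_mul : forall S f g, subalg S f -> subalg S g -> subalg S (f * g);
  subalg_min : forall S (T : set ff_sort), (forall c, T (cst c)) -> S `<=` T ->
    (forall f g, T f -> T g -> T (f + g)) -> (forall f g, T f -> T g -> T (f * g)) ->
    subalg S `<=` T;
  ideal_of0 : forall A S, ideal_of A S 0;
  ideal_of_gen : forall A S a f, A a -> S f -> ideal_of A S (a * f);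
  ideal_of_add : forall A S f g, ideal_of A S f -> ideal_of A S g -> ideal_of A S (f + g);
  ideal_of_min : forall A S (T : set ff_sort), T 0 ->
    (forall a f, A a -> S f -> T (a * f)) ->
    (forall f g, T f -> T g -> T (f + g)) -> ideal_of A S `<=` T }.

Arguments cst {n k} K : rename.
Arguments coord {n k} K : rename.
Arguments fderiv {n k} K : rename.
Arguments subalg {n k} K : rename.
Arguments ideal_of {n k} K : rename.

Section Models.
Variables (n : nat) (k : numClosedFieldType) (K : function_field n k).
Implicit Types (A R p q S V E L : set K) (f g h t : K).
Implicit Types (X Y M : set (set K)).

Definition jac (w : 'I_n -> K) : K :=
  \det (\matrix_(i, j) fderiv K i (w j)).

Definition prime_ideal_of A p :=
  [/\ p `<=` A, p 0, ~ p 1 &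
   [/\ forall a b, p a -> p b -> p (a + b),
       forall a b, A a -> p b -> p (a * b) &
       forall a b, A a -> A b -> p (a * b) -> p a \/ p b]].

Definition localize A p : set K :=
  [set h | exists a b, [/\ A a, A b, ~ p b & h = a / b]].

Definition spec A : set (set K) :=
  [set R | exists2 p, prime_ideal_of A p & R = localize A p].

Definition affine_space : set (set K) := spec (subalg K (range (coord K))).

Definition runit R f := [/\ f != 0, R f & R f^-1].
Definition maxid R : set K := [set f | R f /\ ~ runit R f].
Definition dominates V R := R `<=` V /\ maxid R `<=` maxid V.

Definition valuation_ring V :=
  [/\ V 1, forall f g, V f -> V g -> V (f - g) /\ V (f * g)
    & forall f, V f \/ V f^-1].

Definition variety Y :=
  [/\ Y setT,
      exists ss : seq (seq K),
        Y = [set R | exists2 s, s \in ss & spec (subalg K [set` s]) R]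
    & forall V R1 R2, valuation_ring V -> Y R1 -> Y R2 ->
        dominates V R1 -> dominates V R2 -> R1 = R2].

Definition proper_birational Y X :=
  (forall R', Y R' -> exists2 R, X R & dominates R' R) /\
  (forall V R, valuation_ring V -> X R -> dominates V R ->
     exists2 R', Y R' & dominates V R').

Definition closed_point Y R :=
  Y R /\ forall f, R f -> exists c : k, maxid R (f - cst K c).

Definition regular_params R (u : 'I_n -> K) :=
  maxid R = ideal_of K R (range u).

Definition smooth Y :=
  forall R, closed_point Y R -> exists u, regular_params R u.

Definition ideal_stalk L R : set K :=
  [set f | R f /\ (R `<=` L -> maxid L f)].

Definition blowup M L : set (set K) :=
  [set R' | exists R g q,
     let B := subalg K (R `|` [set f / g | f in ideal_stalk L R]) in
     [/\ M R, ideal_stalk L R g /\ g != 0, prime_ideal_of B q,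
         maxid R `<=` q & R' = localize B q]].

Definition uniformizer E t :=
  maxid E t /\ forall f, f != 0 -> exists m : int, runit E (f / t ^ m).

Definition prime_divisor Y E := Y E /\ exists2 t, t != 0 & uniformizer E t.

Definition ord E f : int :=
  xget 0 [set m : int | forall t, uniformizer E t -> runit E (f / t ^ m)].

Definition component Y f E := prime_divisor Y E /\ 0 < ord E f.

Definition snc Y f :=
  forall R, closed_point Y R -> exists2 u, regular_params R u &
    forall E, component Y f E -> R `<=` E ->
      exists j, R `&` maxid E = ideal_of K R [set u j].

Definition log_resolution Y f :=
  [/\ variety Y, proper_birational Y affine_space, smooth Y, snc Y f
    & [set R | Y R /\ runit R f] = [set R | affine_space R /\ runit R f]].

Definition relcan E : int :=
  xget 0 [set m : int |
    (forall w, (forall i, E (w i)) -> jac w != 0 -> - m <= ord E (jac w)) /\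
    (exists w, [/\ forall i, E (w i), jac w != 0 & ord E (jac w) = - m])].

Definition sections Y (N : set K -> int) : set K :=
  [set h | h = 0 \/ forall E, prime_divisor Y E -> 0 <= ord E h + N E].

Definition multiplier_divisor f (c : rat) (E : set K) : int :=
  relcan E - Num.floor (c * (ord E f)%:~R).

Definition multiplier_ideal Y f (c : rat) : set K :=
  sections Y (multiplier_divisor f c).

Definition jumping_number Y f (lam : rat) :=
  0 < lam /\ exists2 e0 : rat, 0 < e0 <= lam &
    forall e : rat, 0 < e < e0 ->
      multiplier_ideal Y f lam `<` multiplier_ideal Y f (lam - e).

Definition candidate Y f (lam : rat) :=
  exists E, component Y f E /\ exists2 m : int, 0 < m &
    lam = (relcan E + m)%:~R / (ord E f)%:~R.

Definition contributes Y f (F : set (set K)) (lam : rat) :=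
  [/\ forall E, F E -> component Y f E /\ ~ affine_space E,
      candidate Y f lam,
      forall E, F E -> lam * (ord E f)%:~R \is a Num.int
    & multiplier_ideal Y f lam `<`
      sections Y (fun E => multiplier_divisor f lam E + (E \in F)%:Z)].

End Models.

Arguments affine_space {n k} K.

(** * Local subrings of the function field *)

Section LocalRings.
Variables (n : nat) (k : numClosedFieldType) (K : function_field n k).
Implicit Types (A R p q S V E L : set K) (f g h t : K) (M : set (set K)).

Definition subring R :=
  [/\ R 1, forall f g, R f -> R g -> R (f - g)
    & forall f g, R f -> R g -> R (f * g)].

Definition local_ring R :=
  subring R /\ forall f g, maxid R f -> maxid R g -> maxid R (f + g).

Lemma subring0 R : subring R -> R 0.
Proof. by case=> R1 RB _; rewrite -(subrr 1); apply: RB. Qed.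

Lemma subringN R f : subring R -> R f -> R (- f).
Proof. by move=> sR Rf; rewrite -sub0r; case: (sR) => _ RB _; apply: RB => //; apply: subring0. Qed.

Lemma subringD R f g : subring R -> R f -> R g -> R (f + g).
Proof. by move=> sR Rf Rg; rewrite -(opprK g); case: (sR) => _ RB _; apply: RB => //; apply: subringN. Qed.

Lemma subringM R f g : subring R -> R f -> R g -> R (f * g).
Proof. by case=> _ _; apply. Qed.

Lemma subringB R f g : subring R -> R f -> R g -> R (f - g).
Proof. by case=> _ + _; apply. Qed.

Lemma subring1 R : subring R -> R 1.
Proof. by case. Qed.

Lemma subringX R f m : subring R -> R f -> R (f ^+ m).
Proof.
move=> sR Rf; elim: m => [|m IH]; first exact: subring1.
by rewrite exprS; apply: subringM.
Qed.

Lemma subring_sum R (I : Type) (r : seq I) (F : I -> K) :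
  subring R -> (forall i, R (F i)) -> R (\sum_(i <- r) F i).
Proof.
move=> sR RF; elim/big_rec: _ => [|i x _ Rx]; first exact: subring0.
exact: subringD.
Qed.

Lemma subring_prod R (I : Type) (r : seq I) (F : I -> K) :
  subring R -> (forall i, R (F i)) -> R (\prod_(i <- r) F i).
Proof.
move=> sR RF; elim/big_rec: _ => [|i x _ Rx]; first exact: subring1.
exact: subringM.
Qed.

Lemma runit1 R : subring R -> runit R 1.
Proof. by move=> sR; split; rewrite ?oner_eq0 ?invr1 //; apply: subring1. Qed.

Lemma runitM R f g : subring R -> runit R f -> runit R g -> runit R (f * g).
Proof.
move=> sR [f0 Rf Rf'] [g0 Rg Rg']; split; rewrite ?mulf_neq0 //.
  exact: subringM.
by rewrite invfM; apply: subringM.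
Qed.

Lemma runitV R f : runit R f -> runit R f^-1.
Proof. by case=> f0 Rf Rf'; split; rewrite ?invr_eq0 ?invrK. Qed.

Lemma runit_div R f g : subring R -> runit R f -> runit R g -> runit R (f / g).
Proof. by move=> sR uf ug; apply: runitM => //; apply: runitV. Qed.

Lemma runitX R f m : subring R -> runit R f -> runit R (f ^+ m).
Proof.
move=> sR Rf; elim: m => [|m IH]; first exact: runit1.
by rewrite exprS; apply: runitM.
Qed.

Lemma runitXz R f (m : int) : subring R -> runit R f -> runit R (f ^ m).
Proof.
move=> sR uf; case: m => m; first exact: runitX.
by apply: runitV; apply: runitX.
Qed.

Lemma runit_neq0 R f : runit R f -> f != 0. Proof. by case. Qed.
Lemma runit_in R f : runit R f -> R f. Proof. by case. Qed.

Lemma runitMl R f g : subring R -> R f -> R g -> runit R (f * g) -> runit R f.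
Proof.
move=> sR Rf Rg [fg0 _ Rfg]; have f0 : f != 0.
  by apply: contraNneq fg0 => ->; rewrite mul0r.
have g0 : g != 0 by apply: contraNneq fg0 => ->; rewrite mulr0.
split=> //; have -> : f^-1 = g * (f * g)^-1 by field; apply/andP.
exact: subringM.
Qed.

Lemma runit_sub R V f : R `<=` V -> runit R f -> runit V f.
Proof. by move=> RV [f0 Rf Rf']; split => //; apply: RV. Qed.

Lemma maxid_in R f : maxid R f -> R f. Proof. by case. Qed.
Lemma maxid_nu R f : maxid R f -> ~ runit R f. Proof. by case. Qed.

Lemma maxid0 R : subring R -> maxid R 0.
Proof. by move=> sR; split; [exact: subring0 | case; rewrite eqxx]. Qed.

Lemma maxidM R f g : subring R -> R f -> maxid R g -> maxid R (f * g).
Proof.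
move=> sR Rf [Rg nu]; split; first exact: subringM.
by rewrite mulrC => u; apply: nu; apply: runitMl u.
Qed.

Lemma maxidMr R f g : subring R -> R f -> maxid R g -> maxid R (g * f).
Proof. by rewrite mulrC; apply: maxidM. Qed.

Lemma runit_or R f : R f -> runit R f \/ maxid R f.
Proof. by move=> Rf; have [u|u] := pselect (runit R f); [left|right; split]. Qed.

Lemma not_maxid R f : R f -> ~ maxid R f -> runit R f.
Proof. by move=> /runit_or[]. Qed.

Lemma localD R f g : local_ring R -> maxid R f -> maxid R g -> maxid R (f + g).
Proof. by case=> _; apply. Qed.

Lemma localN R f : local_ring R -> maxid R f -> maxid R (- f).
Proof.
case=> sR _ mf; rewrite -mulN1r; apply: maxidM => //.
by apply: subringN => //; apply: subring1.
Qed.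

Lemma localB R f g : local_ring R -> maxid R f -> maxid R g -> maxid R (f - g).
Proof. by move=> lR mf mg; apply: localD => //; apply: localN. Qed.

Lemma not_maxid1 R : subring R -> ~ maxid R 1.
Proof. by move=> sR [_]; apply; apply: runit1. Qed.

Lemma runitD_maxid R f g : local_ring R -> runit R f -> maxid R g -> runit R (f + g).
Proof.
move=> lR uf mg; apply: not_maxid.
  by apply: subringD; [case: lR | exact: runit_in | exact: maxid_in].
move=> mfg; apply: (maxid_nu _ uf); rewrite -(addrK g f); exact: localB.
Qed.

Lemma maxidX R f m : subring R -> (0 < m)%N -> maxid R f -> maxid R (f ^+ m).
Proof.
case: m => // m sR _ mf; rewrite exprS; apply: maxidMr => //.
by apply: subringX => //; apply: maxid_in.
Qed.

Lemma maxidM_or R f g : subring R -> R f -> R g -> maxid R (f * g) ->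
  maxid R f \/ maxid R g.
Proof.
move=> sR Rf Rg mfg; case: (runit_or Rf) => uf; last by left.
case: (runit_or Rg) => ug; last by right.
by case: (maxid_nu mfg); apply: runitM.
Qed.

Lemma maxidX_or R f m : subring R -> R f -> maxid R (f ^+ m) -> maxid R f.
Proof.
move=> sR Rf; elim: m => [/(not_maxid1 sR)//|m IH]; rewrite exprS.
by move=> H; case: (maxidM_or sR Rf (subringX _ sR Rf) H).
Qed.

Lemma local_setT : local_ring (setT : set K).
Proof.
split; first by [].
have m0 (f : K) : maxid setT f -> f = 0.
  by case=> _ nu; apply: contra_notP nu => /eqP f0; split.
by move=> f g /m0-> /m0->; rewrite addr0; apply: maxid0.
Qed.

Lemma valuation_subring V : valuation_ring V -> subring V.
Proof. by case=> V1 VB _; split=> // f g Vf Vg; case: (VB _ _ Vf Vg). Qed.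

Lemma valuation_local V : valuation_ring V -> local_ring V.
Proof.
move=> vV; have sV := valuation_subring vV; split=> // f g mf mg.
wlog Vfg : f g mf mg / V (f / g).
  move=> H; case: vV => _ _ /(_ (f / g)) [|]; first exact: H.
  by rewrite invf_div addrC; apply: H.
have [->|g0] := eqVneq g 0; first by rewrite addr0.
have -> : f + g = (f / g + 1) * g by field.
by apply: maxidM => //; apply: subringD => //; apply: subring1.
Qed.

Lemma dominates_refl R : dominates R R.
Proof. by split. Qed.

Lemma dominates_trans R S V : dominates V S -> dominates S R -> dominates V R.
Proof. by case=> a b [c d]; split=> f Rf; [apply/a/c|apply/b/d]. Qed.

Lemma dominates_runit R V f : dominates V R -> R f -> runit V f -> runit R f.
Proof.
case=> _ mm Rf uf; apply: not_maxid => // mf; exact: (maxid_nu (mm _ mf)).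
Qed.

(** The local ring of the centre of V on Spec A. Its prime ideal, the trace on A of the non-units of
    V, is left implicit by asking the denominators to be units of V. *)
Definition center A V : set K :=
  [set h | exists a b, [/\ A a, A b, runit V b & h = a / b]].

(* [point A R] is equivalent to [spec A R] but does not mention a prime ideal of [A]. *)
Definition point A R := [/\ A `<=` R, local_ring R & R = center A R].

Lemma center_sub A V : subring V -> A `<=` V -> center A V `<=` V.
Proof.
move=> sV AV h [a [b [Aa Ab [_ _ Vb] ->]]]; apply: subringM => //; exact: AV.
Qed.

Lemma sub_center A V : subring A -> subring V -> A `<=` center A V.
Proof.
move=> sA sV a Aa; exists a, 1; split; rewrite ?divr1 //; first exact: subring1.
exact: runit1.
Qed.

Lemma center_runit A V f : subring A -> subring V -> A `<=` V ->
  runit (center A V) f <-> center A V f /\ runit V f.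
Proof.
move=> sA sV AV; split=> [u|[]].
  by split; [exact: runit_in | apply: runit_sub u; apply: center_sub].
move=> [a [b [Aa Ab ub ->]]] uab; have ua : runit V a.
  have -> : a = a / b * b by rewrite divfK // (runit_neq0 ub).
  exact: runitM.
split; first exact: runit_neq0 uab.
  by exists a, b.
by exists b, a; rewrite invf_div.
Qed.

Lemma center_maxid A V f : subring A -> subring V -> A `<=` V ->
  maxid (center A V) f <-> center A V f /\ maxid V f.
Proof.
move=> sA sV AV; split=> [[cf nu]|[cf [Vf nu]]]; split=> //.
  by split; [exact: center_sub cf | move=> u; apply/nu/center_runit].
by move=> /center_runit[].
Qed.

Lemma subring_center A V : subring A -> subring V -> subring (center A V).
Proof.
move=> sA sV; split; first exact: (sub_center sA sV (subring1 sA)).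
- move=> _ _ [a [b [Aa Ab ub ->]]] [c [d [Ac Ad ud ->]]].
  exists (a * d - c * b), (b * d); split; [|exact: subringM|exact: runitM|].
    by apply: subringB => //; apply: subringM.
  by field; rewrite (runit_neq0 ub) (runit_neq0 ud).
- move=> _ _ [a [b [Aa Ab ub ->]]] [c [d [Ac Ad ud ->]]].
  exists (a * c), (b * d); split; [exact: subringM..|exact: runitM|].
  by rewrite mulf_div.
Qed.

Lemma center_local A V : subring A -> local_ring V -> A `<=` V -> local_ring (center A V).
Proof.
move=> sA lV AV; have sV := lV.1; have sC := subring_center sA sV.
split=> // f g /center_maxid-/(_ sA sV AV)[cf mf] /center_maxid-/(_ sA sV AV)[cg mg].
by apply/center_maxid => //; split; [exact: subringD | exact: localD].
Qed.

Lemma center_point A V : subring A -> local_ring V -> A `<=` V ->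
  point A (center A V) /\ dominates V (center A V).
Proof.
move=> sA lV AV; have sV := lV.1; split.
  split; [exact: sub_center|exact: center_local|].
  apply/seteqP; split=> h [a [b [Aa Ab ub ->]]]; exists a, b; split=> //.
    by apply/center_runit => //; split => //; apply: sub_center.
  by have /center_runit[] := ub.
by split; [exact: center_sub | move=> f /center_maxid[]].
Qed.

(** Under domination an element of A is invertible in R exactly when it is invertible in V, so V
    determines R; this is the uniqueness of centres on an affine scheme. *)
Lemma point_center A R V : point A R -> dominates V R -> R = center A V.
Proof.
move=> [AR lR RE] dom; rewrite {1}RE; apply/seteqP; split=> h [a [b [Aa Ab ub ->]]].
  by exists a, b; split => //; apply: runit_sub ub; apply: dom.1.
by exists a, b; split => //; apply: (dominates_runit dom) => //; apply: AR.
Qed.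

Lemma pointW A R : A `<=` R -> local_ring R -> R `<=` center A R -> subring A -> point A R.
Proof.
move=> AR lR RC sA; split => //; apply/seteqP; split=> //; apply: center_sub => //.
exact: lR.1.
Qed.

Lemma point_sub A B R : point A R -> A `<=` B -> B `<=` R -> point B R.
Proof.
move=> [AR lR RE] AB BR; split=> //; apply/seteqP; split.
  rewrite {1}RE => h [a [b [Aa Ab ub ->]]]; exists a, b; split=> //; exact: AB.
by apply: center_sub => //; exact: lR.1.
Qed.

Lemma localize_unit A p a b : subring A -> prime_ideal_of A p -> A a -> A b ->
  ~ p b -> runit (localize A p) (a / b) <-> ~ p a.
Proof.
move=> sA pp Aa Ab pb; have [pA p0 p1 [pD pM pP]] := pp.
have nz c : ~ p c -> c != 0 by move=> nc; apply: contra_notN nc => /eqP->.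
have b0 := nz _ pb.
split=> [[ab0 _ [c [d [Ac Ad pd E]]]] pa|pa].
  have a0 : a != 0 by apply: contraNneq ab0 => ->; rewrite mul0r.
  have d0 := nz _ pd.
  have Ebd : b * d = c * a.
    by move: E; rewrite invf_div => /(congr1 (fun z => z * (a * d))); rewrite mulrA divfK // => ->; field.
  have : p (b * d) by rewrite Ebd; apply: pM.
  by move=> /pP-/(_ Ab Ad)[].
have a0 := nz _ pa; split; first by rewrite mulf_neq0 // invr_eq0.
  by exists a, b.
by exists b, a; rewrite invf_div.
Qed.

Lemma localize_subring A p : subring A -> prime_ideal_of A p -> subring (localize A p).
Proof.
move=> sA [pA p0 p1 [pD pM pP]].
have nz c : ~ p c -> c != 0 by move=> nc; apply: contra_notN nc => /eqP->.
split.
- by exists 1, 1; rewrite divr1; split=> //; apply: subring1.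
- move=> _ _ [a [b [Aa Ab pb ->]]] [c [d [Ac Ad pd ->]]].
  exists (a * d - c * b), (b * d); split.
  + by apply: subringB => //; apply: subringM.
  + exact: subringM.
  + by move/pP => /(_ Ab Ad)[].
  + by field; rewrite (nz _ pb) (nz _ pd).
- move=> _ _ [a [b [Aa Ab pb ->]]] [c [d [Ac Ad pd ->]]].
  exists (a * c), (b * d); split.
  + exact: subringM.
  + exact: subringM.
  + by move/pP => /(_ Ab Ad)[].
  + by rewrite mulf_div.
Qed.

Lemma localize_maxid A p a b : subring A -> prime_ideal_of A p -> A a -> A b ->
  ~ p b -> maxid (localize A p) (a / b) <-> p a.
Proof.
move=> sA pp Aa Ab pb; have ue := localize_unit sA pp Aa Ab pb; split.
  by case=> _ nu; apply: contrapT => /ue.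
move=> pa; split; first by exists a, b.
by move/ue.
Qed.

Lemma sub_localize A p : subring A -> prime_ideal_of A p -> A `<=` localize A p.
Proof.
move=> sA [_ _ p1 _] a Aa; exists a, 1; rewrite divr1; split=> //; exact: subring1.
Qed.

Lemma localize_maxid1 A p a : subring A -> prime_ideal_of A p -> A a ->
  maxid (localize A p) a <-> p a.
Proof.
move=> sA pp Aa; rewrite -{1}(divr1 a); apply: localize_maxid => //.
  exact: subring1.
by case: pp.
Qed.

Lemma localize_local A p : subring A -> prime_ideal_of A p -> local_ring (localize A p).
Proof.
move=> sA pp; have sL := localize_subring sA pp; split=> //.
move=> f g mf mg; have [a [b [Aa Ab pb Ef]]] := maxid_in mf.
have [c [d [Ac Ad pd Eg]]] := maxid_in mg; move: mf mg; rewrite {}Ef {}Eg.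
have [pA p0 p1 [pD pM pP]] := pp.
have nz e : ~ p e -> e != 0 by move=> nc; apply: contra_notN nc => /eqP->.
move=> /localize_maxid-/(_ sA pp Aa Ab pb) pa /localize_maxid-/(_ sA pp Ac Ad pd) pc.
have -> : a / b + c / d = (d * a + b * c) / (b * d).
  by field; rewrite (nz _ pb) (nz _ pd).
apply/localize_maxid => //.
- by apply: subringD => //; apply: subringM.
- exact: subringM.
- by move/pP => /(_ Ab Ad)[].
- by apply: pD; apply: pM.
Qed.

Lemma localize_point A p : subring A -> prime_ideal_of A p -> point A (localize A p).
Proof.
move=> sA pp; have lL := localize_local sA pp.
apply: pointW => //; first exact: sub_localize.
move=> h [a [b [Aa Ab pb ->]]]; exists a, b; split=> //.
rewrite -(divr1 b); apply/localize_unit => //; first exact: subring1.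
by case: pp.
Qed.

Lemma prime_contract A R : subring A -> local_ring R -> A `<=` R ->
  prime_ideal_of A (A `&` maxid R).
Proof.
move=> sA lR AR; have sR := lR.1; split.
- by move=> a [].
- by split; [exact: subring0 | exact: maxid0].
- by case=> _; apply: not_maxid1.
split.
- by move=> a b [Aa ma] [Ab mb]; split; [exact: subringD | exact: localD].
- by move=> a b Aa [Ab mb]; split; [exact: subringM | apply: maxidM => //; exact: AR].
move=> a b Aa Ab [_ mab].
by case: (maxidM_or sR (AR _ Aa) (AR _ Ab) mab) => m; [left|right].
Qed.

Lemma center_localize A R : A `<=` R -> center A R = localize A (A `&` maxid R).
Proof.
move=> AR; apply/seteqP; split=> h [a [b [Aa Ab ub ->]]]; exists a, b; split=> //.
  by case=> _ [].
by apply: not_maxid; [exact: AR | move=> mb; apply: ub].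
Qed.

Lemma specP A R : subring A -> spec A R <-> point A R.
Proof.
move=> sA; split=> [[p pp ->]|[AR lR RE]]; first exact: localize_point.
exists (A `&` maxid R); first exact: prime_contract.
by rewrite {1}RE center_localize.
Qed.

End LocalRings.

(** * Blow-ups *)

Section Blowups.
Variables (n : nat) (k : numClosedFieldType) (K : function_field n k).
Implicit Types (A B R p q S V E L : set K) (f g h t : K) (M : set (set K)).

Definition has_cst R := forall c, R (cst K c).

Lemma subalg_has_cst S : has_cst (subalg K S).
Proof. exact: subalg_cst. Qed.

Lemma subalg_subring S : subring (subalg K S).
Proof.
have S1 : subalg K S 1 by rewrite -(rmorph1 (cst K)); apply: subalg_cst.
split=> // f g Sf Sg; last exact: subalg_mul.
rewrite -mulN1r; apply: subalg_add => //; apply: subalg_mul => //.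
by rewrite -(rmorphN1 (cst K)); apply: subalg_cst.
Qed.
#[local] Hint Resolve subalg_subring : core.

Lemma subalg_sub S R : subring R -> has_cst R -> S `<=` R -> subalg K S `<=` R.
Proof.
move=> sR cR SR; apply: subalg_min => // f g; first exact: subringD.
exact: subringM.
Qed.

Lemma subalg_sub_subalg S S' : S `<=` subalg K S' -> subalg K S `<=` subalg K S'.
Proof. by move=> SS; apply: subalg_sub => //; apply: subalg_has_cst. Qed.

Lemma subalg_eq S S' : S `<=` subalg K S' -> S' `<=` subalg K S ->
  subalg K S = subalg K S'.
Proof. by move=> SS' S'S; apply/seteqP; split; apply: subalg_sub_subalg. Qed.

Lemma ideal_of_sub A S : subring A -> S `<=` A -> ideal_of K A S `<=` A.
Proof.
move=> sA SA; apply: ideal_of_min; first exact: subring0.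
  by move=> a f Aa Sf; apply: subringM => //; apply: SA.
by move=> f g; apply: subringD.
Qed.

Lemma ideal_ofM A S a f : subring A -> A a -> ideal_of K A S f -> ideal_of K A S (a * f).
Proof.
move=> sA Aa; apply: (ideal_of_min (T := [set f | ideal_of K A S (a * f)])) => /=.
- by rewrite mulr0; apply: ideal_of0.
- by move=> b g Ab Sg; rewrite mulrA; apply: ideal_of_gen => //; apply: subringM.
- by move=> g h ig ih; rewrite mulrDr; apply: ideal_of_add.
Qed.

Lemma ideal_of_incl A S f : subring A -> S f -> ideal_of K A S f.
Proof. by move=> sA Sf; rewrite -(mul1r f); apply: ideal_of_gen => //; apply: subring1. Qed.

Lemma ideal_of_maxid A S V : local_ring V -> A `<=` V -> S `<=` maxid V ->
  ideal_of K A S `<=` maxid V.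
Proof.
move=> lV AV SV; have sV := lV.1; apply: ideal_of_min; first exact: maxid0.
  by move=> a f Aa Sf; apply: maxidM => //; [exact: AV | exact: SV].
by move=> f g; apply: localD.
Qed.

Definition good M := forall R, M R -> local_ring R /\ has_cst R.

Definition separated M := forall V R1 R2, valuation_ring V -> M R1 -> M R2 ->
  dominates V R1 -> dominates V R2 -> R1 = R2.

Lemma separated_point A : separated (point A).
Proof. by move=> V R1 R2 vV p1 p2 d1 d2; rewrite (point_center p1 d1) (point_center p2 d2). Qed.

Definition balg L R g := subalg K (R `|` [set f / g | f in ideal_stalk L R]).

Lemma balg_sub L R g R' : local_ring R' -> has_cst R -> R `<=` R' ->
  (forall f, ideal_stalk L R f -> R' (f / g)) -> balg L R g `<=` R'.
Proof.
move=> lR' cR RR' H; apply: subalg_sub; first exact: lR'.1.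
  by move=> c; apply: RR'.
by move=> f [/RR'//|[h Ih <-]]; apply: H.
Qed.

Lemma sub_balg L R g : R `<=` balg L R g.
Proof. by move=> f Rf; apply: subalg_gen; left. Qed.

Lemma quo_balg L R g f : ideal_stalk L R f -> balg L R g (f / g).
Proof. by move=> If; apply: subalg_gen; right; exists f. Qed.

Lemma blowupP M L R' : blowup M L R' <-> exists R g,
  [/\ M R, ideal_stalk L R g, g != 0, dominates R' R & point (balg L R g) R'].
Proof.
split=> [[R [g [q [MR [Ig g0] pq mq ->]]]]|[R [g [MR Ig g0 [RR' mm] pR']]]].
  exists R, g; split=> //; last exact: (localize_point (subalg_subring _) pq).
  split.
    apply: subset_trans (sub_localize (subalg_subring _) pq); exact: sub_balg.
  move=> f mf; apply/localize_maxid1 => //; last exact: mq.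
  by apply: sub_balg; apply: maxid_in.
have [BR lR' R'E] := pR'.
exists R, g, (balg L R g `&` maxid R'); split=> //.
- exact: prime_contract.
- by move=> f mf; split; [apply: sub_balg; apply: maxid_in | apply: mm].
- by rewrite -center_localize.
Qed.

Lemma blowup_dom M L R' : blowup M L R' -> exists2 R, M R & dominates R' R.
Proof. by move/blowupP => [R [g [MR _ _ d _]]]; exists R. Qed.

(** Two points of the blow-up dominated by V lie over the same point of M, with chart denominators
    g1 and g2. Both g2/g1 and its inverse lie in V, so g2/g1 is a unit of V, hence of R1, which
    therefore contains the algebra of the second chart. *)
Lemma blowup_separated M L : good M -> separated M -> separated (blowup M L).
Proof.
move=> gM sM.
have half V R1 R2 : valuation_ring V -> blowup M L R1 -> blowup M L R2 ->
  dominates V R1 -> dominates V R2 -> R2 `<=` R1.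
  move=> vV /blowupP[S1 [g1 [MS1 Ig1 g10 d1 p1]]] /blowupP[S2 [g2 [MS2 Ig2 g20 d2 p2]]].
  move=> dV1 dV2; have E : S2 = S1.
    by apply: (sM V) => //; [exact: dominates_trans d2|exact: dominates_trans d1].
  move: MS2 Ig2 d2 p2; rewrite {}E => _ Ig2 d2 p2.
  have [B1 lR1 R1E] := p1; have [B2 lR2 R2E] := p2.
  have u : runit V (g2 / g1).
    split; first by rewrite mulf_neq0 // invr_eq0.
      by apply: dV1.1; apply: B1; apply: quo_balg.
    by rewrite invf_div; apply: dV2.1; apply: B2; apply: quo_balg.
  have [_ _] : runit R1 (g2 / g1).
    by apply: dominates_runit u => //; apply: B1; apply: quo_balg.
  rewrite invf_div => R1g.
  have B21 : balg L S1 g2 `<=` R1.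
    apply: balg_sub => //; [by case: (gM _ MS1) | by case: d1 |].
    move=> f If; have -> : f / g2 = f / g1 * (g1 / g2) by rewrite mulrA divfK.
    by apply: subringM => //; [exact: lR1.1 | apply: B1; apply: quo_balg].
  rewrite (point_center p2 dV2) => h [a [b [Ba Bb ub ->]]].
  have [_ _ R1b] : runit R1 b by apply: dominates_runit ub => //; apply: B21.
  by apply: subringM => //; [exact: lR1.1 | apply: B21].
move=> V R1 R2 vV b1 b2 d1 d2; apply/seteqP; split; exact: (half V).
Qed.

(** Over a valuation ring the ideal of the centre becomes generated by one of its own elements; this
    element is the denominator of the chart of the blow-up in which V has its centre. *)
Definition principal_stalks M L := forall V R, valuation_ring V -> M R -> dominates V R ->
  exists g, [/\ ideal_stalk L R g, g != 0 & forall f, ideal_stalk L R f -> V (f / g)].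

Lemma blowup_proper M L V R : good M -> principal_stalks M L -> valuation_ring V ->
  M R -> dominates V R -> exists2 R', blowup M L R' & dominates V R'.
Proof.
move=> gM pS vV MR d; have [g [Ig g0 Vg]] := pS _ _ vV MR d.
have lV := valuation_local vV; have [lR cR] := gM _ MR.
have BV : balg L R g `<=` V by apply: balg_sub => //; case: d.
have [pC dC] := center_point (subalg_subring _) lV BV.
exists (center (balg L R g) V) => //; apply/blowupP; exists R, g; split=> //.
have RC : R `<=` center (balg L R g) V.
  by apply: (subset_trans (@sub_balg L R g)); apply: sub_center; [exact: subalg_subring | exact: lV.1].
split=> // f mf; apply/(center_maxid _ (subalg_subring _) lV.1 BV).
by split; [apply: RC; apply: maxid_in | apply: d.2].
Qed.

Lemma valuation_min V (s : seq K) : valuation_ring V -> has (fun f => f != 0) s ->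
  exists g, [/\ g \in s, g != 0 & forall f, f \in s -> V (f / g)].
Proof.
move=> vV; have sV := valuation_subring vV; elim: s => //= a s IH.
have [[g [gs g0 Hg]]|nH] := pselect (exists g, [/\ g \in s, g != 0 & forall f, f \in s -> V (f / g)]).
  move=> _; case: vV => _ _ /(_ (a / g)); rewrite invf_div => -[Va|Va].
    by exists g; split=> //; [rewrite inE gs orbT | move=> f; rewrite inE => /predU1P[->|/Hg]].
  have [a0|a0] := eqVneq a 0.
    exists g; split=> //; first by rewrite inE gs orbT.
    move=> f; rewrite inE => /predU1P[->|/Hg //]; rewrite a0 mul0r; exact: subring0.
  exists a; split=> //; first by rewrite inE eqxx.
  move=> f; rewrite inE => /predU1P[->|/Hg Vf].
    by rewrite divff //; apply: subring1.
  have -> : f / a = f / g * (g / a) by rewrite mulrA divfK.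
  exact: subringM.
have nz f : f \in s -> f = 0.
  move=> fs; apply: contra_notP nH => /eqP f0; apply: IH; apply/hasP; by exists f.
case: eqVneq => [a0 /=|a0 _]; first by move=> /IH.
exists a; split=> //; first by rewrite inE eqxx.
move=> f; rewrite inE => /predU1P[->|/nz ->].
  by rewrite divff //; apply: subring1.
by rewrite mul0r; apply: subring0.
Qed.

Lemma principal_stalk V L R (s : seq K) : valuation_ring V -> dominates V R -> subring R ->
  has (fun f => f != 0) s -> ideal_stalk L R = ideal_of K R [set` s] ->
  exists g, [/\ ideal_stalk L R g, g != 0 & forall f, ideal_stalk L R f -> V (f / g)].
Proof.
move=> vV [RV _] sR hs ->; have [g [gs g0 Hg]] := valuation_min vV hs.
have sV := valuation_subring vV.
exists g; split=> //; first exact: ideal_of_incl.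
apply: (ideal_of_min (T := [set f | V (f / g)])) => /=.
- by rewrite mul0r; apply: subring0.
- by move=> a f Ra sf; rewrite -mulrA; apply: subringM => //; [apply: RV|apply: Hg].
- by move=> f h Vf Vh; rewrite mulrDl; apply: subringD.
Qed.

Lemma ideal_stalk_out L R : ~ R `<=` L -> ideal_stalk L R = R.
Proof. by move=> nRL; apply/seteqP; split=> f; [case | move=> Rf; split]. Qed.

Lemma balg_out L R g : local_ring R -> has_cst R -> ~ R `<=` L -> runit R g -> balg L R g = R.
Proof.
move=> lR cR nRL [g0 Rg Rg']; apply/seteqP; split; last exact: sub_balg.
apply: balg_sub => // f; rewrite ideal_stalk_out // => Rf.
by apply: subringM => //; exact: lR.1.
Qed.

Lemma point_self R : local_ring R -> point R R.
Proof.
move=> lR; apply: pointW => //; last exact: lR.1.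
by apply: sub_center; exact: lR.1.
Qed.

Lemma blowup_out M L R : good M -> M R -> ~ R `<=` L -> blowup M L R.
Proof.
move=> gM MR nRL; have [lR cR] := gM _ MR; have sR := lR.1.
apply/blowupP; exists R, 1; split=> //.
- by rewrite ideal_stalk_out //; apply: subring1.
- exact: oner_neq0.
- exact: dominates_refl.
- by rewrite balg_out //; [exact: point_self | exact: runit1].
Qed.

(** Off the centre the ideal stalk contains 1, so 1/g lies in the blow-up algebra; g is then
    invertible in R', hence in R by domination, and R[I/g] = R. *)
Lemma blowup_out_inv M L R R' g : good M -> M R -> ~ R `<=` L ->
  ideal_stalk L R g -> g != 0 -> dominates R' R -> point (balg L R g) R' -> R' = R.
Proof.
move=> gM MR nRL Ig g0 d pR'; have [lR cR] := gM _ MR; have sR := lR.1.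
have [BR' lR' _] := pR'.
have Rg : R g by rewrite ideal_stalk_out in Ig.
have uR' : runit R' g.
  split=> //; first exact: d.1.
  rewrite -div1r; apply: BR'; apply: quo_balg; rewrite ideal_stalk_out //; exact: subring1.
have uR := dominates_runit d Rg uR'.
have BE := balg_out lR cR nRL uR; rewrite BE in pR'.
by rewrite (point_center pR' (dominates_refl _)) -(point_center (point_self lR) d).
Qed.

(** Since f vanishes at L, no point where f is invertible lies in the closure of L, and outside this
    closure the blow-up changes nothing. *)
Lemma blowup_unit M L f R : good M -> (forall R, M R -> R f) -> maxid L f ->
  (blowup M L R /\ runit R f) <-> (M R /\ runit R f).
Proof.
move=> gM Mf Lf.
have nL S : runit S f -> ~ S `<=` L by move=> u /runit_sub/(_ u); apply: maxid_nu Lf.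
split=> [[/blowupP[S [g [MS Ig g0 d p]]] u]|[MR u]]; last first.
  by split=> //; apply: blowup_out => //; apply: nL.
have uS : runit S f by apply: dominates_runit d _ u; apply: Mf.
by rewrite (blowup_out_inv gM MS (nL _ uS) Ig g0 d p).
Qed.

(* The pairs in [ss] consist of generators of the algebra of a chart and of
   generators of the ideal of the centre on it. *)
Lemma blowup_spec M L (ss : seq (seq K * seq K)) :
  M = [set R | exists2 p : seq K * seq K, p \in ss & point (subalg K [set` p.1]) R] ->
  (forall (p : seq K * seq K) R, p \in ss -> point (subalg K [set` p.1]) R ->
     ideal_stalk L R = ideal_of K R [set` p.2]) ->
  forall R', blowup M L R' <-> exists (p : seq K * seq K) g, [/\ p \in ss, g \in p.2, g != 0 &
    point (subalg K [set` p.1 ++ [seq f / g | f <- p.2]]) R'].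
Proof.
move=> ME IE R'; split.
  move=> /blowupP[R [g [+ Ig g0 d pB]]]; rewrite ME => -[[s c] /= pss pR].
  have [AR lR RE] := pR; have sR := lR.1; have [BR' lR' R'E] := pB; have sR' := lR'.1.
  have IR := IE _ _ pss pR; rewrite /= in IR.
  have cI f : f \in c -> ideal_stalk L R f by move=> fc; rewrite IR; apply: ideal_of_incl.
  have BI f : ideal_stalk L R f -> R' (f / g) by move=> If; apply: BR'; apply: quo_balg.
  (* Some generator h of the centre has h/g invertible at R': otherwise 1 = g/g, a combination of
     the quotients of the generators by g, would be a non-unit. Dividing by h instead of g gives one
     of the listed charts. *)
  have [[h hc uh]|nh] := pselect (exists2 h, h \in c & runit R' (h / g)); last first.
    have : maxid R' (g / g).
      move: Ig; rewrite {1}IR; apply: (ideal_of_min (T := [set f | maxid R' (f / g)])) => /=.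
      - by rewrite mul0r; apply: maxid0.
      - move=> a f Ra fc; rewrite -mulrA; apply: maxidM => //; first exact: d.1.
        have [u|//] := runit_or (BI _ (cI _ fc)); by case: nh; exists f.
      - by move=> f h mf mh; rewrite mulrDl; apply: localD.
    by rewrite divff // => /not_maxid1.
  have h0 : h != 0 by apply: contraNneq (runit_neq0 uh) => ->; rewrite mul0r.
  exists (s, c), h; split=> //=; set A' := subalg K _.
  have AA' : subalg K [set` s] `<=` A'.
    apply: subalg_sub_subalg => f fs; apply: subalg_gen => /=.
    by rewrite mem_cat; apply/orP; left.
  have A'h f : f \in c -> A' (f / h).
    move=> fc; apply: subalg_gen => /=; rewrite mem_cat; apply/orP; right.
    by apply/mapP; exists f.
  have A'R' : A' `<=` R'.
    apply: subalg_sub => //; first by move=> a; apply: BR'; apply: subalg_cst.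
    move=> f /=; rewrite mem_cat => /orP[fs|/mapP[e ec ->]].
      by apply: d.1; apply: AR; apply: subalg_gen.
    have -> : e / h = e / g * (h / g)^-1 by field; rewrite g0 h0.
    apply: subringM => //; first by apply: BI; apply: cI.
    by case: uh.
  apply: pointW => //; last exact: subalg_subring.
  rewrite -/A'.
  have sA' : subring A' := subalg_subring _.
  have sC := subring_center sA' sR'.
  have uC f : center A' R' f -> runit R' f -> runit (center A' R') f.
    by move=> cf u; apply/center_runit.
  have RC : R `<=` center A' R'.
    rewrite RE => _ [a [b [Aa Ab ub ->]]]; exists a, b; split=> //; [exact: AA'..|].
    by apply: runit_sub ub; apply: d.1.
  have IC f : ideal_stalk L R f -> center A' R' (f / h).
    rewrite IR; apply: (ideal_of_min (T := [set f | center A' R' (f / h)])) => /=.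
    - by rewrite mul0r; apply: subring0.
    - move=> a e Ra ec; rewrite -mulrA; apply: subringM => //; first exact: RC.
      by apply: sub_center => //; apply: A'h.
    - by move=> e1 e2 C1 C2; rewrite mulrDl; apply: subringD.
  have Cg : center A' R' (h / g).
    rewrite -invf_div; apply: runit_in; apply: runitV; apply: uC; first exact: IC.
    by rewrite -invf_div; apply: runitV.
  have BC : balg L R g `<=` center A' R'.
    apply: subalg_sub => //.
      by move=> a; apply: sub_center => //; apply: subalg_cst.
    move=> f [/RC//|[e Ie <-]].
    have -> : e / g = e / h * (h / g) by rewrite mulrA divfK.
    by apply: subringM => //; apply: IC.
  rewrite {1}R'E => _ [a [b [Ba Bb ub ->]]]; apply: subringM => //; first exact: BC.
  by apply: runit_in; apply: runitV; apply: uC => //; apply: BC.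
move=> [[s c] [g [pss gc g0 /=]]]; set A' := subalg K _ => pR'.
have [A'R' lR' R'E] := pR'; have sR' := lR'.1.
have AA' : subalg K [set` s] `<=` A'.
  apply: subalg_sub_subalg => f fs; apply: subalg_gen => /=.
  by rewrite mem_cat; apply/orP; left.
have [pR d] := center_point (subalg_subring _) lR' (subset_trans AA' A'R').
set R := center _ R' in pR d; have IR := IE _ _ pss pR; rewrite /= in IR.
have [AR lR _] := pR; have sR := lR.1.
have cR : has_cst R by move=> a; apply: AR; apply: subalg_cst.
apply/blowupP; exists R, g; split=> //.
- by rewrite ME; exists (s, c).
- by rewrite IR; apply: ideal_of_incl.
apply: point_sub pR' _ _.
  apply: subalg_sub; [exact: subalg_subring | exact: subalg_has_cst |].
  move=> f /=; rewrite mem_cat => /orP[fs|/mapP[e ec ->]].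
    by apply: sub_balg; apply: AR; apply: subalg_gen.
  by apply: quo_balg; rewrite IR; apply: ideal_of_incl.
apply: balg_sub => //; first by case: d.
move=> f; rewrite IR; apply: (ideal_of_min (T := [set f | R' (f / g)])) => /=.
- by rewrite mul0r; apply: subring0.
- move=> a e Ra ec; rewrite -mulrA; apply: subringM => //; first exact: d.1.
  apply: A'R'; apply: subalg_gen => /=; rewrite mem_cat; apply/orP; right.
  by apply/mapP; exists e.
- by move=> f1 f2 V1 V2; rewrite mulrDl; apply: subringD.
Qed.

(** The last hypothesis on c says that it generates the prime ideal of L in A, and localization
    preserves this. If R is not in the closure of L, some generator is a unit of R and the ideal is
    all of R: otherwise every denominator of R would be a unit of L and R would be contained in
    L. *)
Lemma ideal_stalk_in A L R (c : seq K) : subring A -> point A L ->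
  [set` c] `<=` maxid L -> [set` c] `<=` A ->
  (forall a, A a -> maxid L a -> ideal_of K A [set` c] a) ->
  point A R -> ideal_stalk L R = ideal_of K R [set` c].
Proof.
move=> sA [AL lL LE] cL cA H [AR lR RE]; have sR := lR.1.
have [RL|nRL] := pselect (R `<=` L).
  apply/seteqP; split=> f.
    move=> [Rf /(_ RL) mf]; move: (Rf); rewrite {1}RE => -[a [b [Aa Ab ub Ef]]].
    have ma : maxid L a.
      have -> : a = b * f by rewrite Ef mulrCA divff ?mulr1 // (runit_neq0 ub).
      by apply: maxidM => //; [exact: lL.1 | apply: AL].
    have := H _ Aa ma; rewrite Ef mulrC => I; apply: ideal_ofM => //; first by case: ub.
    apply: ideal_of_min I; [exact: ideal_of0| |exact: ideal_of_add].
    by move=> e g Ae gc; apply: ideal_of_gen => //; apply: AR.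
  move=> I; split=> [|_].
    by apply: ideal_of_sub I => // g /cA/AR.
  by apply: ideal_of_maxid I.
rewrite ideal_stalk_out //.
have [[g gc ug]|nu] := pselect (exists2 g, g \in c & runit R g).
  apply/seteqP; split=> f; last by apply: ideal_of_sub => // e /cA/AR.
  move=> Rf; have -> : f = (f / g) * g by rewrite divfK // (runit_neq0 ug).
  by apply: ideal_of_gen => //; apply: subringM => //; case: ug.
case: nRL; rewrite {1}RE => _ [a [b [Aa Ab ub ->]]].
apply: subringM; [exact: lL.1|exact: AL|].
apply: runit_in; apply: runitV; apply: not_maxid; first exact: AL.
move=> mb; apply: (maxid_nu _ ub); apply: (ideal_of_maxid lR AR _ (H _ Ab mb)).
move=> g gc; have [u|//] := runit_or (AR _ (cA _ gc)).
by case: nu; exists g.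
Qed.

(** Charts that miss the centre are recorded with the single generator 1, so that all charts of a
    blow-up are described by the same kind of data. *)
Lemma ideal_stalk_one A L R : ~ A `<=` L -> point A R ->
  ideal_stalk L R = ideal_of K R [set` [:: 1]].
Proof.
move=> nAL [AR lR _]; have sR := lR.1; rewrite ideal_stalk_out; last first.
  by move=> RL; apply: nAL; apply: subset_trans RL.
apply/seteqP; split=> f; last first.
  by apply: ideal_of_sub => // e /=; rewrite inE => /eqP->; apply: subring1.
by move=> Rf; rewrite -(mulr1 f); apply: ideal_of_gen => //=; rewrite inE.
Qed.

End Blowups.

(** * Systems of coordinates *)

Lemma mpoly_ring_ind (n : nat) (R : comNzRingType) (P : {mpoly R[n]} -> Prop) :
  (forall c, P c%:MP) -> (forall i, P 'X_i) ->
  (forall p q, P p -> P q -> P (p + q)) ->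
  (forall p q, P p -> P q -> P (p * q)) -> forall p, P p.
Proof.
move=> PC PX PD PM; have PXm m : P 'X_[m].
  rewrite mpolyXE_id; elim/big_rec: _ => [|i q _ Pq]; first by rewrite -mpolyC1; apply: (PC).
  apply: (PM) => //; elim: (m i) => [|d IH]; first by rewrite expr0 -mpolyC1; apply: (PC).
  by rewrite exprS; apply: (PM).
apply: mpolyind => [|c m p _ _ Pp]; first by rewrite -mpolyC0; apply: (PC).
by apply: (PD) => //; rewrite -mul_mpolyC; apply: (PM).
Qed.

Lemma msize_mderiv (n : nat) (R : nzRingType) (p : {mpoly R[n]}) i :
  p != 0 -> (msize p^`M(i) < msize p)%N.
Proof.
move=> p0; rewrite msizeE big_seq; have p1 : (0 < msize p)%N by rewrite lt0n msize_poly_eq0.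
elim/big_ind: _ => // [a b ap bp|m]; first by rewrite gtn_max ap bp.
rewrite mcoeff_msupp mcoeff_deriv => c0.
have /msize_mdeg_lt : (m + U_(i))%MM \in msupp p.
  by rewrite mcoeff_msupp; apply: contraNneq c0 => ->; rewrite mul0rn.
by rewrite mdegD mdeg1 addn1.
Qed.

Section Frames.
Variables (n : nat) (k : numClosedFieldType) (K : function_field n k).
Implicit Types (A B R S V E L : set K) (f g h t : K) (w : 'I_n -> K) (p q : {mpoly k[n]}).
#[local] Hint Resolve subalg_subring : core.

Lemma fderiv0 i : fderiv K i 0 = 0.
Proof. by have := fderiv_cst K i 0; rewrite rmorph0. Qed.

Lemma fderiv1 i : fderiv K i 1 = 0.
Proof. by have := fderiv_cst K i 1; rewrite rmorph1. Qed.

Lemma fderivV i f : f != 0 -> fderiv K i f^-1 = - fderiv K i f / f ^+ 2.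
Proof.
move=> f0; have : fderiv K i (f * f^-1) = 0 by rewrite divff // fderiv1.
rewrite fderivM => /eqP; rewrite addrC addr_eq0 => /eqP E.
by apply: (mulfI f0); rewrite E; field.
Qed.

Lemma fderiv_div i f g : g != 0 ->
  fderiv K i (f / g) = (fderiv K i f * g - f * fderiv K i g) / g ^+ 2.
Proof. by move=> g0; rewrite fderivM fderivV //; field. Qed.

Definition ev w : {mpoly k[n]} -> K := mmap (cst K) w.
HB.instance Definition _ w := GRing.RMorphism.copy (ev w) (mmap (cst K) w).

Lemma evC w c : ev w c%:MP = cst K c. Proof. by rewrite /ev mmapC. Qed.
Lemma evX w i : ev w 'X_i = w i. Proof. by rewrite /ev mmapX mmap1U. Qed.

Definition alg w := subalg K (range w).

Lemma alg_subring w : subring (alg w). Proof. exact: subalg_subring. Qed.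
#[local] Hint Resolve alg_subring : core.

Lemma alg_gen w i : alg w (w i).
Proof. by apply: subalg_gen; exists i. Qed.

Lemma alg_cst w c : alg w (cst K c).
Proof. exact: subalg_cst. Qed.

Lemma algP w h : alg w h <-> exists p, h = ev w p.
Proof.
split=> [|[p ->]].
  apply: (subalg_min (T := [set h | exists p, h = ev w p])) => /=.
  - by move=> c; exists c%:MP; rewrite evC.
  - by move=> _ [i _ <-]; exists 'X_i; rewrite evX.
  - by move=> _ _ [p ->] [q ->]; exists (p + q); rewrite rmorphD.
  - by move=> _ _ [p ->] [q ->]; exists (p * q); rewrite rmorphM.
elim/mpoly_ring_ind: p => [c|i|p q Ap Aq|p q Ap Aq].
- by rewrite evC; apply: alg_cst.
- by rewrite evX; apply: alg_gen.
- by rewrite rmorphD; apply: subringD.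
- by rewrite rmorphM; apply: subringM.
Qed.

Lemma alg_ev w p : alg w (ev w p).
Proof. by apply/algP; exists p. Qed.

Lemma fderiv_ev i w p : fderiv K i (ev w p) = \sum_l fderiv K i (w l) * ev w p^`M(l).
Proof.
elim/mpoly_ring_ind: p => [c|j|p q Ep Eq|p q Ep Eq].
- rewrite evC fderiv_cst big1 // => l _; by rewrite mderivC rmorph0 mulr0.
- rewrite evX (bigD1 j) //= big1 ?addr0.
    by rewrite mderivX mnmE eqxx scale1r -[X in (X - _)%MM]addm0 addmC addmK mpolyX0 rmorph1 mulr1.
  by move=> l lj; rewrite mderivX mnmE eq_sym (negPf lj) scale0r rmorph0 mulr0.
- by rewrite rmorphD fderivD Ep Eq -big_split; apply: eq_bigr => l _; rewrite mderivD rmorphD mulrDr.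
- rewrite rmorphM fderivM Ep Eq mulr_suml mulr_sumr -big_split; apply: eq_bigr => l _ /=.
  by rewrite mderivM rmorphD !rmorphM /=; ring.
Qed.

(** Coordinates of an affine space birational to X: in characteristic zero the non-vanishing
    Jacobian determinant encodes algebraic independence, and the second clause says that K is the
    fraction field of k[w]. *)
Definition frame w := jac w != 0 /\
  forall h, exists a b, [/\ alg w a, alg w b, b != 0 & h = a / b].

(** Differentiating a relation p(w) = 0 gives a linear system with invertible matrix for the values
    of the partial derivatives of p. These are relations of smaller degree, hence zero by induction,
    and p is a constant. Applied to [coord K], this yields the algebraic independence that
    [function_field] does not postulate. *)
Lemma jac_ev_inj w p : jac w != 0 -> ev w p = 0 -> p = 0.
Proof.
move=> J0; move: {-1}(msize p) (leqnn (msize p)) => d; elim: d p => [|d IH] p.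
  by rewrite leqn0 msize_poly_eq0 => /eqP.
move=> pd evp; apply: contrapT => /eqP p0.
have dp l : p^`M(l) = 0.
  apply: IH; first by rewrite -ltnS; apply: leq_trans pd; apply: msize_mderiv.
  pose M := \matrix_(i, j) fderiv K i (w j); pose r := \col_j ev w p^`M(j).
  have : M *m r = 0.
    apply/matrixP => i j; have E : fderiv K i (ev w p) = 0 by rewrite evp fderiv0.
    rewrite !mxE -[RHS]E fderiv_ev.
    by apply: eq_bigr => j' _; rewrite !mxE.
  have uM : M \in unitmx by rewrite unitmxE unitfE.
  by move/(congr1 (mulmx (invmx M))); rewrite mulKmx // mulmx0 => /matrixP/(_ l 0); rewrite !mxE.
(* Characteristic zero: the derivative in a variable multiplies a coefficient by the exponent of
   that variable, so only the constant coefficient can survive. *)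
have pC : p = (p@_0)%:MP.
  apply/mpolyP => m; rewrite mcoeffC; case: eqVneq => [->|m0]; first by rewrite mulr1.
  rewrite mulr0; have [l ml] : exists l, (0 < m l)%N.
    apply: contrapT => nl; move: m0; apply/negP; rewrite negbK; apply/eqP/mnmP => l.
    by rewrite mnm0E; apply/eqP; rewrite -leqn0 leqNgt; apply/negP => ml; apply: nl; exists l.
  have := congr1 (mcoeff (m - U_(l))) (dp l); rewrite mcoeff_deriv mcoeff0 submK; last first.
    by apply/mnm_lepP => i; rewrite mnm1E; case: eqP => // <-.
  by move/eqP; rewrite mulrn_eq0 /= => /eqP.
move: evp p0; rewrite pC evC => /eqP; rewrite fmorph_eq0 => /eqP->.
by rewrite mpolyC0 eqxx.
Qed.

Lemma ev_inj w : frame w -> injective (ev w).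
Proof.
by case=> J0 _ p q E; apply/eqP; rewrite -subr_eq0; apply/eqP/(jac_ev_inj J0); rewrite rmorphB /= E subrr.
Qed.

Lemma frame_coord w : jac w != 0 -> (forall i, alg w (coord K i)) -> frame w.
Proof.
move=> J0 wc; split=> // h; have [p [q [q0 ->]]] := frac_coord h.
have sub r : alg w (mmap (cst K) (coord K) r).
  apply: (subalg_sub (S := range (coord K))) => //; first exact: subalg_has_cst.
    by move=> _ [i _ <-].
  exact: (alg_ev (coord K) r).
by exists (mmap (cst K) (coord K) p), (mmap (cst K) (coord K) q).
Qed.

(** The value of h at the point v of Spec k[w], as a relation, because the polynomial that
    represents h is determined only when w is a frame. Non-divisibility and non-invertibility in
    k[w] are certified by such values. *)
Definition at_point w (v : 'I_n -> k) h c := exists2 p, h = ev w p & p.@[v] = c.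

Lemma at_cst w v c : at_point w v (cst K c) c.
Proof. by exists c%:MP; rewrite ?evC ?mevalC. Qed.

Lemma at_gen w v i : at_point w v (w i) (v i).
Proof. by exists 'X_i; rewrite ?evX ?mevalXU. Qed.

Lemma atD w v f g c d : at_point w v f c -> at_point w v g d -> at_point w v (f + g) (c + d).
Proof. by case=> p -> <- [q -> <-]; exists (p + q); rewrite ?rmorphD ?mevalD. Qed.

Lemma atM w v f g c d : at_point w v f c -> at_point w v g d -> at_point w v (f * g) (c * d).
Proof. by case=> p -> <- [q -> <-]; exists (p * q); rewrite ?rmorphM ?mevalM. Qed.

Lemma atN w v f c : at_point w v f c -> at_point w v (- f) (- c).
Proof. by case=> p -> <-; exists (- p); rewrite ?rmorphN ?mevalN. Qed.

Lemma atX w v f c m : at_point w v f c -> at_point w v (f ^+ m) (c ^+ m).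
Proof. by case=> p -> <-; exists (p ^+ m); rewrite ?rmorphXn. Qed.

Lemma at1 w v : at_point w v 1 1.
Proof. by rewrite -{1}(rmorph1 (cst K)); apply: at_cst. Qed.

Lemma at0 w v : at_point w v 0 0.
Proof. by rewrite -{1}(rmorph0 (cst K)); apply: at_cst. Qed.

Lemma at_alg w v h : alg w h -> exists c, at_point w v h c.
Proof. by move/algP => [p ->]; exists p.@[v], p. Qed.

Lemma at_fun w v h c d : frame w -> at_point w v h c -> at_point w v h d -> c = d.
Proof. by move=> fw [p -> <-] [q /(ev_inj fw)-> <-]. Qed.

Lemma at_ndvd w v f t c : frame w -> t != 0 -> at_point w v f c -> c != 0 ->
  at_point w v t 0 -> ~ alg w (f / t).
Proof.
move=> fw t0 fc c0 tv /(at_alg v)[d] /atM/(_ tv); rewrite divfK // mulr0 => /(at_fun fw fc) c'.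
by rewrite c' eqxx in c0.
Qed.

Lemma frame_neq0 w i : frame w -> w i != 0.
Proof.
move=> fw; apply/eqP => w0; have := at_gen w (fun=> 1) i; rewrite w0.
by move=> /(at_fun fw (at0 _ _))/eqP; rewrite eq_sym oner_eq0.
Qed.

(** Restriction to the subspace where the coordinates in J vanish, kept inside the same polynomial
    ring: an idempotent endomorphism whose kernel is the ideal of the subspace. This ideal is prime
    because the ring is a domain. *)
Definition kill (J : pred 'I_n) : {mpoly k[n]} -> {mpoly k[n]} :=
  mmap (@mpolyC n k) (fun i => if J i then 0 else 'X_i).
HB.instance Definition _ J := GRing.RMorphism.copy (kill J) (mmap (@mpolyC n k) (fun i => if J i then 0 else 'X_i)).

Lemma killC J c : kill J c%:MP = c%:MP. Proof. by rewrite /kill mmapC. Qed.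
Lemma killX J i : kill J 'X_i = if J i then 0 else 'X_i.
Proof. by rewrite /kill mmapX mmap1U. Qed.

Lemma kill_kill J p : kill J (kill J p) = kill J p.
Proof.
elim/mpoly_ring_ind: p => [c|i|p q Ep Eq|p q Ep Eq].
- by rewrite !killC.
- by rewrite !killX; case: ifP => Ji; rewrite ?rmorph0 // killX Ji.
- by rewrite !rmorphD /= Ep Eq.
- by rewrite !rmorphM /= Ep Eq.
Qed.

Definition coord_ideal w (J : pred 'I_n) :=
  ideal_of K (alg w) [set h | exists2 j, J j & h = w j].

Lemma coord_ideal_kill w J p : coord_ideal w J (ev w p - ev w (kill J p)).
Proof.
have MI a h : alg w a -> coord_ideal w J h -> coord_ideal w J (a * h) by exact: ideal_ofM.
elim/mpoly_ring_ind: p => [c|i|p q Ep Eq|p q Ep Eq].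
- by rewrite killC subrr; apply: ideal_of0.
- rewrite killX; case: ifP => Ji; last by rewrite subrr; apply: ideal_of0.
  by rewrite rmorph0 subr0 evX; apply: ideal_of_incl => //; exists i.
- by rewrite !rmorphD /= opprD addrACA; apply: ideal_of_add.
- rewrite !rmorphM /=.
  have -> : ev w p * ev w q - ev w (kill J p) * ev w (kill J q) =
    ev w p * (ev w q - ev w (kill J q)) + ev w (kill J q) * (ev w p - ev w (kill J p)) by ring.
  by apply: ideal_of_add; apply: MI => //; apply: alg_ev.
Qed.

Lemma coord_idealP w J p : frame w -> coord_ideal w J (ev w p) <-> kill J p = 0.
Proof.
move=> fw; split=> [|Z]; last first.
  by have := coord_ideal_kill w J p; rewrite Z rmorph0 subr0.
suff H : coord_ideal w J `<=` [set h | exists2 q, h = ev w q & kill J q = 0].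
  by move=> /H [q /(ev_inj fw)->].
apply: ideal_of_min => /=.
- by exists 0; rewrite ?rmorph0.
- move=> a _ /algP[q ->] [j Jj ->]; exists (q * 'X_j); first by rewrite rmorphM /= evX.
  by rewrite rmorphM /= killX Jj mulr0.
- by move=> _ _ [q -> Eq] [r -> Er]; exists (q + r); rewrite rmorphD //= Eq Er addr0.
Qed.

Lemma coord_ideal_prime w J : frame w -> prime_ideal_of (alg w) (coord_ideal w J).
Proof.
move=> fw; split; [| exact: ideal_of0 | |split].
- by apply: ideal_of_sub => // _ [j _ ->]; apply: alg_gen.
- by rewrite -(rmorph1 (ev w)) coord_idealP // rmorph1 => /eqP; rewrite oner_eq0.
- by move=> a b; apply: ideal_of_add.
- by move=> a b Aa; apply: ideal_ofM.
- move=> _ _ /algP[p ->] /algP[q ->]; rewrite -rmorphM !coord_idealP // rmorphM /=.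
  by move/eqP; rewrite mulf_eq0 => /orP[]/eqP; [left|right].
Qed.

(** Serves to describe in a chart w a centre that was given by coordinates w'. Outside J the two
    systems agree, so killing J produces the same element from both. That element vanishes at L,
    hence is 0 by the description in w', and the ideal in w contains h. *)
Lemma coord_ideal_subst w w' J L h : frame w' -> (forall j, ~~ J j -> w j = w' j) ->
  L = localize (alg w') (coord_ideal w' J) -> alg w `<=` L ->
  (forall j, J j -> maxid L (w j)) -> alg w h -> maxid L h -> coord_ideal w J h.
Proof.
move=> fw' ww' LE AL mJ /algP[p ->] mp.
have pw' := coord_ideal_prime J fw'; have sA := alg_subring w'.
have lL : local_ring L by rewrite LE; apply: localize_local.
have E : ev w (kill J p) = ev w' (kill J p).
  elim/mpoly_ring_ind: (p) => [c|i|q r Eq Er|q r Eq Er].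
  - by rewrite killC !evC.
  - by rewrite killX; case: ifP => Ji; rewrite ?rmorph0 // !evX ww' ?Ji.
  - by rewrite !rmorphD /= Eq Er.
  - by rewrite !rmorphM /= Eq Er.
have mI : coord_ideal w J `<=` maxid L.
  by apply: ideal_of_maxid => // _ [j Jj ->]; apply: mJ.
have mk : maxid L (ev w (kill J p)).
  have -> : ev w (kill J p) = ev w p - (ev w p - ev w (kill J p)).
    by rewrite opprB addrC subrK.
  by apply: localB => //; apply: mI; apply: coord_ideal_kill.
move: mk; rewrite E LE => /(localize_maxid1 sA pw' (alg_ev _ _)).
rewrite coord_idealP // kill_kill => kp0.
by have := coord_ideal_kill w J p; rewrite kp0 rmorph0 subr0.
Qed.

End Frames.

(** * Prime elements, discrete valuation rings and orders *)

Section Orders.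
Variables (n : nat) (k : numClosedFieldType) (K : function_field n k).
Implicit Types (A B R S V E L : set K) (f g h t : K) (w : 'I_n -> K) (p q : {mpoly k[n]}).
#[local] Hint Resolve subalg_subring alg_subring : core.

Definition dvr E := local_ring E /\ exists2 t, t != 0 & uniformizer E t.

Lemma uniformizer_runit E t m : local_ring E -> uniformizer E t -> t != 0 ->
  runit E (t ^ m) -> m = 0.
Proof.
move=> lE [mt _] t0; have sE := lE.1; case: m => [[|m]|m] // u.
  by case: (maxid_nu (maxidX (m := m.+1) sE isT mt)).
by case: (maxid_nu (maxidX (m := m.+1) sE isT mt)); rewrite -[_ ^+ _]invrK; apply: runitV.
Qed.

Lemma uniformizer_neq0 E t : dvr E -> uniformizer E t -> t != 0.
Proof.
move=> [lE [s s0 us]] [_ Ht]; apply/eqP => t0.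
have [m] := Ht _ s0; rewrite t0 exp0rz; case: eqVneq => [_|_] /=.
  by rewrite invr1 mulr1 => u; case: (maxid_nu us.1).
by rewrite invr0 mulr0 => -[]; rewrite eqxx.
Qed.

Lemma runit_expz E t s m : local_ring E -> runit E (t / s) -> runit E (t ^ m / s ^ m).
Proof.
move=> lE u; have -> : t ^ m / s ^ m = (t / s) ^ m.
  by rewrite expfzMl exprz_inv invr_expz.
by apply: runitXz => //; exact: lE.1.
Qed.

Lemma subringXz R t m : subring R -> R t -> 0 <= m -> R (t ^ m).
Proof. by case: m => m // sR Rt _; apply: subringX. Qed.

Lemma runit_quo_in R f g : subring R -> R g -> runit R (f / g) -> R f.
Proof.
move=> sR Rg [fg0 Rfg _]; have [g0|g0] := eqVneq g 0.
  by rewrite g0 invr0 mulr0 eqxx in fg0.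
by rewrite -(divfK g0 f); apply: subringM.
Qed.

Lemma dvr_ge0 E s f m : local_ring E -> uniformizer E s -> s != 0 ->
  runit E (f / s ^ m) -> (0 <= m <-> E f) /\ (0 < m <-> maxid E f).
Proof.
move=> lE us s0 u; have sE := lE.1; have [ms _] := us; have Es := maxid_in ms.
have Ef : 0 <= m -> E f.
  by move=> m0; apply: runit_quo_in u => //; apply: subringXz.
have mf : 0 < m -> maxid E f.
  case: m u {Ef} => [[|m]|m] // u _.
  rewrite -(divfK (expf_neq0 m.+1 s0) f); apply: maxidM => //; first exact: runit_in u.
  exact: maxidX.
have neg : E f -> m < 0 -> False.
  case: m u {Ef mf} => m // u Ef _; apply: (maxid_nu _ u); rewrite NegzE -exprnN.
  by rewrite invrK; apply: maxidM => //; apply: maxidX.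
split; split=> //; first by move=> fE; rewrite leNgt; apply/negP => /(neg fE).
move=> mfE; have : 0 <= m by rewrite leNgt; apply/negP => /(neg (maxid_in mfE)).
rewrite le_eqVlt => /orP[/eqP m0|//]; move: u; rewrite -m0 divr1 => u.
by case: (maxid_nu mfE).
Qed.

Lemma uniformizer_quo E s t : dvr E -> uniformizer E s -> uniformizer E t -> E (t / s).
Proof.
move=> dE us ut; have [lE _] := dE; have sE := lE.1.
have s0 := uniformizer_neq0 dE us; have t0 := uniformizer_neq0 dE ut.
have [a ua] := us.2 _ t0; have [_ [_ /(_ ut.1) a0]] := dvr_ge0 lE us s0 ua.
have u : runit E ((t / s) / s ^ (a - 1)).
  suff -> : t / s / s ^ (a - 1) = t / s ^ a by [].
  by rewrite expfzDr // -mulrA -invfM mulrCA divff ?mulr1.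
by apply: (dvr_ge0 lE us s0 u).1.1; rewrite subr_ge0.
Qed.

Lemma uniformizer_assoc E s t : dvr E -> uniformizer E s -> uniformizer E t -> runit E (t / s).
Proof.
move=> dE us ut; split; [|exact: uniformizer_quo|].
  by rewrite mulf_neq0 ?invr_eq0 // (uniformizer_neq0 dE).
by rewrite invf_div; apply: uniformizer_quo.
Qed.

(** [ord] asks for an exponent valid for every uniformizer; a single one suffices to find it because
    two uniformizers differ by a unit. *)
Lemma ord_eq E t f m : local_ring E -> uniformizer E t -> t != 0 ->
  runit E (f / t ^ m) -> ord E f = m.
Proof.
move=> lE ut t0 u; have dE : dvr E by split=> //; exists t.
have sE := lE.1; rewrite /ord; apply: xget_unique => /=.
  move=> s us; have -> : f / s ^ m = (f / t ^ m) * (t ^ m / s ^ m).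
    by rewrite mulrA divfK // expfz_neq0.
  by apply: runitM => //; apply: runit_expz => //; apply: uniformizer_assoc.
move=> m' /(_ t ut) u'; apply/eqP; rewrite -subr_eq0; apply/eqP.
apply: (uniformizer_runit lE ut t0).
have -> : t ^ (m' - m) = (f / t ^ m) / (f / t ^ m').
  have f0 : f != 0 by apply: contraNneq (runit_neq0 u) => ->; rewrite mul0r.
  have tm0 : t ^ m != 0 by exact: expfz_neq0.
  have tm'0 : t ^ m' != 0 by exact: expfz_neq0.
  rewrite expfzDr // -invr_expz; field; by rewrite f0 tm0 tm'0.
exact: runit_div.
Qed.

Lemma ordP E t f : local_ring E -> uniformizer E t -> t != 0 -> f != 0 ->
  runit E (f / t ^ ord E f).
Proof. by move=> lE ut t0 f0; have [m u] := ut.2 _ f0; rewrite (ord_eq lE ut t0 u). Qed.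

Lemma ord_runit E f : dvr E -> runit E f -> ord E f = 0.
Proof. by move=> [lE [t t0 ut]] u; apply: (ord_eq lE ut t0); rewrite divr1. Qed.

Lemma ordM E f g : dvr E -> f != 0 -> g != 0 -> ord E (f * g) = ord E f + ord E g.
Proof.
move=> [lE [t t0 ut]] f0 g0; apply: (ord_eq lE ut t0).
rewrite expfzDr // -mulf_div; apply: runitM; [exact: lE.1|exact: ordP..].
Qed.

Lemma ordV E f : dvr E -> f != 0 -> ord E f^-1 = - ord E f.
Proof.
move=> dE f0; have := ordM (f := f^-1) (g := f) dE; rewrite invr_eq0 mulVf //.
rewrite ord_runit //; last by apply: runit1; case: dE => -[].
by move=> /(_ f0 f0)/eqP; rewrite eq_sym addr_eq0 => /eqP.
Qed.

(** No exponent turns 0 / t^m into a unit, so [xget] returns its default value. *)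
Lemma ord_zero E : dvr E -> ord E 0 = 0.
Proof.
move=> [lE [t t0 ut]]; rewrite /ord; case: xgetP => // m _ /= /(_ t ut).
by rewrite mul0r => -[]; rewrite eqxx.
Qed.

Lemma ord_ge0 E f : dvr E -> f != 0 -> 0 <= ord E f <-> E f.
Proof. by move=> [lE [t t0 ut]] f0; apply: (dvr_ge0 lE ut t0 (ordP lE ut t0 f0)).1. Qed.

Lemma ord_gt0 E f : dvr E -> f != 0 -> 0 < ord E f <-> maxid E f.
Proof. by move=> [lE [t t0 ut]] f0; apply: (dvr_ge0 lE ut t0 (ordP lE ut t0 f0)).2. Qed.

Lemma dvr_valuation E : dvr E -> valuation_ring E.
Proof.
move=> dE; have [lE [t t0 ut]] := dE; have sE := lE.1; split.
- exact: subring1.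
- by move=> f g Ef Eg; split; [exact: subringB | exact: subringM].
- move=> f; have [->|f0] := eqVneq f 0; first by left; apply: subring0.
  case: (leP 0 (ord E f)) => of0; first by left; apply/ord_ge0.
  by right; apply/ord_ge0; rewrite ?invr_eq0 // ordV // oppr_ge0 ltW.
Qed.

(* Divisibility of [a] by [b] in [A] is expressed by [A (a / b)]. *)
Definition prime_elt A g := [/\ A g, g != 0, ~ A g^-1 &
  forall a b, A a -> A b -> A (a * b / g) -> A (a / g) \/ A (b / g)].

Definition mult_ideal A g : set K := [set a | A a /\ A (a / g)].

Definition prime_loc A g := localize A (mult_ideal A g).

(** Takes the part of Krull's intersection theorem in showing that the localization at a prime
    element is a discrete valuation ring. *)
Definition finite_mult A g := forall a, A a -> a != 0 -> exists m, ~ A (a / g ^+ m).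

Definition fractions A := forall h, exists a b, [/\ A a, A b, b != 0 & h = a / b].

Lemma mult_ideal_prime A g : subring A -> prime_elt A g -> prime_ideal_of A (mult_ideal A g).
Proof.
move=> sA [Ag g0 ng pg]; split; [by move=> a [] | | |split].
- by split; rewrite ?mul0r; apply: subring0.
- by case=> _; rewrite div1r.
- by move=> a b [Aa ag] [Ab bg]; split; rewrite ?mulrDl; apply: subringD.
- by move=> a b Aa [Ab bg]; split; rewrite -?mulrA; apply: subringM.
- by move=> a b Aa Ab [_ /(pg _ _ Aa Ab)[]]; [left|right].
Qed.

Lemma mult_ideal_not A g b : A b -> ~ mult_ideal A g b <-> ~ A (b / g).
Proof. by move=> Ab; split=> H; apply: contra_not H => // -[]. Qed.

Lemma prime_loc_point A g : subring A -> prime_elt A g -> point A (prime_loc A g).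
Proof. by move=> sA pg; apply: localize_point => //; apply: mult_ideal_prime. Qed.

Lemma prime_loc_maxid A g a : subring A -> prime_elt A g -> A a ->
  maxid (prime_loc A g) a <-> A (a / g).
Proof.
move=> sA pg Aa; rewrite localize_maxid1 //; last exact: mult_ideal_prime.
by split=> [[]|].
Qed.

Lemma prime_loc_runit A g a : subring A -> prime_elt A g -> A a -> ~ A (a / g) ->
  runit (prime_loc A g) a.
Proof.
move=> sA pg Aa na; have [Al _ _] := prime_loc_point sA pg.
by apply: not_maxid; [exact: Al | move/prime_loc_maxid => /(_ sA pg Aa)].
Qed.

Lemma prime_elt_mult A g a : subring A -> prime_elt A g -> finite_mult A g -> A a -> a != 0 ->
  exists m b, [/\ A b, ~ A (b / g) & a = g ^+ m * b].
Proof.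
move=> sA [Ag g0 _ _] fm Aa a0; have [m nm] := fm _ Aa a0.
elim: m nm => [|m IH] nm; first by rewrite divr1 in nm.
have [Am|/IH //] := pselect (A (a / g ^+ m)).
exists m, (a / g ^+ m); split=> //; last by rewrite mulrC divfK // expf_neq0.
by rewrite -mulrA -invfM -exprSr.
Qed.

Lemma prime_loc_uniformizer A g : subring A -> prime_elt A g -> finite_mult A g ->
  fractions A -> uniformizer (prime_loc A g) g.
Proof.
move=> sA pg fm fr; have [Ag g0 ng _] := pg; split.
  by apply/prime_loc_maxid => //; rewrite divff //; apply: subring1.
move=> f f0; have [a [b [Aa Ab b0 Ef]]] := fr f.
have a0 : a != 0 by apply: contraNneq f0 => a0; rewrite Ef a0 mul0r.
have [i [a' [Aa' na' Ea]]] := prime_elt_mult sA pg fm Aa a0.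
have [j [b' [Ab' nb' Eb]]] := prime_elt_mult sA pg fm Ab b0.
exists (i%:Z - j%:Z).
have -> : f / g ^ (i%:Z - j%:Z) = a' / b'.
  have b'0 : b' != 0 by apply: contraNneq b0 => b'0; rewrite Eb b'0 mulr0.
  have gi0 : g ^+ i != 0 by exact: expf_neq0.
  have gj0 : g ^+ j != 0 by exact: expf_neq0.
  rewrite Ef Ea Eb expfzDr // -invr_expz -!exprnP; field; by rewrite b'0 gi0 gj0.
have [_ lE _] := prime_loc_point sA pg.
by apply: runit_div; [exact: lE.1 | exact: prime_loc_runit..].
Qed.

Lemma prime_loc_dvr A g : subring A -> prime_elt A g -> finite_mult A g ->
  fractions A -> dvr (prime_loc A g).
Proof.
move=> sA pg fm fr; have [_ lE _] := prime_loc_point sA pg; split=> //.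
by exists g; [case: pg | exact: prime_loc_uniformizer].
Qed.

(* A discrete valuation ring has no overring but itself and the whole field. *)
Lemma dvr_prime_loc A E g : subring A -> dvr E -> point A E -> prime_elt A g ->
  maxid E g -> E = prime_loc A g.
Proof.
move=> sA dE [AE lE EE] pg mg; have sE := lE.1; have [_ lP _] := prime_loc_point sA pg.
have sP := lP.1; have [Ag g0 ng _] := pg.
have sub : E `<=` prime_loc A g.
  rewrite {1}EE => _ [a [b [Aa Ab ub ->]]]; exists a, b; split=> //.
  apply/mult_ideal_not => // bg; apply: (maxid_nu _ ub).
  by rewrite -(divfK g0 b); apply: maxidM => //; apply: AE.
apply/seteqP; split=> // h Ph; have [_ [t t0 ut]] := dE.
have [->|h0] := eqVneq h 0; first exact: subring0.
apply/ord_ge0 => //; rewrite leNgt; apply/negP; case oh: (ord E h) => [//|m] _.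
have uh := ordP lE ut t0 h0; rewrite oh NegzE -exprnN invrK in uh.
(* If h has order -(m+1), then h t^(m+1) is a unit of E, so the overring that contains h also
   contains the inverse of t. With t invertible, g becomes a unit there, although it lies in the
   maximal ideal. *)
have Pt : prime_loc A g t^-1.
  have -> : t^-1 = h * t ^+ m * (h * t ^+ m.+1)^-1.
    by have tm0 := expf_neq0 m t0; rewrite exprS; field; rewrite t0 h0 tm0.
  apply: subringM => //; first apply: subringM => //.
    by apply: subringX => //; apply: sub; apply: maxid_in; case: ut.
  by apply: sub; case: uh.
have ut' : runit (prime_loc A g) t by split=> //; apply: sub; apply: maxid_in; case: ut.
have : maxid (prime_loc A g) g.
  by apply/prime_loc_maxid => //; rewrite divff //; apply: subring1.
move/maxid_nu; apply.
have := ordP lE ut t0 g0; set e := ord E g => ug.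
rewrite -{2}(divfK (expfz_neq0 e t0) g); apply: runitM => //; first exact: runit_sub ug.
exact: runitXz.
Qed.

(** Here E is only known to contain A. Its centre on Spec A is a point of Y dominated by E, and
    separatedness identifies this point with E. *)
Lemma dvr_prime_loc_sep (Y : set (set K)) A E g : separated Y -> (point A `<=` Y) ->
  subring A -> dvr E -> Y E -> A `<=` E -> prime_elt A g -> maxid E g -> E = prime_loc A g.
Proof.
move=> sepY AY sA dE YE AE pg mg; apply: dvr_prime_loc => //.
have [pC dC] := center_point sA dE.1 AE.
rewrite (sepY E E (center A E) (dvr_valuation dE) YE (AY _ pC) (dominates_refl _) dC).
exact: pC.
Qed.

(** A comparison of degrees: g comes from a non-constant polynomial, whose d-th power has degree at
    least d, and [msize p] is one more than the degree of p. *)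
Lemma frame_finite_mult w g : frame w -> alg w g -> g != 0 -> ~ alg w g^-1 ->
  finite_mult (alg w) g.
Proof.
move=> fw /algP[q ->] g0 ng _ /algP[p ->] a0; have p0 : p != 0.
  by apply: contraNneq a0 => ->; rewrite rmorph0.
have q0 : q != 0 by apply: contraNneq g0 => ->; rewrite rmorph0.
have q2 : (1 < msize q)%N.
  rewrite ltnNge; apply/negP => /msize1_polyC qC; apply: ng.
  by rewrite qC evC -fmorphV; apply: alg_cst.
exists (msize p) => /algP[r Er].
have Ep : p = r * q ^+ msize p.
  by apply: (ev_inj fw); rewrite rmorphM rmorphXn /= -Er divfK // expf_neq0.
have r0 : r != 0 by apply: contraNneq p0 => r0; rewrite Ep r0 mul0r.
have Hm d : (d < msize (q ^+ d))%N.
  elim: d => [|d IH]; first by rewrite expr0 msize1.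
  rewrite exprS msizeM ?expf_neq0 //; move: IH q2.
  by case: (msize q) => [|[|a]] //; case: (msize _) => // b; rewrite !addSn /= !ltnS => H _; rewrite addnS ltnS (leq_trans H) // leq_addl.
have := Hm (msize p); rewrite ltnNge; apply/negP; rewrite negbK.
rewrite {2}Ep msizeM ?expf_neq0 //; have : (0 < msize r)%N by rewrite lt0n msize_poly_eq0.
by case: (msize r) => // a _; rewrite addSn /= leq_addl.
Qed.

Lemma coord_prime_elt w i : frame w -> prime_elt (alg w) (w i).
Proof.
move=> fw; have wi0 := frame_neq0 i fw.
have dv p : alg w (ev w p / w i) <-> kill (pred1 i) p = 0.
  rewrite -(coord_idealP _ _ fw); split=> [/algP[q E]|].
    rewrite -(divfK wi0 (ev w p)) E; apply: ideal_of_gen; first exact: alg_ev.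
    by exists i => //=.
  apply: (ideal_of_min (T := [set h | alg w (h / w i)])) => /=.
  - by rewrite mul0r; apply: subring0.
  - by move=> a _ Aa [j /eqP-> ->]; rewrite mulfK.
  - by move=> f g Af Ag; rewrite mulrDl; apply: subringD.
split=> //; first exact: alg_gen.
  by rewrite -div1r -(rmorph1 (ev w)) => /dv/eqP; rewrite rmorph1 oner_eq0.
move=> _ _ /algP[p ->] /algP[q ->]; rewrite -rmorphM => /dv; rewrite rmorphM /= => /eqP.
by rewrite mulf_eq0 => /orP[]/eqP H; [left|right]; apply/dv.
Qed.

Lemma frame_prime_dvr w g : frame w -> prime_elt (alg w) g -> dvr (prime_loc (alg w) g).
Proof.
move=> fw pg; have [Ag g0 ng _] := pg; apply: prime_loc_dvr => //; last by case: fw.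
exact: frame_finite_mult.
Qed.

Lemma prime_loc_coord_maxid w i : frame w -> maxid (prime_loc (alg w) (w i)) (w i).
Proof.
move=> fw; apply/prime_loc_maxid => //; [exact: coord_prime_elt | exact: alg_gen |].
by rewrite divff ?frame_neq0 //; apply: subring1.
Qed.

Lemma prime_loc_coord_runit w i j : frame w -> j != i -> runit (prime_loc (alg w) (w i)) (w j).
Proof.
move=> fw ji; apply: prime_loc_runit => //; [exact: coord_prime_elt | exact: alg_gen |].
have := at_gen w (fun l => (l == j)%:R) j; rewrite eqxx => /at_ndvd; apply=> //.
- exact: frame_neq0.
- exact: oner_neq0.
by have := at_gen w (fun l => (l == j)%:R) i; rewrite eq_sym (negPf ji).
Qed.

Lemma ord_prime_loc w g m h : frame w -> prime_elt (alg w) g ->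
  runit (prime_loc (alg w) g) h -> ord (prime_loc (alg w) g) (g ^+ m * h) = m.
Proof.
move=> fw pg uh; have [Ag g0 ng _] := pg; have dE := frame_prime_dvr fw pg.
have [lE _] := dE.
apply: (ord_eq lE _ g0); last by rewrite -exprnP mulrAC divff ?mul1r // expf_neq0.
apply: prime_loc_uniformizer => //; last by case: fw.
exact: frame_finite_mult.
Qed.

(** The differentials of the w_l generate the differentials of E: the chain and quotient rules
    introduce only denominators that are units of E. *)
Lemma fderiv_point w E h : point (alg w) E -> E h ->
  exists2 G : 'I_n -> K, forall l, E (G l) &
    forall i, fderiv K i h = \sum_l fderiv K i (w l) * G l.
Proof.
move=> [AE lE EE]; rewrite {1}EE => -[_ [_ [/algP[p ->] /algP[q ->] uq ->]]].
have q0 := runit_neq0 uq; have sE := lE.1.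
have Eev r : E (ev w r) by apply: AE; apply: alg_ev.
exists (fun l => (ev w p^`M(l) * ev w q - ev w p * ev w q^`M(l)) * (ev w q)^-1 ^+ 2) => [l|i].
  apply: subringM => //; first by apply: subringB => //; apply: subringM.
  by apply: subringX => //; case: uq.
rewrite fderiv_div // !fderiv_ev mulr_suml mulr_sumr -sumrB mulr_suml.
by apply: eq_bigr => l _; field.
Qed.

(** The Jacobian matrix of any v with entries in E is that of w times a matrix over E, whose
    determinant has non-negative order. Hence w attains the minimal order of a Jacobian
    determinant. *)
Lemma relcan_frame w E : frame w -> dvr E -> point (alg w) E -> relcan E = - ord E (jac w).
Proof.
move=> [J0 fr] dE pE; have [AE lE _] := pE; have sE := lE.1.
rewrite /relcan; have H : forall v, (forall i, E (v i)) -> jac v != 0 -> ord E (jac w) <= ord E (jac v).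
  move=> v Ev Jv; have /choice[G HG] : forall j, exists G : 'I_n -> K, (forall l, E (G l)) /\
        forall i, fderiv K i (v j) = (\sum_l fderiv K i (w l) * G l)%R.
      by move=> j; have [G ? ?] := fderiv_point pE (Ev j); exists G.
  have JE : jac v = jac w * \det (\matrix_(i, j) G j i).
    rewrite -det_mulmx; congr (\det _); apply/matrixP => i j; rewrite !mxE (HG j).2.
    by apply: eq_bigr => l _; rewrite !mxE.
  have d0 : \det (\matrix_(i, j) G j i) != 0.
    by apply: contraNneq Jv => d0; rewrite JE d0 mulr0.
  rewrite JE ordM // lerDl; apply/ord_ge0 => //.
  apply: subring_sum => // s; apply: subringM => //.
    by apply: subringX => //; apply: subringN => //; apply: subring1.
  by apply: subring_prod => // i; rewrite mxE; apply: (HG _).1.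
apply: xget_unique => /=.
  by rewrite opprK; split=> //; exists w; split=> // i; apply: AE; apply: alg_gen.
move=> m [m1 [v [Ev Jv Em]]]; apply/eqP; rewrite -eqr_oppLR eq_le.
by rewrite m1 /= -?Em ?H // => i; apply: AE; apply: alg_gen.
Qed.

End Orders.

(** * Unique factorization in polynomial rings *)

Section Factorial.
Variable D : idomainType.
Implicit Types a b p : D.

Definition divides a b := exists c, b = c * a.

Definition prime_element p := [/\ p != 0, p \isn't a GRing.unit &
  forall a b, divides p (a * b) -> divides p a \/ divides p b].

Definition has_factorization a := exists (u : D) (s : seq D),
  [/\ u \is a GRing.unit, forall p, p \in s -> prime_element p & a = u * \prod_(p <- s) p].

(** Factoring into prime elements, not merely irreducible ones, makes this property equivalent to
    unique factorization. *)
Definition factorial_ring := forall a, a != 0 -> has_factorization a.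

Lemma has_factorizationM a b :
  has_factorization a -> has_factorization b -> has_factorization (a * b).
Proof.
move=> [u [s [uu ps ->]]] [v [t [uv pt ->]]]; exists (u * v), (s ++ t); split.
- by rewrite unitrM uu.
- by move=> p; rewrite mem_cat => /orP[/ps|/pt].
- by rewrite big_cat /=; ring.
Qed.

Lemma divides_mull a b c : divides a b -> divides a (c * b).
Proof. by case=> d ->; exists (c * d); rewrite mulrA. Qed.

Lemma divides_mulr a b c : divides a b -> divides a (b * c).
Proof. by rewrite mulrC; apply: divides_mull. Qed.

Lemma dividesD a b c : divides a b -> divides a c -> divides a (b + c).
Proof. by case=> d -> [e ->]; exists (d + e); rewrite mulrDl. Qed.

Lemma divides0 a : divides a 0.
Proof. by exists 0; rewrite mul0r. Qed.

Lemma dividesrr a : divides a a.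
Proof. by exists 1; rewrite mul1r. Qed.

Lemma divides_sum a (I : Type) (r : seq I) (P : pred I) (F : I -> D) :
  (forall i, P i -> divides a (F i)) -> divides a (\sum_(i <- r | P i) F i).
Proof.
move=> H; elim/big_rec: _ => [|i x Pi dx]; first exact: divides0.
by apply: dividesD => //; apply: H.
Qed.

Lemma dividesB a b c : divides a b -> divides a c -> divides a (b - c).
Proof. by case=> d -> [e ->]; exists (d - e); rewrite mulrBl. Qed.

Lemma prime_dividesD p a b : divides p (a + b) -> divides p b -> divides p a.
Proof. by move=> ab b'; rewrite -(addrK b a); apply: dividesB. Qed.

Lemma prime_not_unit p a b : prime_element p -> a \is a GRing.unit -> divides p a -> False.
Proof.
by move=> [_ /negP nu _] ua [c E]; apply: nu; move: ua; rewrite E unitrM => /andP[].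
Qed.

(** The prime p is associated to one of the factors, which is then removed. The drop in length
    drives the induction on the number of prime factors of a leading coefficient. *)
Lemma prime_divides_prod p u (s : seq D) : prime_element p -> u \is a GRing.unit ->
  (forall q, q \in s -> prime_element q) -> divides p (u * \prod_(q <- s) q) ->
  exists u' (s' : seq D), [/\ u' \is a GRing.unit, (size s' < size s)%N,
    forall q, q \in s' -> prime_element q & u * \prod_(q <- s) q = p * (u' * \prod_(q <- s') q)].
Proof.
move=> pp; have [p0 /negP nu pP] := pp; elim: s u => [|q s IH] u uu ps.
  by rewrite big_nil mulr1 => /(prime_not_unit 0 pp uu).
have ps' r : r \in s -> prime_element r by move=> rs; apply: ps; rewrite inE rs orbT.
have [q0 /negP nq qP] := ps q (mem_head _ _).
rewrite big_cons mulrCA => /pP[[e Eq]|/(IH _ uu ps')[u' [s' [uu' ss' ps'' E]]]]; last first.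
  exists u', (q :: s'); rewrite big_cons E; split=> //; last by rewrite mulrCA; congr (_ * _); rewrite mulrCA.
  by move=> r; rewrite inE => /predU1P[->|/ps''//]; apply: ps; rewrite mem_head.
have ue : e \is a GRing.unit.
  have : divides q (e * p) by rewrite -Eq; apply: dividesrr.
  move=> /qP[[c Ee]|[c Ep]].
    have : 1 = c * p.
      apply: (mulfI q0); rewrite mulr1 {1}Eq Ee; ring.
    by move=> cp; case: nu; apply/unitrPr; exists c; rewrite mulrC -cp.
  have ec : 1 = e * c.
    apply: (mulIf q0); rewrite mul1r {1}Eq Ep; ring.
  by apply/unitrPr; exists c.
exists (u * e), s; split=> //; first by rewrite unitrM uu.
by rewrite Eq; ring.
Qed.

Lemma dividesC_coef a (f : {poly D}) : (exists c, f = c * a%:P) <-> forall i, divides a f`_i.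
Proof.
split=> [[c ->] i|H]; first by rewrite coefMC; exists c`_i.
have [c Hc] := choice H; exists (\poly_(i < size f) c i); apply/polyP => i.
rewrite coefMC coef_poly; case: ltnP => [_|fi]; first exact: Hc.
by rewrite mul0r nth_default.
Qed.

End Factorial.

(** * Gauss's lemma and the factoriality of D[X] *)

Section FactorialPoly.
Variable D : idomainType.
Implicit Types (a b : D) (f g h : {poly D}).
Import Pdiv.Idomain.

(** If a divides neither f nor g, take the least indices i and j of coefficients that it does not
    divide. In the coefficient of index i + j of f g every term except f_i g_j is divisible by a. *)
Lemma prime_polyC a : prime_element a -> prime_element a%:P.
Proof.
move=> [a0 /negP nu aP]; split.
- by rewrite polyC_eq0.
- by apply/negP; rewrite poly_unitE coefC eqxx => /andP[_ /nu].
move=> f g dfg; apply: contrapT => /not_orP[nf ng].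
have ex h : ~ divides a%:P h -> exists i, ~ divides a h`_i.
  by move=> nh; apply/existsNP => H; apply: nh; apply/dividesC_coef.
have minex h : ~ divides a%:P h -> exists i, ~ divides a h`_i /\ forall j, (j < i)%N -> divides a h`_j.
  move=> /ex [i0 n0]; pose P i := `[< ~ divides a h`_i >].
  have exP : exists i, P i by exists i0; apply/asboolP.
  case: (ex_minnP exP) => i /asboolP ni mi; exists i; split=> // j ji.
  by apply: contrapT => nj; move: ji; rewrite ltnNge mi //; apply/asboolP.
have [i [ni mi]] := minex _ nf; have [j [nj mj]] := minex _ ng.
have /dividesC_coef/(_ (i + j)%N) := dfg.
have ilt : (i < (i + j).+1)%N by rewrite ltnS leq_addr.
rewrite coefM (bigD1 (Ordinal ilt)) //= addKn => /prime_dividesD H.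
suff /H/aP[/ni[]|/nj[]] : divides a (\sum_(l < (i + j).+1 | l != Ordinal ilt) f`_l * g`_(i + j - l)).
apply: divides_sum => l; rewrite -val_eqE /= neq_ltn => /orP[li|il].
  by apply: divides_mulr; apply: mi.
by apply: divides_mull; apply: mj; rewrite ltn_subLR ?ltn_add2r // -ltnS.
Qed.

Definition primitive f := forall a, prime_element a -> ~ divides a%:P f.

(** The primes of d are removed one at a time: as a constant polynomial each of them divides g or h,
    and dividing it out keeps the degree. *)
Lemma clear_denominator d f g h : factorial_ring D -> d != 0 -> f != 0 -> d%:P * f = g * h ->
  exists g' h', [/\ f = g' * h', size g' = size g & size h' = size h].
Proof.
move=> fD d0; have [u [s [uu ps ->]]] := fD d d0 => {d d0}; elim: s f g h ps => [|q s IH] f g h ps f0.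
  rewrite big_nil mulr1 => E; exists (u^-1 *: g), h; split=> //; last first.
    by rewrite size_scale // invr_eq0; apply: contraTneq uu => ->; rewrite unitr0.
  by rewrite -scalerAl -E mul_polyC scalerA mulVr // scale1r.
have [q0 _ _] := ps q (mem_head _ _).
have ps' r : r \in s -> prime_element r by move=> rs; apply: ps; rewrite inE rs orbT.
have [_ _ qP] := prime_polyC (ps q (mem_head _ _)).
rewrite big_cons mulrCA polyCM => E; have qP0 : q%:P != 0 by rewrite polyC_eq0.
have /qP[[c Ec]|[c Ec]] : divides q%:P (g * h).
- by rewrite -E -mulrA; exists ((u * \prod_(j <- s) j)%:P * f); rewrite mulrC.
- have [|g' [h' [Ef Eg Eh]]] := IH f c h ps' f0.
    by apply: (mulfI qP0); rewrite mulrA E Ec; ring.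
  by exists g', h'; split; rewrite // Eg Ec mulrC mul_polyC size_scale.
- have [|g' [h' [Ef Eg Eh]]] := IH f g c ps' f0.
    by apply: (mulfI qP0); rewrite mulrA E Ec; ring.
  by exists g', h'; split; rewrite // Eh Ec mulrC mul_polyC size_scale.
Qed.

Lemma primitive_divides d f g h : factorial_ring D -> d != 0 -> primitive g ->
  d%:P * f = h * g -> divides g f.
Proof.
move=> fD d0 pg; have [u [s [uu ps ->]]] := fD d d0 => {d d0}; elim: s h ps => [|q s IH] h ps.
  rewrite big_nil mulr1 => E; exists (u^-1 *: h).
  by rewrite -scalerAl -E mul_polyC scalerA mulVr // scale1r.
have [q0 _ _] := ps q (mem_head _ _).
have ps' r : r \in s -> prime_element r by move=> rs; apply: ps; rewrite inE rs orbT.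
have [_ _ qP] := prime_polyC (ps q (mem_head _ _)).
rewrite big_cons mulrCA polyCM => E; have qP0 : q%:P != 0 by rewrite polyC_eq0.
have /qP[[c Ec]|/(pg _ (ps q (mem_head _ _)))//] : divides q%:P (h * g).
  by rewrite -E -mulrA; exists ((u * \prod_(j <- s) j)%:P * f); rewrite mulrC.
by apply: (IH c) => //; apply: (mulfI qP0); rewrite mulrA E Ec; ring.
Qed.

(** Over a domain [%|] is divisibility up to a nonzero constant, that is over the fraction field.
    There irreducibility gives primality, and primitivity of f removes the constant. *)
Lemma irreducible_prime f : factorial_ring D -> irreducible_poly f -> primitive f ->
  prime_element f.
Proof.
move=> fD [f1 fI] pf; split.
- by rewrite -size_poly_gt0 (leq_trans _ f1).
- by rewrite poly_unitE; case: (size f) f1 => [|[|m]].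
move=> g h [c E]; have fgh : f %| g * h by rewrite E dvdp_mulIr.
have dv (a : {poly D}) : f %| a -> divides f a.
  move=> /dvdpP[[d q] /= d0 E']; apply: (primitive_divides (d := d) (h := q)) => //.
  by rewrite mul_polyC.
have [/dv|nfg] := boolP (f %| g); first by left.
right; apply: dv; rewrite -(@Gauss_dvdpr _ h g f) // coprimep_def.
apply/negPn/negP => s1; move: nfg; rewrite -(eqp_dvdl _ (fI _ s1 (dvdp_gcdl _ _))).
by rewrite dvdp_gcdr.
Qed.

(** Induction on the degree: a non-constant primitive polynomial that is not irreducible splits into
    factors of smaller degree. Any other polynomial is made primitive by extracting constant primes,
    by induction on the number of prime factors of its leading coefficient. *)
Lemma factorial_poly : factorial_ring D -> factorial_ring {poly D}.
Proof.
move=> fD f; move: {-1}(size f) (leqnn (size f)) => m; elim: m f => [|m IHm] f.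
  by rewrite leqn0 size_poly_eq0 => ->.
have prim g : (size g <= m.+1)%N -> g != 0 -> primitive g ->
    has_factorization g.
  move=> gm g0 pg; case: (leqP (size g) 1) => g1.
    have Eg := size1_polyC g1; have c0 : g`_0 != 0 by rewrite -polyC_eq0 -Eg.
    have [u [[|q s] [uu ps Ec]]] := fD _ c0.
      exists g, [::]; rewrite big_nil mulr1; split=> //.
      by rewrite Eg Ec big_nil mulr1 rmorph_unit.
    case: (pg q (ps _ (mem_head _ _))); rewrite Eg Ec big_cons.
    by exists (u * \prod_(j <- s) j)%:P; rewrite -polyCM; congr _%:P; ring.
  have [gi|ngi] := pselect (irreducible_poly g).
    exists 1, [:: g]; rewrite unitr1 big_seq1 mul1r; split=> // q.
    by rewrite inE => /eqP->; apply: irreducible_prime.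
  have [q [q1 qg nqg]] : exists q : {poly D}, [/\ size q != 1%N, q %| g & ~~ (q %= g)].
    apply: contrapT => nq; apply: ngi; split=> // q q1 qg.
    by apply/negPn/negP => nqg; apply: nq; exists q.
  have /dvdpP[[d c] /= d0 E] := qg.
  have q0 := dvdpN0 qg g0.
  rewrite -mul_polyC in E; have [g' [h' [Eg sg' sh']]] := clear_denominator fD d0 g0 E.
  have g'0 : g' != 0 by apply: contraNneq g0 => Z; rewrite Eg Z mul0r.
  have h'0 : h' != 0 by apply: contraNneq g0 => Z; rewrite Eg Z mulr0.
  have sg := size_mul g'0 h'0; rewrite -Eg in sg.
  have g'2 : (1 < size g')%N.
    case sE : (size g') => [|[|l]] //; first by move: g'0; rewrite -size_poly_eq0 sE.
    by move: nqg; rewrite -(dvdp_size_eqp qg) -sh' sg sE eqxx.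
  have h'2 : (1 < size h')%N.
    case sE : (size h') => [|[|l]] //; first by move: h'0; rewrite -size_poly_eq0 sE.
    by move: q1; rewrite -sh' sE.
  by rewrite Eg; apply: has_factorizationM; apply: IHm => //; move: gm; rewrite sg; lia.
move=> fm f0; have lf0 : lead_coef f != 0 by rewrite lead_coef_eq0.
have [u [s [uu ps Es]]] := fD _ lf0; move: (leqnn (size s)); move: {-1}(size s) => l.
elim: l u s f fm f0 lf0 uu ps Es => [|l IHl] u s f fm f0 lf0 uu ps Es sl;
  (have [[a [pa [g Eg]]]|np] := pselect (exists a, prime_element a /\ divides a%:P f);
  last by apply: prim => // a pa af; apply: np; exists a);
  have [a0 _ _] := pa;
  have g0 : g != 0 by apply: contraNneq f0 => g0; rewrite Eg g0 mul0r.
- have : divides a (u * \prod_(q <- s) q).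
    by rewrite -Es Eg lead_coefM lead_coefC; exists (lead_coef g).
  by move=> /(prime_divides_prod pa uu ps)[u' [s' [_]]]; rewrite ltnNge (leq_trans sl).
have : divides a (u * \prod_(q <- s) q).
  by rewrite -Es Eg lead_coefM lead_coefC; exists (lead_coef g).
move=> /(prime_divides_prod pa uu ps)[u' [s' [uu' ss' ps' E']]].
rewrite Eg mulrC; apply: has_factorizationM.
  exists 1, [:: a%:P]; rewrite unitr1 big_seq1 mul1r; split=> // q.
  by rewrite inE => /eqP->; apply: prime_polyC.
apply: (IHl u' s') => //; [|by rewrite lead_coef_eq0| |by rewrite -ltnS (leq_trans ss')].
  by rewrite Eg mulrC mul_polyC size_scale in fm.
by apply: (mulfI a0); rewrite -E' -Es Eg lead_coefM lead_coefC mulrC.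
Qed.

End FactorialPoly.

Lemma factorial_iso (D E : idomainType) (phi : {rmorphism E -> D}) : injective phi ->
  (forall a, exists b, phi b = a) -> factorial_ring D -> factorial_ring E.
Proof.
move=> inj /choice[psi psiK] fD a a0.
have phiK b : psi (phi b) = b by apply: inj; rewrite psiK.
have psiM b c : psi (b * c) = psi b * psi c by apply: inj; rewrite rmorphM !psiK.
have dvP b c : divides b c -> divides (phi b) (phi c).
  by case=> e ->; exists (phi e); rewrite rmorphM.
have dvP' b c : divides b c -> divides (psi b) (psi c).
  by case=> e ->; exists (psi e); rewrite psiM.
have pa0 : phi a != 0 by rewrite -(rmorph0 phi) (inj_eq inj).
have uP u : u \is a GRing.unit -> psi u \is a GRing.unit.
  move=> uu; apply/unitrPr; exists (psi u^-1); apply: inj.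
  by rewrite rmorphM !psiK divrr // rmorph1.
have [u [s [uu ps Ea]]] := fD _ pa0; exists (psi u), [seq psi p | p <- s]; split.
- exact: uP.
- move=> _ /mapP[p pin ->]; have [p0 np pP] := ps p pin; split.
  + by rewrite -(inj_eq inj) psiK rmorph0.
  + by apply: contra np => u'; rewrite -(psiK p) rmorph_unit.
  + move=> b c /dvP; rewrite rmorphM psiK => /pP[]/dvP'; rewrite phiK; by [left|right].
- apply: inj; rewrite Ea rmorphM psiK rmorph_prod big_map; congr (_ * _).
  by apply: eq_bigr => p _; rewrite psiK.
Qed.

(** * Factoriality of k[x_1, .., x_n], by adjoining the last variable *)

Section FactorialMpoly.
Variable k : fieldType.

Lemma muni_widen n (i : 'I_n) : muni ('X_(widen_ord (leqnSn n) i) : {mpoly k[n.+1]}) = ('X_i)%:P.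
Proof.
rewrite muniE msuppX big_seq1 mcoeffX eqxx scale1r mnm1E.
have -> : (widen_ord (leqnSn n) i == ord_max) = false.
  by apply/negP => /eqP/(congr1 val) /= E; have := ltn_ord i; rewrite E ltnn.
rewrite expr0 alg_polyC; congr ('X_[_])%:P; apply/mnmP => j.
by rewrite mnmE !mnm1E -!val_eqE.
Qed.

Lemma muni_max n : muni ('X_ord_max : {mpoly k[n.+1]}) = 'X.
Proof.
rewrite muniE msuppX big_seq1 mcoeffX eqxx scale1r mnm1E eqxx expr1.
suff -> : [multinom (U_(ord_max : 'I_n.+1) (widen_ord (leqnSn n) i))%MM | i < n] = 0%MM.
  by rewrite mpolyX0 scale1r.
apply/mnmP => i; rewrite mnmE mnm0E mnm1E -val_eqE /=.
by have := ltn_ord i; case: eqP => // <-; rewrite ltnn.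
Qed.

Definition unmuni n (p : {poly {mpoly k[n]}}) : {mpoly k[n.+1]} :=
  (mpwiden p).['X_ord_max].

Lemma muniK n : cancel (@muni n k) (@unmuni n).
Proof.
move=> p; rewrite /unmuni; elim/mpoly_ring_ind: p => [c|i|p q Ep Eq|p q Ep Eq].
- by rewrite muniC mpwidenC hornerC mwidenC.
- case: (unliftP ord_max i) => [j ->|->]; last by rewrite muni_max mpwidenX hornerX.
  have -> : lift ord_max j = widen_ord (leqnSn n) j.
    by apply: val_inj; rewrite /= /bump leqNgt ltn_ord.
  rewrite muni_widen mpwidenC hornerC mwidenX mnmwiden1; congr 'X_[U_(_)].
- rewrite muniD (raddfD (@mpwiden n k) (muni p) (muni q)) hornerD.
  by congr (_ + _).
- rewrite muniM (rmorphM (@mpwiden n k) (muni p) (muni q)) hornerM.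
  by congr (_ * _).
Qed.

Lemma muni_surj n (f : {poly {mpoly k[n]}}) : exists p, muni p = f.
Proof.
elim/poly_ind: f => [|f c [p <-]]; first by exists 0; rewrite muni0.
have [q <-] : exists q, muni q = c%:P.
  elim/mpoly_ring_ind: c => [a|i|a b [q Eq] [r Er]|a b [q Eq] [r Er]].
  - by exists a%:MP; rewrite muniC.
  - by exists 'X_(widen_ord (leqnSn n) i); rewrite muni_widen.
  - by exists (q + r); rewrite rmorphD /= Eq Er polyCD.
  - by exists (q * r); rewrite rmorphM /= Eq Er polyCM.
by exists (p * 'X_ord_max + q); rewrite rmorphD rmorphM /= muni_max.
Qed.

Lemma factorial_mpoly n : factorial_ring {mpoly k[n]}.
Proof.
elim: n => [|n IH].
  move=> p; have [c ->] : exists c, p = c%:MP.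
    elim/mpoly_ring_ind: p => [c|[]//|p q [a ->] [b ->]|p q [a ->] [b ->]]; first by exists c.
      by exists (a + b); rewrite mpolyCD.
    by exists (a * b); rewrite mpolyCM.
  rewrite mpolyC_eq0 => c0; exists c%:MP, [::]; rewrite big_nil mulr1; split=> //.
  by rewrite rmorph_unit // unitfE.
apply: (@factorial_iso {poly {mpoly k[n]}} {mpoly k[n.+1]} (@muni n k)); last exact: factorial_poly.
  exact: can_inj (@muniK n).
exact: muni_surj.
Qed.

End FactorialMpoly.

(** * Primality of the cubic C *)

Section Cubic.
Variable k : numClosedFieldType.

Definition cubic (F : comNzRingType) (x y z : F) := y * z ^+ 2 - x ^+ 2 * z + x ^+ 3 + y ^+ 3.

Lemma natr_neq0 m : m.+1%:R != 0 :> k. Proof. by rewrite pnatr_eq0. Qed.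

(** A reducible polynomial of degree at most 3 has a factor of degree 1, so this excludes the only
    way in which C could split. The equation of the plane is solved for x, y or z, and C is
    evaluated at a few points of the plane. *)
Lemma cubic_no_line (a b c d : k) :
  (forall x y z, a * x + b * y + c * z + d = 0 -> cubic x y z = 0) -> [/\ a = 0, b = 0 & c = 0].
Proof.
rewrite /cubic => H; have [a0|a0] := eqVneq a 0; last first.
  set B := - b / a; set C := - c / a; set D := - d / a.
  have HH y z : cubic (B * y + C * z + D) y z = 0.
    by apply: H; rewrite /B /C /D; field.
  rewrite /cubic in HH.
  have D0 : D = 0.
    have /eqP : D ^+ 3 = 0 by rewrite -(HH 0 0); ring.
    by rewrite expf_eq0 => /eqP.
  rewrite D0 in HH.
  have C2 : C ^+ 3 - C ^+ 2 = 0 by rewrite -(HH 0 1); ring.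
  have B3 : B ^+ 3 + 1 = 0 by rewrite -(HH 1 0); ring.
  have H1 := HH 1 1; have H2 := HH (-1) 1.
  (* Adding the values at y = 1 and y = -1 for z = 1 keeps the part even in y. As B is nonzero it
     gives 3 C = 1, against C^3 = C^2. *)
  have E : 2%:R * B * (3%:R * B * C - B) = 0.
    have -> : 2%:R * B * (3%:R * B * C - B) =
      (1 * 1 ^+ 2 - (B * 1 + C * 1 + 0) ^+ 2 * 1 + (B * 1 + C * 1 + 0) ^+ 3 + 1 ^+ 3) +
      (- 1 * 1 ^+ 2 - (B * - 1 + C * 1 + 0) ^+ 2 * 1 + (B * - 1 + C * 1 + 0) ^+ 3 + (- 1) ^+ 3)
      - 2%:R * (C ^+ 3 - C ^+ 2) by ring.
    by rewrite H1 H2 C2 mulr0 !addr0 subr0.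
  have B0 : B != 0.
    by apply/eqP => B0; move/eqP: B3; rewrite B0 expr0n /= add0r oner_eq0.
  move/eqP: E; rewrite mulf_eq0 (negPf (mulf_neq0 (natr_neq0 1) B0)) /= => /eqP E.
  have C3 : 3%:R * C = 1.
    by apply: (mulfI B0); rewrite mulr1; apply/eqP; rewrite -subr_eq0 -E; apply/eqP; ring.
  have : 2%:R = 0 :> k.
    have -> : 2%:R = - (27%:R * (C ^+ 3 - C ^+ 2)) + ((3%:R * C) ^+ 3 - 3%:R * (3%:R * C) ^+ 2) + 2%:R + 2%:R - 2%:R :> k by ring.
    rewrite C2 C3; ring.
  by move/eqP; rewrite (negPf (natr_neq0 1)).
have [b0|b0] := eqVneq b 0; last first.
  (* With a = 0 the value of y on the plane does not depend on x, so at z = 0 the cubic is x^3 plus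
     a constant and cannot vanish at both x = 0 and x = 1. *)
  have HH x z : x ^+ 3 + z * (- (c * z + d) / b * z - x ^+ 2) + (- (c * z + d) / b) ^+ 3 = 0.
    by rewrite -(H x (- (c * z + d) / b) z); [ring | rewrite a0; field].
  have : (1 : k) = 0.
    transitivity ((1 ^+ 3 + 0 * (- (c * 0 + d) / b * 0 - 1 ^+ 2) + (- (c * 0 + d) / b) ^+ 3) -
      (0 ^+ 3 + 0 * (- (c * 0 + d) / b * 0 - 0 ^+ 2) + (- (c * 0 + d) / b) ^+ 3)); first by ring.
    by rewrite !HH subrr.
  by move/eqP; rewrite oner_eq0.
have [c0|c0] := eqVneq c 0; first by [].
have HH x : x ^+ 3 - x ^+ 2 * (- d / c) = 0.
  by rewrite -(H x 0 (- d / c)); [ring | rewrite a0 b0; field].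
have E1 := HH 1; have E2 := HH 2%:R.
have : 4%:R = 0 :> k.
  have -> : 4%:R = (2%:R ^+ 3 - 2%:R ^+ 2 * (- d / c)) - 4%:R * (1 ^+ 3 - 1 ^+ 2 * (- d / c)) :> k by ring.
  by rewrite E1 E2 mulr0 subr0.
by move/eqP; rewrite (negPf (natr_neq0 3)).
Qed.

Lemma linear_mpoly n (p : {mpoly k[n]}) : (msize p <= 2)%N ->
  p = (p@_0)%:MP + \sum_i p@_(U_(i)) *: 'X_i.
Proof.
move=> p2; apply/mpolyP => m; rewrite mcoeffD mcoeffC raddf_sum /=.
have [->|m0] := eqVneq m 0%MM.
  rewrite mulr1 big1 ?addr0 // => i _; rewrite mcoeffZ mcoeffX.
  by rewrite mnm1_eq0 mulr0.
rewrite mulr0 add0r; have [i mi] : exists i, (0 < m i)%N.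
  apply: contrapT => nl; move/eqP: m0; apply; apply/mnmP => l.
  by rewrite mnm0E; apply/eqP; rewrite -leqn0 leqNgt; apply/negP => ml; apply: nl; exists l.
have Em : m = (m - U_(i) + U_(i))%MM.
  by rewrite submK //; apply/mnm_lepP => j; rewrite mnm1E; case: eqP => // <-.
have [m1|m1] := eqVneq (m - U_(i))%MM 0%MM.
  move: Em; rewrite m1 add0m => ->; rewrite (bigD1 i) //= mcoeffZ mcoeffX eqxx mulr1.
  rewrite big1 ?addr0 // => j ji; rewrite mcoeffZ mcoeffX (_ : (_ == _) = false) ?mulr0 //.
  by apply/eqP => /mnmP/(_ j); rewrite !mnm1E eqxx eq_sym (negPf ji).
have md : (2 <= mdeg m)%N.
  by rewrite Em mdegD mdeg1 addn1 ltnS lt0n mdeg_eq0.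
rewrite (memN_msupp_eq0 (msize_mdeg_ge (leq_trans p2 md))) big1 // => j _.
rewrite mcoeffZ mcoeffX (_ : (_ == _) = false) ?mulr0 //.
by apply/eqP => E; rewrite -E mdeg1 in md.
Qed.

Definition i0 : 'I_3 := @Ordinal 3 0 isT.
Definition i1 : 'I_3 := @Ordinal 3 1 isT.
Definition i2 : 'I_3 := @Ordinal 3 2 isT.

Lemma ord3P (i : 'I_3) : [\/ i = i0, i = i1 | i = i2].
Proof.
by case: i => -[|[|[|m]]] lt3 //; [constructor 1|constructor 2|constructor 3]; apply: val_inj.
Qed.

Lemma sum3 (V : nmodType) (F : 'I_3 -> V) : \sum_i F i = F i0 + F i1 + F i2.
Proof.
rewrite !big_ord_recl big_ord0 addr0 addrA; congr (F _ + F _ + F _); exact: val_inj.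
Qed.

Definition cubic_mpoly : {mpoly k[3]} := cubic 'X_i0 'X_i1 'X_i2.

Lemma cubic_morph (A B : comNzRingType) (f : {rmorphism A -> B}) x y z :
  f (cubic x y z) = cubic (f x) (f y) (f z).
Proof. by rewrite /cubic !rmorphD rmorphN (rmorphM f y) (rmorphM f (x ^+ 2)) !rmorphXn. Qed.

Lemma meval_cubic v : cubic_mpoly.@[v] = cubic (v i0) (v i1) (v i2).
Proof. by rewrite (cubic_morph (meval v)) /= !mevalXU. Qed.

Lemma cubic_mpoly_neq0 : cubic_mpoly != 0.
Proof.
apply/eqP => /(congr1 (meval (fun i => (i == i0)%:R))); rewrite meval_cubic meval0.
rewrite (_ : cubic _ _ _ = 1); first by apply/eqP; rewrite oner_eq0.
by rewrite /cubic /=; ring.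
Qed.

Lemma msize_cubic : (msize cubic_mpoly <= 4)%N.
Proof.
have X0 i : 'X_i != 0 :> {mpoly k[3]} by rewrite -msize_poly_eq0 msizeX mdeg1.
have S1 i : msize ('X_i : {mpoly k[3]}) = 2%N by rewrite msizeX mdeg1.
have S2 i : msize ('X_i ^+ 2 : {mpoly k[3]}) = 3%N by rewrite expr2 msizeM // S1.
have S3 i : msize ('X_i ^+ 3 : {mpoly k[3]}) = 4%N.
  by rewrite exprS msizeM ?expf_neq0 // S1 S2.
rewrite /cubic_mpoly /cubic.
do 3 rewrite (leq_trans (msizeD_le _ _)) // geq_max ?S3 ?andbT //.
by rewrite msizeN (msizeM (X0 i1) (expf_neq0 2 (X0 i2))) (msizeM (expf_neq0 2 (X0 i0)) (X0 i2)) !S1 !S2.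
Qed.

Lemma cubic_linear_factor (l : {mpoly k[3]}) : divides l cubic_mpoly ->
  (msize l <= 2)%N -> (msize l <= 1)%N.
Proof.
move=> [c Ec] l2; have El := linear_mpoly l2.
have lv v : l.@[v] = l@_0 + l@_(U_(i0)) * v i0 + l@_(U_(i1)) * v i1 + l@_(U_(i2)) * v i2.
  by rewrite {1}El sum3 !mevalD mevalC !mevalZ !mevalXU !addrA.
have [|a0 b0 c0] := @cubic_no_line l@_(U_(i0)) l@_(U_(i1)) l@_(U_(i2)) l@_0.
  move=> x y z H; pose v (i : 'I_3) := if i == i0 then x else if i == i1 then y else z.
  have := meval_cubic v; rewrite Ec mevalM (_ : l.@[v] = 0) ?mulr0 // lv -[RHS]H /v /=; ring.
by rewrite El sum3 a0 b0 c0 !scale0r !addr0 msizeC leq_b1.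
Qed.

(** C vanishes at the origin, so it is not a unit and has a prime factor q. Having no linear factor,
    C leaves q degree at least 2; the cofactor then has degree at most 1 and is constant for the
    same reason, so C is associated to q. *)
Lemma cubic_prime : prime_element cubic_mpoly.
Proof.
have [u [[|q s] [uu ps EG]]] := factorial_mpoly cubic_mpoly_neq0.
  have : u.@[fun=> 0] \is a GRing.unit by rewrite rmorph_unit.
  have := meval_cubic (fun=> 0); rewrite EG big_nil mulr1 => ->.
  by rewrite /cubic !(expr0n, mul0r, subr0, addr0) unitr0.
have pq := ps q (mem_head _ _); have [q0 nq qP] := pq.
have [r EGr] : exists r, cubic_mpoly = q * r.
  by exists (u * \prod_(j <- s) j); rewrite EG big_cons; ring.
have r0 : r != 0 by apply: contraNneq cubic_mpoly_neq0 => r0; rewrite EGr r0 mulr0.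
have cu (p : {mpoly k[3]}) : p != 0 -> (msize p <= 1)%N -> p \is a GRing.unit.
  move=> p0 /msize1_polyC pC; move: p0; rewrite pC mpolyC_eq0 => c0.
  by rewrite rmorph_unit // unitfE.
have q3 : (2 < msize q)%N.
  rewrite ltnNge; apply/negP => q2; move/negP: nq; apply; apply: cu => //.
  by apply: cubic_linear_factor => //; exists r; rewrite EGr mulrC.
have ur : r \is a GRing.unit.
  apply: cu => //; apply: cubic_linear_factor; first by exists q.
  have := msize_cubic; rewrite EGr msizeM //; move: q3.
  by set a := msize q; set b := msize r; lia.
split; first exact: cubic_mpoly_neq0.
  by apply: contra nq; rewrite EGr unitrM => /andP[].
have dv a : divides q a -> divides cubic_mpoly a.
  by case=> c ->; exists (c / r); rewrite EGr -mulrA (mulrCA r^-1) mulVr // mulr1.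
move=> a b [c Ec]; have /qP[/dv|/dv] : divides q (a * b); [|by left|by right].
by exists (c * r); rewrite Ec EGr; ring.
Qed.

End Cubic.

(** * Functions regular along all prime divisors of affine space *)

Section Hartogs.
Variables (n : nat) (k : numClosedFieldType) (K : function_field n k).
Implicit Types (w : 'I_n -> K) (p q : {mpoly k[n]}).

Lemma divides_ev w p q : frame w -> ev w p != 0 -> divides p q <-> alg w (ev w q / ev w p).
Proof.
move=> fw p0; split=> [[c ->]|/algP[c E]].
  by rewrite rmorphM mulfK //; apply: alg_ev.
by exists c; apply: (ev_inj fw); rewrite rmorphM /= -E divfK.
Qed.

Lemma ev_prime w p : frame w -> prime_element p -> prime_elt (alg w) (ev w p).
Proof.
move=> fw [p0 np pP]; have sA := alg_subring w.
have ep0 : ev w p != 0 by rewrite -(rmorph0 (ev w)) (inj_eq (ev_inj fw)).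
split=> //; first exact: alg_ev.
  move/algP => [q Eq]; move/negP: np; apply; apply/unitrPr; exists q.
  by apply: (ev_inj fw); rewrite rmorphM rmorph1 /= -Eq divff.
move=> _ _ /algP[a ->] /algP[b ->].
by rewrite -rmorphM -!(divides_ev _ fw ep0) => /pP.
Qed.

(** The algebraic Hartogs lemma. The denominator of h is a product of primes; regularity along each
    of them forces it to divide the numerator, and the primes cancel one by one. *)
Lemma hartogs w (h : K) : frame w ->
  (forall g : K, prime_elt (alg w) g -> prime_loc (alg w) g h) -> alg w h.
Proof.
move=> fw H; have sA := alg_subring w; have [_ fr] := fw.
have [_ [_ [/algP[p ->] /algP[q ->] q0 Eh]]] := fr h.
have q0' : q != 0 by apply: contraNneq q0 => ->; rewrite rmorph0.
have [u [s [uu ps Eq]]] := factorial_mpoly q0'.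
have [v uv] := unitrPr uu.
have u0 : ev w u != 0 by apply: contraNneq q0 => Z; rewrite Eq rmorphM /= Z mul0r.
have {}Eh : h = ev w (p * v) / \prod_(g <- s) ev w g.
  rewrite Eh Eq rmorphM rmorph_prod /= invfM mulrA; congr (_ / _).
  by rewrite rmorphM /=; congr (_ * _); apply: (mulfI u0); rewrite divff // -rmorphM uv rmorph1.
move: (p * v) Eh => {u uu q q0 q0' Eq v uv u0} r; elim: s r ps => [|g s IH] r ps Eh.
  by rewrite Eh big_nil divr1; apply: alg_ev.
have pg := ev_prime fw (ps g (mem_head _ _)); have [Ag g0 _ gP] := pg.
have ps' a : a \in s -> prime_element a by move=> as'; apply: ps; rewrite inE as' orbT.
have s0 : \prod_(g <- s) ev w g != 0.
  rewrite prodf_seq_neq0; apply/allP => a /ps'[a0 _ _] /=.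
  by rewrite -(rmorph0 (ev w)) (inj_eq (ev_inj fw)).
have [a [b [Aa Ab nb Ehab]]] := H _ pg.
have b0 : b != 0.
  by apply: contra_notN nb => /eqP->; split; rewrite ?mul0r; apply: subring0.
have Ai : alg w (ev w r * b / ev w g).
  have -> : ev w r * b / ev w g = a * \prod_(g <- s) ev w g.
    have <- : h * (b * \prod_(g <- s) ev w g) = a * \prod_(g <- s) ev w g.
      by rewrite Ehab mulrA divfK.
    by rewrite Eh big_cons; field; rewrite g0 s0.
  by apply: subringM => //; apply: subring_prod => // c; apply: alg_ev.
case: (gP _ _ (alg_ev w r) Ab Ai) => [/algP[r' Er']|bg]; last by case: nb.
by apply: (IH r') => //; rewrite Eh big_cons -Er' invfM mulrA.
Qed.

End Hartogs.

(** * Closed points, smoothness and normal crossings in a chart *)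

Section ClosedPoints.
Variables (n : nat) (k : numClosedFieldType) (K : function_field n k).
Implicit Types (A B R S V E L : set K) (f g h t : K) (w : 'I_n -> K).
#[local] Hint Resolve subalg_subring alg_subring : core.

Definition val R f (c : k) := R f /\ maxid R (f - cst K c).

Section Values.
Variable R : set K.
Hypotheses (lR : local_ring R) (cR : has_cst R).
Let sR := lR.1.

Lemma val_cst c : val R (cst K c) c.
Proof. by split; rewrite ?subrr //; apply: maxid0. Qed.

Lemma valD f g c d : val R f c -> val R g d -> val R (f + g) (c + d).
Proof.
move=> [Rf mf] [Rg mg]; split; first exact: subringD.
by rewrite rmorphD opprD addrACA; apply: localD.
Qed.

Lemma valN f c : val R f c -> val R (- f) (- c).
Proof.
by move=> [Rf mf]; split; [exact: subringN | rewrite rmorphN -opprD; apply: localN].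
Qed.

Lemma valM f g c d : val R f c -> val R g d -> val R (f * g) (c * d).
Proof.
move=> [Rf mf] [Rg mg]; split; first exact: subringM.
have -> : f * g - cst K (c * d) = (f - cst K c) * g + cst K c * (g - cst K d).
  by rewrite rmorphM /=; ring.
by apply: localD => //; [apply: maxidMr | apply: maxidM].
Qed.

Lemma val1 : val R 1 1.
Proof. by rewrite -{1}(rmorph1 (cst K)); apply: val_cst. Qed.

Lemma valX f c m : val R f c -> val R (f ^+ m) (c ^+ m).
Proof.
move=> vf; elim: m => [|m IH]; first exact: val1.
by rewrite !exprS; apply: valM.
Qed.

Lemma cst_runit c : c != 0 -> runit R (cst K c).
Proof. by move=> c0; split; rewrite ?fmorph_eq0 // -fmorphV. Qed.

Lemma val_runit f c : val R f c -> c != 0 -> runit R f.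
Proof.
move=> [Rf mf] c0; rewrite -(subrK (cst K c) f) addrC.
by apply: runitD_maxid => //; apply: cst_runit.
Qed.

Lemma val_maxid f c : val R f c -> maxid R f -> c = 0.
Proof. by move=> vf mf; apply/eqP/negPn/negP => /(val_runit vf)/(maxid_nu mf). Qed.

End Values.

Definition shift w (a : 'I_n -> k) i := w i - cst K (a i).

(** Modulo the shifted coordinates every element of k[w] is congruent to a constant. For the
    numerator of an element of the maximal ideal this constant is a non-unit, hence 0. *)
Lemma shift_regular w R (a : 'I_n -> k) : point (alg w) R ->
  (forall i, maxid R (shift w a i)) -> maxid R = ideal_of K R (range (shift w a)).
Proof.
move=> [AR lR RE] ma; have sR := lR.1.
have cR : has_cst R by move=> c; apply: AR; apply: alg_cst.
apply/seteqP; split; last first.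
  by apply: ideal_of_maxid => // _ [i _ <-].
have MI b h : R b -> ideal_of K R (range (shift w a)) h ->
  ideal_of K R (range (shift w a)) (b * h) by exact: ideal_ofM.
have H h : alg w h -> exists c, ideal_of K R (range (shift w a)) (h - cst K c).
  apply: (subalg_min (T := [set h | exists c, ideal_of K R (range (shift w a)) (h - cst K c)])) => /=.
  - by move=> c; exists c; rewrite subrr; apply: ideal_of0.
  - by move=> _ [i _ <-]; exists (a i); apply: ideal_of_incl => //; exists i.
  - by move=> f g [c If] [d Ig]; exists (c + d); rewrite rmorphD opprD addrACA; apply: ideal_of_add.
  - move=> f g [c If] [d Ig]; exists (c * d).
    have Rg : R g.
      have : maxid R (g - cst K d) by apply: (ideal_of_maxid lR _ _ Ig) => // _ [i _ <-].
      by move/maxid_in => Rgd; rewrite -(subrK (cst K d) g); apply: subringD.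
    have -> : f * g - cst K (c * d) = g * (f - cst K c) + cst K c * (g - cst K d).
      by rewrite rmorphM /=; ring.
    by apply: ideal_of_add; apply: MI.
move=> h mh; have := maxid_in mh; rewrite {1}RE => -[b [d [Ab Ad ud Eh]]].
have [c Ic] := H _ Ab.
have mc : maxid R (b - cst K c) by apply: (ideal_of_maxid lR _ _ Ic) => // _ [i _ <-].
have mb : maxid R b.
  rewrite -(divfK (runit_neq0 ud) b) -Eh mulrC; apply: maxidM => //; exact: runit_in.
have c0 : c = 0 by apply: (val_maxid lR cR (f := b)) => //; split=> //; apply: AR.
rewrite c0 rmorph0 subr0 in Ic; rewrite Eh mulrC; apply: MI => //; by case: ud.
Qed.

Lemma prime_loc_stalk A R g : subring A -> point A R -> prime_elt A g ->
  R `<=` prime_loc A g -> R `&` maxid (prime_loc A g) = ideal_of K R [set g].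
Proof.
move=> sA [AR lR RE] pg RP; have [Ag g0 _ gP] := pg; have sR := lR.1.
have [_ lP _] := prime_loc_point sA pg; have sP := lP.1.
have mg : maxid (prime_loc A g) g.
  by apply/prime_loc_maxid => //; rewrite divff //; apply: subring1.
apply/seteqP; split=> h.
  move=> [Rh mh]; move: (Rh); rewrite {1}RE => -[a [b [Aa Ab ub Eh]]].
  have ma : maxid (prime_loc A g) a.
    rewrite -(divfK (runit_neq0 ub) a) -Eh mulrC; apply: maxidM => //.
    by apply: RP; apply: runit_in.
  have /(prime_loc_maxid sA pg Aa) ag := ma.
  have -> : h = (a / g * b^-1) * g.
    by rewrite Eh mulrAC divfK.
  apply: ideal_of_gen => //; apply: subringM => //; first exact: AR.
  by case: ub.
move=> I; split; first by apply: ideal_of_sub I => // _ ->; apply: AR.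
by apply: ideal_of_maxid I => // _ ->.
Qed.

End ClosedPoints.

Section Charts.
Variables (k : numClosedFieldType) (K : function_field 3 k).
Implicit Types (A B R S V E L : set K) (f g h t : K) (w : 'I_3 -> K) (e kap : 'I_3 -> nat).
#[local] Hint Resolve subalg_subring alg_subring : core.

(* In a chart with coordinates [w], the divisor D is [prod w_i^(e i) * g^2 = 0] and
   [kap i] is the multiplicity of [w_i = 0] in the relative canonical divisor. *)
Definition divisor_chart f w e kap g := [/\ frame w, prime_elt (alg w) g,
  forall i, ~ alg w (g / w i),
  f = (\prod_i w i ^+ e i) * g ^+ 2 &
  exists2 c : k, c != 0 & jac w * \prod_i w i ^+ kap i = cst K c].

Section OneChart.
Variables (f : K) (w : 'I_3 -> K) (e kap : 'I_3 -> nat) (g : K).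
Hypothesis Hc : divisor_chart f w e kap g.
Let fw : frame w. Proof. by case: Hc. Qed.
Let pg : prime_elt (alg w) g. Proof. by case: Hc. Qed.

Lemma chart_mono_runit i (a : 'I_3 -> nat) :
  runit (prime_loc (alg w) (w i)) (\prod_(j | j != i) w j ^+ a j).
Proof.
have pw := coord_prime_elt i fw; have [_ lP _] := prime_loc_point (alg_subring w) pw.
elim/big_rec: _ => [|j h ji uh]; first exact: runit1 lP.1.
apply: runitM => //; first exact: lP.1.
by apply: runitX; [exact: lP.1 | apply: prime_loc_coord_runit].
Qed.

Lemma chart_coord_g i : runit (prime_loc (alg w) (w i)) g.
Proof.
by apply: prime_loc_runit => //; [exact: coord_prime_elt | case: pg | case: Hc].
Qed.

(** If g divided w_i, the prime w_i would divide g, which is excluded, or the cofactor w_i / g,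
    which would make g invertible. *)
Lemma chart_g_coord i : runit (prime_loc (alg w) g) (w i).
Proof.
apply: prime_loc_runit => //; first exact: alg_gen.
have [_ wi0 _ wP] := coord_prime_elt i fw; have [Ag g0 ng _] := pg.
move=> Aw; case: Hc => _ _ /(_ i) ngw _ _.
have : alg w (g * (w i / g) / w i).
  by rewrite mulrCA divff // mulr1 divff //; apply: subring1.
move=> /(wP _ _ Ag Aw)[//|]; rewrite -mulrA mulrCA divff // mulr1 => H; exact: ng.
Qed.

Lemma chart_g_mono (a : 'I_3 -> nat) : runit (prime_loc (alg w) g) (\prod_i w i ^+ a i).
Proof.
have [_ lP _] := prime_loc_point (alg_subring w) pg.
elim/big_rec: _ => [|j h _ uh]; first exact: runit1 lP.1.
apply: runitM => //; first exact: lP.1.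
by apply: runitX; [exact: lP.1 | apply: chart_g_coord].
Qed.

Lemma chart_ord_coord i : ord (prime_loc (alg w) (w i)) f = e i.
Proof.
have pw := coord_prime_elt i fw; have [_ lP _] := prime_loc_point (alg_subring w) pw.
have sP := lP.1; case: Hc => _ _ _ -> _; rewrite (bigD1 i) //= -mulrA ord_prime_loc //.
apply: runitM => //; first exact: chart_mono_runit.
by apply: runitX => //; apply: chart_coord_g.
Qed.

Lemma chart_ord_g : ord (prime_loc (alg w) g) f = 2.
Proof.
case: Hc => _ _ _ -> _; rewrite mulrC ord_prime_loc //; exact: chart_g_mono.
Qed.

Lemma chart_jac_neq0 : jac w != 0. Proof. by case: fw. Qed.

(** [relcan] is minus the order of the Jacobian determinant, and this determinant is the inverse of
    the monomial up to a nonzero constant, a unit at E. *)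
Lemma chart_relcan E : dvr E -> point (alg w) E -> relcan E = ord E (\prod_i w i ^+ kap i).
Proof.
move=> dE pE; rewrite (relcan_frame fw dE pE); have [AE lE _] := pE.
case: Hc => _ _ _ _ [c c0 Ec].
have m0 : \prod_i w i ^+ kap i != 0.
  by apply/eqP => Z; move/eqP: Ec; rewrite Z mulr0 eq_sym fmorph_eq0 (negPf c0).
have := ordM dE chart_jac_neq0 m0; rewrite Ec ord_runit //; last first.
  by apply: cst_runit => // a; apply: AE; apply: alg_cst.
by move/esym/eqP; rewrite addr_eq0 => /eqP->; rewrite opprK.
Qed.

Lemma chart_relcan_ge0 E : dvr E -> point (alg w) E -> 0 <= relcan E.
Proof.
move=> dE pE; rewrite chart_relcan //; have [AE lE _] := pE.
have m0 : \prod_i w i ^+ kap i != 0.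
  by apply/prodf_neq0 => i _; rewrite expf_neq0 // frame_neq0.
apply/ord_ge0 => //; apply: AE; apply: subring_prod => // i.
by apply: subringX => //; apply: alg_gen.
Qed.

Lemma chart_relcan_coord i : relcan (prime_loc (alg w) (w i)) = kap i.
Proof.
have pw := coord_prime_elt i fw; have pP := prime_loc_point (alg_subring w) pw.
rewrite chart_relcan //; last exact: frame_prime_dvr.
by rewrite (bigD1 i) //= ord_prime_loc //; apply: chart_mono_runit.
Qed.

Lemma chart_relcan_g : relcan (prime_loc (alg w) g) = 0.
Proof.
have pP := prime_loc_point (alg_subring w) pg.
rewrite chart_relcan //; last exact: frame_prime_dvr.
rewrite ord_runit //; [exact: frame_prime_dvr | exact: chart_g_mono].
Qed.

Lemma chart_component E : dvr E -> point (alg w) E -> maxid E f ->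
  (exists2 i, (0 < e i)%N & E = prime_loc (alg w) (w i)) \/ E = prime_loc (alg w) g.
Proof.
move=> dE pE; have [AE lE _] := pE; have sE := lE.1; have [Ag _ _ _] := pg.
case: Hc => _ _ _ -> _.
have Ew i : E (w i) by apply: AE; apply: alg_gen.
have Em : E (\prod_i w i ^+ e i).
  by apply: subring_prod => // i; apply: subringX.
move=> /(maxidM_or sE Em (subringX 2 sE (AE _ Ag)))[mm|/(maxidX_or sE (AE _ Ag)) mg]; last first.
  by right; apply: dvr_prime_loc.
left; have [i mi] : exists i, maxid E (w i ^+ e i).
  move: mm; rewrite !big_ord_recl big_ord0 mulr1.
  have EX j : E (w j ^+ e j) by apply: subringX.
  move=> /(maxidM_or sE (EX _) (subringM sE (EX _) (EX _)))[m|]; first by eexists; exact: m.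
  by move=> /(maxidM_or sE (EX _) (EX _))[m|m]; eexists; exact: m.
have mwi := maxidX_or sE (Ew i) mi; exists i.
  by rewrite lt0n; apply/eqP => e0; rewrite e0 in mi; case: (not_maxid1 sE mi).
by apply: dvr_prime_loc => //; apply: coord_prime_elt.
Qed.

(** The shifted coordinates are suitable parameters unless g vanishes at R. In that case g replaces
    a coordinate w_j - a_j whose coefficient in the expansion of g is a unit. The alternative
    [e j = 0] or [a j != 0] says that w_j = 0 is not a component of D through R, so no component
    loses its parameter. *)
Lemma chart_snc (Y : set (set K)) R (a : 'I_3 -> k) : good Y -> separated Y ->
  point (alg w) `<=` Y -> point (alg w) R -> (forall i, maxid R (shift w a i)) ->
  (maxid R g -> exists j (q : 'I_3 -> K), [/\ e j = 0%N \/ a j != 0, runit R (q j),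
     forall i, R (q i) & g = \sum_i q i * shift w a i]) ->
  exists2 u, regular_params R u & forall E, component Y f E -> R `<=` E ->
    exists j, R `&` maxid E = ideal_of K R [set u j].
Proof.
move=> gY sepY AY pR ma Hg; have [AR lR RE] := pR; have sR := lR.1.
have cR : has_cst R by move=> c; apply: AR; apply: alg_cst.
have reg := shift_regular pR ma; have [Ag _ _ _] := pg.
have comp E : component Y f E -> R `<=` E ->
  (exists2 i, (0 < e i)%N & E = prime_loc (alg w) (w i)) \/ E = prime_loc (alg w) g.
  move=> [[YE tE] oE] RE'; have AE := subset_trans AR RE'.
  have dE : dvr E by split=> //; case: (gY _ YE).
  have f0 : f != 0 by apply: contraTneq oE => ->; rewrite ord_zero.
  apply: chart_component => //; last by apply/ord_gt0.
  have [pC dC] := center_point (alg_subring w) dE.1 AE.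
  rewrite (sepY E E (center (alg w) E) (dvr_valuation dE) YE (AY _ pC) (dominates_refl _) dC).
  exact: pC.
have coordE i : R `<=` prime_loc (alg w) (w i) ->
    a i = 0 /\ R `&` maxid (prime_loc (alg w) (w i)) = ideal_of K R [set w i].
  move=> RP; have pw := coord_prime_elt i fw; split; last exact: prime_loc_stalk.
  apply: (val_maxid lR cR (f := w i)).
    by split; [apply: AR; apply: alg_gen | exact: ma].
  split=> [|u]; first by apply: AR; apply: alg_gen.
  apply: (maxid_nu _ (runit_sub RP u)); apply/prime_loc_maxid => //; first exact: alg_gen.
  by rewrite divff ?frame_neq0 //; apply: subring1.
have [ug|mg] := runit_or (AR _ Ag).
  exists (shift w a) => // E /comp H RE'; case: (H RE') => [[i ei EE]|EE]; rewrite EE in RE' *.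
    have [ai ->] := coordE _ RE'; exists i; by rewrite /shift ai rmorph0 subr0.
  case: (maxid_nu _ (runit_sub RE' ug)); apply/prime_loc_maxid => //.
  by rewrite divff; [exact: subring1 | case: pg].
have [j [q [ej uq Rq Eg]]] := Hg mg.
pose u i := if i == j then g else shift w a i; exists u.
  apply/seteqP; split; last first.
    by apply: ideal_of_maxid => // _ [i _ <-]; rewrite /u; case: ifP.
  rewrite reg.
  have su i : i != j -> ideal_of K R (range u) (shift w a i).
    by move=> ij; apply: ideal_of_incl => //; exists i; rewrite /u ?(negPf ij).
  have sj : ideal_of K R (range u) (shift w a j).
    have -> : shift w a j = (q j)^-1 * g + \sum_(i | i != j) (- (q j)^-1 * q i) * shift w a i.
      rewrite Eg (bigD1 j) //= mulrDr mulKf ?(runit_neq0 uq) // -addrA mulr_sumr -big_split /=.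
      by rewrite big1 ?addr0 // => i _; ring.
    apply: ideal_of_add.
      apply: ideal_of_gen; first by case: uq.
      by exists j => //; rewrite /u eqxx.
    elim/big_rec: _ => [|i h ij Ih]; first exact: ideal_of0.
    apply: ideal_of_add => //; apply: ideal_ofM => //; last exact: su.
    by apply: subringM => //; apply: subringN => //; case: uq.
  apply: ideal_of_min; [exact: ideal_of0 | | exact: ideal_of_add].
  move=> b _ Rb [i _ <-]; apply: ideal_ofM => //.
  by have [->|ij] := eqVneq i j; [exact: sj | exact: su].
move=> E /comp H RE'; case: (H RE') => [[i ei EE]|EE]; rewrite EE in RE' *.
  have [ai ->] := coordE _ RE'; exists i; rewrite /u; case: eqVneq => [ij|_].
    by move: ej; rewrite -ij ai eqxx => -[e0|//]; rewrite e0 in ei.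
  by rewrite /shift ai rmorph0 subr0.
by exists j; rewrite /u eqxx prime_loc_stalk.
Qed.

End OneChart.

Inductive mono w : K -> Prop :=
| mono1 : mono w 1
| mono_gen i : mono w (w i)
| monoM s t : mono w s -> mono w t -> mono w (s * t).

Lemma monoX w s m : mono w s -> mono w (s ^+ m).
Proof.
move=> ms; elim: m => [|m IH]; first exact: mono1.
by rewrite exprS; apply: monoM.
Qed.

Lemma mono_alg w s : mono w s -> alg w s.
Proof.
elim=> [|i|s' t _ As _ At]; [exact: subring1 | exact: alg_gen | exact: subringM].
Qed.

Lemma mono_neq0 w s : frame w -> mono w s -> s != 0.
Proof.
move=> fw; elim=> [|i|s' t _ s0 _ t0]; [exact: oner_neq0 | exact: frame_neq0 | exact: mulf_neq0].
Qed.

(** Each w_i is prime and does not divide g; in an equation w_i h = g q it therefore divides q. *)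
Lemma mono_cancel w g s h : frame w -> alg w g -> g != 0 -> (forall i, ~ alg w (g / w i)) ->
  mono w s -> alg w h -> alg w (s * h / g) -> alg w (h / g).
Proof.
move=> fw Ag g0 ng ms; elim: ms h => [|i|s1 s2 m1 IH1 m2 IH2] h Ah H.
- by rewrite mul1r in H.
- have [_ wi0 _ wP] := coord_prime_elt i fw.
  have : alg w (g * (w i * h / g) / w i).
    by rewrite mulrCA divff // mulr1 mulrAC divff ?mul1r.
  move=> /(wP _ _ Ag H)[/ng//|]; suff -> : w i * h / g / w i = h / g by [].
  by field; rewrite g0 wi0.
- apply: IH2 => //; apply: IH1; first by apply: subringM => //; apply: mono_alg.
  by rewrite mulrA.
Qed.

(* [C] and [g] define the same divisor up to the exceptional components [w_i = 0]; any
   element of the algebra of [w] becomes one of that of [w0] after multiplication by a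
   power of [t], which is invertible away from these components. *)
Lemma prime_transform w0 w t C g s : frame w -> alg w0 `<=` alg w -> prime_elt (alg w0) C ->
  alg w0 t -> mono w t -> (forall i, exists m, alg w0 (t ^+ m * w i)) ->
  C = s * g -> mono w s -> (exists m, alg w0 (t ^+ m / s)) -> alg w g ->
  (forall i, ~ alg w (g / w i)) -> ~ alg w g^-1 -> prime_elt (alg w) g.
Proof.
move=> fw A0A [AC C0 _ CP] At mt wt EC ms [m4 sm] Ag ng ng1.
have g0 : g != 0 by apply: contraNneq C0 => Z; rewrite EC Z mulr0.
have s0 := mono_neq0 fw ms; have t0 := mono_neq0 fw mt.
have tX m : alg w0 (t ^+ m) by apply: subringX.
have clear h : alg w h -> exists m, alg w0 (t ^+ m * h).
  apply: (subalg_min (T := [set h | exists m, alg w0 (t ^+ m * h)])) => /=.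
  - by move=> c; exists 0%N; rewrite mul1r; apply: alg_cst.
  - by move=> _ [i _ <-].
  - move=> a b [m1 H1] [m2 H2]; exists (m1 + m2)%N.
    have -> : t ^+ (m1 + m2) * (a + b) = t ^+ m2 * (t ^+ m1 * a) + t ^+ m1 * (t ^+ m2 * b).
      by rewrite exprD; ring.
    by apply: subringD => //; apply: subringM.
  - move=> a b [m1 H1] [m2 H2]; exists (m1 + m2)%N.
    by rewrite exprD mulrACA; apply: subringM.
split=> // a b Aa Ab Aab.
have [m1 H1] := clear _ Aa; have [m2 H2] := clear _ Ab; have [m3 H3] := clear _ Aab.
have back m h : alg w h -> alg w0 (t ^+ m * h / C) -> alg w (h / g).
  move=> Ah /A0A H; apply: (mono_cancel fw Ag g0 ng (monoX m mt) Ah).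
  have -> : t ^+ m * h / g = s * (t ^+ m * h / C) by rewrite EC; field; rewrite s0 g0.
  by apply: subringM => //; apply: mono_alg.
(* The factor t^m3 brings the quotient a b / g into the smaller algebra, and t^m4 clears the
   denominator s that arises from C = s g. *)
have : alg w0 ((t ^+ m1 * a) * (t ^+ (m3 + m4) * (t ^+ m2 * b)) / C).
  have -> : (t ^+ m1 * a) * (t ^+ (m3 + m4) * (t ^+ m2 * b)) / C =
      t ^+ m1 * t ^+ m2 * (t ^+ m3 * (a * b / g)) * (t ^+ m4 / s).
    by rewrite EC exprD; field; rewrite s0 g0.
  by do 3 apply: subringM => //.
have A1 : alg w0 (t ^+ (m3 + m4) * (t ^+ m2 * b)) by apply: subringM.
move=> /(CP _ _ H1 A1)[H|H]; first by left; apply: back H.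
by right; apply: (back ((m3 + m4) + m2)%N) => //; rewrite exprD -(mulrA (t ^+ (m3 + m4))).
Qed.

End Charts.

(** * The charts of the resolution *)

Lemma det3 (R : comNzRingType) (M : 'M[R]_3) :
  \det M = M i0 i0 * (M i1 i1 * M i2 i2 - M i1 i2 * M i2 i1)
         - M i0 i1 * (M i1 i0 * M i2 i2 - M i1 i2 * M i2 i0)
         + M i0 i2 * (M i1 i0 * M i2 i1 - M i1 i1 * M i2 i0).
Proof.
pose F (a b : nat) := M (inord a) (inord b).
have HF i j : M i j = F i j by rewrite /F !inord_val.
rewrite (expand_det_row _ i0) sum3 /cofactor !(expand_det_row _ ord0) !big_ord_recl !big_ord0.
rewrite /cofactor !det_mx11 !mxE !HF /= /bump /=; ring.
Qed.

Section Jacobians.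
Variables (k : numClosedFieldType) (K : function_field 3 k).
Local Notation x := (coord K i0).
Local Notation y := (coord K i1).
Local Notation z := (coord K i2).

Definition lw (s : seq K) (i : 'I_3) := nth 0 s i.

Lemma range_lw (a b c : K) : range (lw [:: a; b; c]) = [set` [:: a; b; c]].
Proof.
apply/seteqP; split=> [_ [i _ <-]|f /=].
  by case: (ord3P i) => ->; rewrite /= !inE eqxx ?orbT.
by rewrite !inE => /or3P[]/eqP->; [exists i0|exists i1|exists i2].
Qed.

Lemma jac_coord : jac (coord K) = 1.
Proof.
rewrite /jac; set M := (X in \det X); have -> : M = 1%:M; last exact: det1.
by apply/matrixP => i j; rewrite !mxE fderiv_coord.
Qed.

Lemma frame_coordK : frame (coord K).
Proof.
by apply: frame_coord; [rewrite jac_coord oner_neq0 | move=> i; apply: alg_gen].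
Qed.

Lemma x_neq0 : x != 0. Proof. exact: (frame_neq0 i0 frame_coordK). Qed.
Lemma y_neq0 : y != 0. Proof. exact: (frame_neq0 i1 frame_coordK). Qed.
Lemma z_neq0 : z != 0. Proof. exact: (frame_neq0 i2 frame_coordK). Qed.

Lemma fderiv_xyz :
  ((fderiv K i0 x = 1) * (fderiv K i0 y = 0) * (fderiv K i0 z = 0) *
  ((fderiv K i1 x = 0) * (fderiv K i1 y = 1) * (fderiv K i1 z = 0)) *
  ((fderiv K i2 x = 0) * (fderiv K i2 y = 0) * (fderiv K i2 z = 1)))%type.
Proof. by rewrite !fderiv_coord. Qed.

Lemma prod3 (F : 'I_3 -> K) : \prod_i F i = F i0 * F i1 * F i2.
Proof.
rewrite !big_ord_recl big_ord0 mulr1 mulrA; congr (F _ * F _ * F _); exact: val_inj.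
Qed.

Definition eqD : K := y * cubic x y z ^+ 2.

Lemma cubic_prime_elt : prime_elt (alg (coord K)) (cubic x y z).
Proof.
have := ev_prime frame_coordK (cubic_prime k).
by rewrite (cubic_morph (ev (coord K))) /= !evX.
Qed.

(** The hypotheses are the finite list of computations that certify a chart. The nonzero value of g
    at the chart origin, where every w_i vanishes, shows that no w_i divides g; a zero of g shows
    that g is not a unit; primality is transferred from C with t = x y z. *)
Lemma chart_intro (w : 'I_3 -> K) (e kap : 'I_3 -> nat) (g s : K) (c : k) :
  jac w * \prod_i w i ^+ kap i = 1 -> mono w x -> mono w y -> mono w z ->
  (forall i, exists m, alg (coord K) ((x * y * z) ^+ m * w i)) ->
  cubic x y z = s * g -> mono w s -> (exists m, alg (coord K) ((x * y * z) ^+ m / s)) ->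
  y * s ^+ 2 = \prod_i w i ^+ e i ->
  at_point w (fun=> 0) g c -> c != 0 -> (exists v, at_point w v g 0) ->
  divisor_chart eqD w e kap g.
Proof.
move=> J mx my mz cl Cg ms sm Es gc c0 [v gv].
have Ag : alg w g by have [p -> _] := gc; apply: alg_ev.
have wc i : alg w (coord K i) by case: (ord3P i) => ->; apply: mono_alg.
have fw : frame w.
  apply: frame_coord => //; apply/eqP => J0; move/eqP: J; rewrite J0 mul0r.
  by rewrite eq_sym oner_eq0.
have ng i : ~ alg w (g / w i).
  by apply: (at_ndvd fw (frame_neq0 i fw) gc c0); apply: at_gen.
split=> //; last first.
- by exists 1; rewrite ?oner_neq0 // J rmorph1.
- by rewrite /eqD Cg exprMn mulrA Es.
apply: (prime_transform (w0 := coord K) (t := x * y * z) fw _ cubic_prime_elt _ _ cl Cg ms sm Ag ng).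
- by apply: subalg_sub; [exact: alg_subring | exact: subalg_has_cst | move=> _ [i _ <-]].
- by do 2?apply: subringM; try exact: alg_gen; exact: alg_subring.
- by do 2?apply: monoM.
move=> /(at_alg v)[d gd]; have g0 : g != 0.
  by apply: contraPneq gc => -> /(at_fun fw (at0 _ _)) E; rewrite -E eqxx in c0.
have := atM gv gd; rewrite divff // mul0r => /(at_fun fw (at1 _ _))/eqP.
by rewrite oner_eq0.
Qed.

End Jacobians.

(** The strict transforms of C in the five charts, in the arguments (y/x, z/x), (x/y, z/y), (x/y,
    y/z), (x^2/(yz), y/x) and (x/z, yz/x^2). As C is homogeneous, the remaining coordinate of each
    chart only splits off as a power. *)
Definition G1 (F : comNzRingType) (b c : F) := b * c ^+ 2 - c + 1 + b ^+ 3.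
Definition G2 (F : comNzRingType) (s t : F) := t ^+ 2 - s ^+ 2 * t + s ^+ 3 + 1.
Definition G3 (F : comNzRingType) (s w : F) := 1 - s ^+ 2 * w + s ^+ 3 * w ^+ 2 + w ^+ 2.
Definition G4 (F : comNzRingType) (p v : F) := 1 - p + v * p ^+ 2 * (1 + v ^+ 3).
Definition G5 (F : comNzRingType) (u q : F) := q - 1 + u + u ^+ 4 * q ^+ 3.

Ltac unfold_lw := try match goal with w := lw _ |- _ => rewrite /w end; rewrite /lw.

Section ConcreteCharts.
Variables (k : numClosedFieldType) (K : function_field 3 k).
Local Notation x := (coord K i0).
Local Notation y := (coord K i1).
Local Notation z := (coord K i2).
Let x0 : x != 0 := x_neq0 K.
Let y0 : y != 0 := y_neq0 K.
Let z0 : z != 0 := z_neq0 K.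

Ltac at_poly := repeat first [exact: at_gen | exact: at1 | apply: atX | apply: atN | apply: atD | apply: atM].

Section At.
Variables (w : 'I_3 -> K) (v : 'I_3 -> k) (i j : 'I_3).
Lemma at_G1 : at_point w v (G1 (w i) (w j)) (G1 (v i) (v j)). Proof. by rewrite /G1; at_poly. Qed.
Lemma at_G2 : at_point w v (G2 (w i) (w j)) (G2 (v i) (v j)). Proof. by rewrite /G2; at_poly. Qed.
Lemma at_G3 : at_point w v (G3 (w i) (w j)) (G3 (v i) (v j)). Proof. by rewrite /G3; at_poly. Qed.
Lemma at_G4 : at_point w v (G4 (w i) (w j)) (G4 (v i) (v j)). Proof. by rewrite /G4; at_poly. Qed.
Lemma at_G5 : at_point w v (G5 (w i) (w j)) (G5 (v i) (v j)). Proof. by rewrite /G5; at_poly. Qed.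
End At.

(** [C1] and [C2] are charts of the first blow-up that the later centres miss. [C3] comes from the
    second blow-up, [C4] and [C5] from the third. *)
Definition C1 := [:: x; y / x; z / x].
Definition C2 := [:: x / y; y; z / y].
Definition C3 := [:: x / y; y / z; z].
Definition C4 := [:: x ^+ 2 / (y * z); y / x; z].
Definition C5 := [:: x / z; y * z / x ^+ 2; z].

Definition nw (s : seq nat) (i : 'I_3) := nth 0%N s i.

Ltac alg_poly := repeat first [exact: alg_gen | exact: subring1 (alg_subring _)
  | apply: (subringX _ (alg_subring _)) | apply: (subringM (alg_subring _))].
Ltac by_field := unfold_lw; rewrite ?prod3 /nw /=; field; rewrite ?x0 ?y0 ?z0.
Ltac by_jac := unfold_lw; rewrite /jac det3 prod3 !mxE /= ?expr2 !fderiv_div ?mulf_neq0 ?expf_neq0 // ?fderivM;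
  by rewrite !fderiv_xyz; field; rewrite ?x0 ?y0 ?z0.
Ltac mono_eq e := match goal with |- mono _ ?t => have -> : t = e by by_field end;
  by repeat first [exact: mono_gen | apply: monoM].
Ltac clear_eq m e := exists m; match goal with |- alg _ ?t => have -> : t = e by by_field end; by alg_poly.

Lemma chart1 : divisor_chart (eqD K) (lw C1) (nw [:: 7; 1; 0]) (nw [:: 2; 0; 0])
  (G1 (lw C1 i1) (lw C1 i2)).
Proof.
set w := lw C1; have mx : mono w x by mono_eq (w i0).
have my : mono w y by mono_eq (w i0 * w i1).
have mz : mono w z by mono_eq (w i0 * w i2).
apply: (chart_intro (s := x ^+ 3) (c := 1)) => //.
- by_jac.
- by move=> i; case: (ord3P i) => ->; unfold_lw => /=;
    [clear_eq 0%N (1 * x) | clear_eq 1%N (y * y * z) | clear_eq 1%N (z * y * z)].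
- by rewrite /cubic /G1; by_field.
- by repeat first [apply: monoX | apply: monoM].
- by clear_eq 3%N (y ^+ 3 * z ^+ 3).
- by by_field.
- by have := at_G1 w (fun=> 0) i1 i2; congr at_point; rewrite /G1; ring.
- by rewrite ?oppr_eq0 oner_neq0.
pose v i : k := if i == i1 then -1 else 0.
by exists v; have := at_G1 w v i1 i2; congr at_point; rewrite /v /G1 /=; ring.
Qed.

Lemma chart2 : divisor_chart (eqD K) (lw C2) (nw [:: 0; 7; 0]) (nw [:: 0; 2; 0])
  (G2 (lw C2 i0) (lw C2 i2)).
Proof.
set w := lw C2; have mx : mono w x by mono_eq (w i0 * w i1).
have my : mono w y by mono_eq (w i1).
have mz : mono w z by mono_eq (w i2 * w i1).
apply: (chart_intro (s := y ^+ 3) (c := 1)) => //.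
- by_jac.
- by move=> i; case: (ord3P i) => ->; unfold_lw => /=;
    [clear_eq 1%N (x * x * z) | clear_eq 0%N (1 * y) | clear_eq 1%N (z * x * z)].
- by rewrite /cubic /G2; by_field.
- by repeat first [apply: monoX | apply: monoM].
- by clear_eq 3%N (x ^+ 3 * z ^+ 3).
- by by_field.
- by have := at_G2 w (fun=> 0) i0 i2; congr at_point; rewrite /G2; ring.
- by rewrite ?oppr_eq0 oner_neq0.
pose v i : k := if i == i0 then -1 else 0.
by exists v; have := at_G2 w v i0 i2; congr at_point; rewrite /v /G2 /=; ring.
Qed.

Lemma chart3 : divisor_chart (eqD K) (lw C3) (nw [:: 0; 3; 7]) (nw [:: 0; 1; 2])
  (G3 (lw C3 i0) (lw C3 i1)).
Proof.
set w := lw C3; have mx : mono w x by mono_eq (w i0 * (w i1 * w i2)).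
have my : mono w y by mono_eq (w i1 * w i2).
have mz : mono w z by mono_eq (w i2).
apply: (chart_intro (s := z ^+ 2 * y) (c := 1)) => //.
- by_jac.
- by move=> i; case: (ord3P i) => ->; unfold_lw => /=;
    [clear_eq 1%N (x * x * z) | clear_eq 1%N (x * y * y) | clear_eq 0%N (1 * z)].
- by rewrite /cubic /G3; by_field.
- by repeat first [apply: monoX | apply: monoM].
- by clear_eq 3%N (x ^+ 3 * y ^+ 2 * z).
- by by_field.
- by have := at_G3 w (fun=> 0) i0 i1; congr at_point; rewrite /G3; ring.
- by rewrite ?oppr_eq0 oner_neq0.
pose v i : k := if i == i0 then -1 else 1.
by exists v; have := at_G3 w v i0 i1; congr at_point; rewrite /v /G3 /=; ring.
Qed.

Lemma chart4 : divisor_chart (eqD K) (lw C4) (nw [:: 3; 6; 7]) (nw [:: 1; 2; 2])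
  (G4 (lw C4 i0) (lw C4 i1)).
Proof.
set w := lw C4; have mx : mono w x by mono_eq (w i0 * (w i1 * w i2)).
have my : mono w y by mono_eq (w i0 * (w i1 * (w i1 * w i2))).
have mz : mono w z by mono_eq (w i2).
apply: (chart_intro (s := z ^+ 2 * y) (c := 1)) => //.
- by_jac.
- by move=> i; case: (ord3P i) => ->; unfold_lw => /=;
    [clear_eq 1%N (x ^+ 3) | clear_eq 1%N (y * y * z) | clear_eq 0%N (1 * z)].
- by rewrite /cubic /G4; by_field.
- by repeat first [apply: monoX | apply: monoM].
- by clear_eq 3%N (x ^+ 3 * y ^+ 2 * z).
- by by_field.
- by have := at_G4 w (fun=> 0) i0 i1; congr at_point; rewrite /G4; ring.
- by rewrite ?oppr_eq0 oner_neq0.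
pose v i : k := if i == i0 then 1 else 0.
by exists v; have := at_G4 w v i0 i1; congr at_point; rewrite /v /G4 /=; ring.
Qed.

Lemma chart5 : divisor_chart (eqD K) (lw C5) (nw [:: 6; 1; 7]) (nw [:: 2; 0; 2])
  (G5 (lw C5 i0) (lw C5 i1)).
Proof.
set w := lw C5; have mx : mono w x by mono_eq (w i0 * w i2).
have my : mono w y by mono_eq (w i0 * (w i0 * (w i1 * w i2))).
have mz : mono w z by mono_eq (w i2).
apply: (chart_intro (s := z * x ^+ 2) (c := -1)) => //.
- by_jac.
- by move=> i; case: (ord3P i) => ->; unfold_lw => /=;
    [clear_eq 1%N (x * x * y) | clear_eq 2%N (y ^+ 3 * z ^+ 3) | clear_eq 0%N (1 * z)].
- by rewrite /cubic /G5; by_field.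
- by repeat first [apply: monoX | apply: monoM].
- by clear_eq 3%N (x * y ^+ 3 * z ^+ 2).
- by by_field.
- by have := at_G5 w (fun=> 0) i0 i1; congr at_point; rewrite /G5; ring.
- by rewrite ?oppr_eq0 oner_neq0.
pose v i : k := if i == i1 then 1 else 0.
by exists v; have := at_G5 w v i0 i1; congr at_point; rewrite /v /G5 /=; ring.
Qed.

Lemma frame_D : frame (lw [:: x; y / x; z]).
Proof.
have J : jac (lw [:: x; y / x; z]) * x = 1.
  rewrite /jac det3 !mxE /lw /= !fderiv_div ?mulf_neq0 ?expf_neq0 //.
  by rewrite !fderiv_xyz; field.
pose w := lw [:: x; y / x; z]; apply: frame_coord.
  by apply/eqP => J0; move/eqP: J; rewrite J0 mul0r eq_sym oner_eq0.
have sA := alg_subring w.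
move=> i; case: (ord3P i) => ->; [exact: (alg_gen w i0) | | exact: (alg_gen w i2)].
have Aw : alg w (w i0 * w i1) by apply: subringM => //; apply: alg_gen.
have E : w i0 * w i1 = y by rewrite /w /lw /=; field.
by rewrite E in Aw.
Qed.

End ConcreteCharts.

(** * The three blow-ups *)

Section Resolution.
Variables (k : numClosedFieldType) (K : function_field 3 k).
Implicit Types (A B R S V E L : set K) (M : set (set K)).
Local Notation x := (coord K i0).
Local Notation y := (coord K i1).
Local Notation z := (coord K i2).
Let x0 : x != 0 := x_neq0 K.
Let y0 : y != 0 := y_neq0 K.
Let z0 : z != 0 := z_neq0 K.
#[local] Hint Resolve subalg_subring alg_subring : core.

Definition chart_point (s l : seq K) : set K :=
  let A := subalg K [set` s] in localize A (ideal_of K A [set` l]).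

Definition X3 : set (set K) := affine_space K.
Definition origin : set K := chart_point [:: x; y; z] [:: x; y; z].
Definition Y1 : set (set K) := blowup X3 origin.
Definition line1 : set K := chart_point [:: x; y; z] [:: x; y].
Definition Y2 : set (set K) := blowup Y1 line1.
Definition line2 : set K := chart_point [:: x; y / x; z] [:: x; y / x].
Definition Y3 : set (set K) := blowup Y2 line2.

Definition coord_loc (w : 'I_3 -> K) (J : pred 'I_3) := localize (alg w) (coord_ideal w J).

Section CoordLoc.
Variables (w : 'I_3 -> K) (J : pred 'I_3).
Hypothesis fw : frame w.
Let pI := coord_ideal_prime J fw.

Lemma coord_loc_point : point (alg w) (coord_loc w J).
Proof. by apply: localize_point. Qed.

Lemma coord_loc_maxidP h : alg w h -> maxid (coord_loc w J) h <-> coord_ideal w J h.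
Proof. by move=> Ah; apply: localize_maxid1. Qed.

Lemma coord_loc_maxid i : J i -> maxid (coord_loc w J) (w i).
Proof.
move=> Ji; apply/coord_loc_maxidP; first exact: alg_gen.
by apply: ideal_of_incl => //; exists i.
Qed.

Lemma coord_loc_runit i : ~~ J i -> runit (coord_loc w J) (w i).
Proof.
move=> Ji; have [AL _ _] := coord_loc_point.
apply: not_maxid; first by apply: AL; apply: alg_gen.
move/coord_loc_maxidP => /(_ (alg_gen w i)); rewrite -(evX w) coord_idealP // killX (negPf Ji).
by move/eqP; rewrite -msize_poly_eq0 msizeX mdeg1.
Qed.
End CoordLoc.

Lemma chart_pointE (w : 'I_3 -> K) (J : pred 'I_3) (s l : seq K) : range w = [set` s] ->
  [set` l] = [set h | exists2 j, J j & h = w j] -> chart_point s l = coord_loc w J.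
Proof. by rewrite /chart_point /coord_loc /coord_ideal /alg => -> ->. Qed.

Lemma range_coord : range (coord K) = [set` [:: x; y; z]].
Proof.
apply/seteqP; split=> [_ [i _ <-]|f /=].
  by case: (ord3P i) => ->; rewrite /= !inE eqxx ?orbT.
by rewrite !inE => /or3P[]/eqP->; [exists i0|exists i1|exists i2].
Qed.

Lemma alg_coord : alg (coord K) = subalg K [set` [:: x; y; z]].
Proof. by rewrite /alg range_coord. Qed.

Let Jline : pred 'I_3 := fun i => i != i2.

Lemma set_coords (w : 'I_3 -> K) :
  [set` [:: w i0; w i1; w i2]] = [set h | exists2 j, predT j & h = w j].
Proof.
apply/seteqP; split=> [f /=|_ [j _ ->]].
  by rewrite !inE => /or3P[]/eqP->; [exists i0|exists i1|exists i2].
by case: (ord3P j) => ->; rewrite /= !inE eqxx ?orbT.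
Qed.

Lemma set_line (w : 'I_3 -> K) :
  [set` [:: w i0; w i1]] = [set h | exists2 j, Jline j & h = w j].
Proof.
apply/seteqP; split=> [f /=|_ [j + ->]].
  by rewrite !inE => /orP[]/eqP->; [exists i0|exists i1].
by case: (ord3P j) => -> //; rewrite /= !inE eqxx ?orbT.
Qed.

Lemma originE : origin = coord_loc (coord K) predT.
Proof.
apply: chart_pointE; first exact: range_coord.
exact: (set_coords (coord K)).
Qed.

Lemma line1E : line1 = coord_loc (coord K) Jline.
Proof.
apply: chart_pointE; first exact: range_coord.
exact: (set_line (coord K)).
Qed.

Definition wD := lw [:: x; y / x; z].

Lemma line2E : line2 = coord_loc wD Jline.
Proof.
apply: chart_pointE; first exact: range_lw.
exact: (set_line wD).
Qed.

Let fc := frame_coordK K.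
Let fD : frame wD := frame_D K.

Lemma origin_maxid i : maxid origin (coord K i).
Proof. by rewrite originE; apply: coord_loc_maxid. Qed.

Lemma line1_x : maxid line1 x. Proof. by rewrite line1E; apply: coord_loc_maxid. Qed.
Lemma line1_y : maxid line1 y. Proof. by rewrite line1E; apply: coord_loc_maxid. Qed.
Lemma line1_z : runit line1 z. Proof. by rewrite line1E; apply: coord_loc_runit. Qed.
Lemma line2_x : maxid line2 x. Proof. by rewrite line2E; apply: (coord_loc_maxid fD (i := i0)). Qed.
Lemma line2_yx : maxid line2 (y / x). Proof. by rewrite line2E; apply: (coord_loc_maxid fD (i := i1)). Qed.
Lemma line2_z : runit line2 z. Proof. by rewrite line2E; apply: (coord_loc_runit fD (i := i2)). Qed.

Lemma origin_point : point (alg (coord K)) origin.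
Proof. by rewrite originE; apply: coord_loc_point. Qed.
Lemma line1_point : point (alg (coord K)) line1.
Proof. by rewrite line1E; apply: coord_loc_point. Qed.
Lemma line2_point : point (alg wD) line2.
Proof. by rewrite line2E; apply: coord_loc_point. Qed.

Lemma line2_y : maxid line2 y.
Proof.
have [_ [sL _] _] := line2_point.
have -> : y = x * (y / x) by field.
by apply: maxidM => //; [exact: maxid_in line2_x | exact: line2_yx].
Qed.

Definition covers M (ss : seq (seq K)) :=
  M = [set R | exists2 s, s \in ss & point (subalg K [set` s]) R].

Lemma covers_good M ss : covers M ss -> good M.
Proof.
move=> -> R [s _ [AR lR _]]; split=> // c; apply: AR; exact: subalg_cst.
Qed.

Lemma subset_list (s : seq K) (T : set K) : foldr (fun f P => T f /\ P) True s -> [set` s] `<=` T.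
Proof.
elim: s => [_ f /=|a s IH /= [Ta /IH H] f /=]; first by rewrite in_nil.
by rewrite inE => /predU1P[->|/H].
Qed.

Lemma subalg_list_eq (s t : seq K) : foldr (fun f P => subalg K [set` t] f /\ P) True s ->
  foldr (fun f P => subalg K [set` s] f /\ P) True t -> subalg K [set` s] = subalg K [set` t].
Proof. by move=> st ts; apply: subalg_eq; apply: subset_list. Qed.

Lemma subalg_nth (s : seq K) i : (i < size s)%N -> subalg K [set` s] (nth 0 s i).
Proof. by move=> si; apply: subalg_gen; apply: mem_nth. Qed.

Lemma subalg_mul_nth (s : seq K) i j f : (i < size s)%N -> (j < size s)%N ->
  f = nth 0 s i * nth 0 s j -> subalg K [set` s] f.
Proof. by move=> si sj ->; apply: subalg_mul; apply: subalg_nth. Qed.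

Lemma subalg_nth_eq (s : seq K) i f : (i < size s)%N -> f = nth 0 s i -> subalg K [set` s] f.
Proof. by move=> si ->; apply: subalg_nth. Qed.

Lemma subalg_1_eq (s : seq K) f : f = 1 -> subalg K [set` s] f.
Proof. by move=> ->; apply: subring1. Qed.

Ltac by_field := rewrite /=; field; rewrite ?x0 ?y0 ?z0.
Ltac is_nth i := by apply: (subalg_nth_eq (i := i)); [|by_field].
Ltac is_prod i j := by apply: (subalg_mul_nth (i := i) (j := j)); [| |by_field].
Ltac by_gens := first [is_nth 0%N | is_nth 1%N | is_nth 2%N | is_nth 3%N | is_nth 4%N | is_nth 5%N
  | is_prod 0%N 1%N | is_prod 0%N 2%N | is_prod 1%N 2%N | by apply: subalg_1_eq; rewrite ?divr1; by_field].

Let C30 := [:: x / z; y / z; z].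
Let CD := [:: x / z; y / x; z].

(** The algebras delivered by a blow-up have redundant generators, such as x/x or a coordinate that
    is a product of two others. This identity and the following ones reduce each of them to three
    coordinates. *)
Lemma blow1_x : subalg K [set` [:: x; y; z; x / x; y / x; z / x]] = subalg K [set` C1 K].
Proof. by apply: subalg_list_eq; rewrite /=; repeat split; by_gens. Qed.

Lemma blow1_y : subalg K [set` [:: x; y; z; x / y; y / y; z / y]] = subalg K [set` C2 K].
Proof. by apply: subalg_list_eq; rewrite /=; repeat split; by_gens. Qed.

Lemma blow1_z : subalg K [set` [:: x; y; z; x / z; y / z; z / z]] = subalg K [set` C30].
Proof. by apply: subalg_list_eq; rewrite /=; repeat split; by_gens. Qed.

Lemma blow2_x : subalg K [set` [:: x / z; y / z; z; x / z / (x / z); y / z / (x / z)]] =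
  subalg K [set` CD].
Proof. by apply: subalg_list_eq; rewrite /=; repeat split; by_gens. Qed.

Lemma blow2_y : subalg K [set` [:: x / z; y / z; z; x / z / (y / z); y / z / (y / z)]] =
  subalg K [set` C3 K].
Proof. by apply: subalg_list_eq; rewrite /=; repeat split; by_gens. Qed.

Lemma blow3_x : subalg K [set` [:: x / z; y / x; z; x / z / (x / z); y / x / (x / z)]] =
  subalg K [set` C5 K].
Proof. by apply: subalg_list_eq; rewrite /=; repeat split; by_gens. Qed.

Lemma blow3_y : subalg K [set` [:: x / z; y / x; z; x / z / (y / x); y / x / (y / x)]] =
  subalg K [set` C4 K].
Proof. by apply: subalg_list_eq; rewrite /=; repeat split; by_gens. Qed.

Lemma blow_one (a b c : K) : subalg K [set` [:: a; b; c; 1 / 1]] = subalg K [set` [:: a; b; c]].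
Proof. by apply: subalg_list_eq; rewrite /=; repeat split; by_gens. Qed.

Lemma stalk_coord (w w' : 'I_3 -> K) (J : pred 'I_3) L R (c : seq K) : frame w' ->
  (forall j, ~~ J j -> w j = w' j) -> L = coord_loc w' J -> alg w' `<=` alg w ->
  alg w `<=` L -> (forall j, J j -> maxid L (w j)) ->
  [set` c] = [set h | exists2 j, J j & h = w j] ->
  point (alg w) R -> ideal_stalk L R = ideal_of K R [set` c].
Proof.
move=> fw' ww' LE A'A AL mJ cE; apply: ideal_stalk_in => //.
- by rewrite LE; apply: point_sub (coord_loc_point _ fw') A'A _; rewrite -LE.
- by rewrite cE => _ [j Jj ->]; apply: mJ.
- by rewrite cE => _ [j Jj ->]; apply: alg_gen.
by move=> a Aa ma; rewrite cE; apply: (coord_ideal_subst fw' ww' LE).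
Qed.

Lemma origin_stalk R : point (subalg K [set` [:: x; y; z]]) R ->
  ideal_stalk origin R = ideal_of K R [set` [:: x; y; z]].
Proof.
rewrite -alg_coord; apply: (stalk_coord (w' := coord K) (J := predT)) => //.
- exact: originE.
- by have [] := origin_point.
- by move=> j _; apply: origin_maxid.
exact: (set_coords (coord K)).
Qed.

Lemma alg_lw (a b c : K) : alg (lw [:: a; b; c]) = subalg K [set` [:: a; b; c]].
Proof. by rewrite /alg range_lw. Qed.

Lemma alg_sub_coord (w : 'I_3 -> K) : (forall i, alg w (coord K i)) -> alg (coord K) `<=` alg w.
Proof.
move=> wc; apply: subalg_sub => //; first exact: subalg_has_cst.
by move=> _ [i _ <-].
Qed.

Lemma local_div L a b : local_ring L -> maxid L a -> runit L b -> maxid L (a / b).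
Proof. by move=> lL ma ub; apply: maxidMr => //; [exact: lL.1 | case: ub]. Qed.

Lemma subalg_in (s : seq K) L : subring L -> has_cst L -> foldr (fun f P => L f /\ P) True s ->
  subalg K [set` s] `<=` L.
Proof. by move=> sL cL H; apply: subalg_sub => //; apply: subset_list. Qed.

Lemma line1_local : local_ring line1. Proof. by have [] := line1_point. Qed.
Lemma line2_local : local_ring line2. Proof. by have [] := line2_point. Qed.
Lemma line1_cst : has_cst line1.
Proof. by have [AL _ _] := line1_point => c; apply: AL; apply: alg_cst. Qed.
Lemma line2_cst : has_cst line2.
Proof. by have [AL _ _] := line2_point => c; apply: AL; apply: alg_cst. Qed.

(** At the generic point of the line z is invertible, so the strict transform of the line is cut out
    by x/z and y/z. The comparison with the coordinates x, y, z is possible because the surviving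
    coordinate z is common to both systems. *)
Lemma line1_stalk_C30 R : point (subalg K [set` C30]) R ->
  ideal_stalk line1 R = ideal_of K R [set` [:: x / z; y / z]].
Proof.
have m0 := local_div line1_local line1_x line1_z.
have m1 := local_div line1_local line1_y line1_z.
rewrite -alg_lw; apply: (stalk_coord (w' := coord K) (J := Jline)) => //.
- by move=> j; case: (ord3P j) => ->.
- exact: line1E.
- apply: alg_sub_coord => i; rewrite alg_lw; case: (ord3P i) => ->; by_gens.
- rewrite alg_lw; apply: subalg_in; [exact: line1_local.1 | exact: line1_cst |].
  by rewrite /=; do !split => //; [exact: maxid_in m0 | exact: maxid_in m1 | exact: runit_in line1_z].
- by move=> j; case: (ord3P j) => ->.
exact: (set_line (lw C30)).
Qed.

Lemma line2_stalk_CD R : point (subalg K [set` CD]) R ->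
  ideal_stalk line2 R = ideal_of K R [set` [:: x / z; y / x]].
Proof.
have m0 := local_div line2_local line2_x line2_z.
rewrite -alg_lw; apply: (stalk_coord (w' := wD) (J := Jline)) => //.
- by move=> j; case: (ord3P j) => ->.
- exact: line2E.
- rewrite !alg_lw; apply: subalg_in; [exact: subalg_subring | exact: subalg_has_cst |].
  by rewrite /=; repeat split; by_gens.
- rewrite alg_lw; apply: subalg_in; [exact: line2_local.1 | exact: line2_cst |].
  by rewrite /=; do !split => //; [exact: maxid_in m0 | exact: maxid_in line2_yx | exact: runit_in line2_z].
- by move=> j; case: (ord3P j) => -> // _; exact: line2_yx.
exact: (set_line (lw CD)).
Qed.

(* [a / b] is not regular at [L] when [b] vanishes there and [a] does not. *)
Lemma stalk_quo L R (s : seq K) a b : local_ring L -> b != 0 -> maxid L b -> runit L a -> a / b \in s ->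
  point (subalg K [set` s]) R -> ideal_stalk L R = ideal_of K R [set` [:: 1]].
Proof.
move=> lL b0 mb ua abs; apply: ideal_stalk_one => /(_ (a / b)) H.
apply: (maxid_nu _ ua); rewrite -(divfK b0 a); apply: maxidM => //; first exact: lL.1.
by apply: H; apply: subalg_gen.
Qed.

Lemma runit_one L : local_ring L -> runit L 1.
Proof. by move=> lL; apply: runit1; exact: lL.1. Qed.

Lemma cover_X3 : covers X3 [:: [:: x; y; z]].
Proof.
rewrite /covers /X3 /affine_space range_coord; apply/seteqP; split=> R.
  by move=> /specP pR; exists [:: x; y; z]; [rewrite mem_head | apply: pR].
by move=> [s]; rewrite inE => /eqP-> pR; apply/specP.
Qed.

(** Reduces a blow-up to an equality between two explicit lists of algebras, together with the ideal
    of the centre on each chart. *)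
Lemma blowup_step M L (ss : seq (seq K * seq K)) (ss' : seq (seq K)) :
  covers M [seq p.1 | p <- ss] ->
  (forall (p : seq K * seq K) R, p \in ss -> point (subalg K [set` p.1]) R ->
     ideal_stalk L R = ideal_of K R [set` p.2]) ->
  (forall p : seq K * seq K, p \in ss -> all (fun f => f != 0) p.2 && (p.2 != [::])) ->
  [seq subalg K [set` s] | s <- ss'] =
  flatten [seq [seq subalg K [set` p.1 ++ [seq f / g | f <- p.2]] | g <- p.2] | p <- ss] ->
  covers (blowup M L) ss' /\ principal_stalks M L.
Proof.
move=> cM st nz E; have ME : M = [set R | exists2 p : seq K * seq K, p \in ss & point (subalg K [set` p.1]) R].
  rewrite cM; apply/seteqP; split=> R.
    by move=> [_ /mapP[p pss ->] pR]; exists p.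
  by move=> [p pss pR]; exists p.1 => //; apply: map_f.
split.
  have E' A : (exists2 s, s \in ss' & subalg K [set` s] = A) <->
    (exists p g, [/\ p \in ss, g \in p.2 & subalg K [set` p.1 ++ [seq f / g | f <- p.2]] = A]).
    split=> [[s sss' <-]|[p [g [pss gp EA]]]].
      have : subalg K [set` s] \in [seq subalg K [set` s] | s <- ss'].
        by apply/mapP; exists s.
      rewrite E => /flatten_mapP[p pss /mapP[g gp EA]]; by exists p, g.
    have : A \in [seq subalg K [set` s] | s <- ss'].
      by rewrite E; apply/flatten_mapP; exists p => //; apply/mapP; exists g.
    by move/mapP => [s sss' ->]; exists s.
  apply/seteqP; split=> R.
    move=> /(blowup_spec ME st)[p [g [pss gp g0 pR]]].
    have [_ /(_ (ex_intro _ p (ex_intro _ g (And3 pss gp (erefl _)))))] := E' (subalg K [set` p.1 ++ [seq f / g | f <- p.2]]).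
    by move=> [s sss' Es]; exists s => //; rewrite Es.
  move=> [s sss' pR]; apply/(blowup_spec ME st).
  have [/(_ (ex_intro2 _ _ s sss' (erefl _)))[p [g [pss gp Eg]]] _] := E' (subalg K [set` s]).
  exists p, g; split=> //; last by rewrite Eg.
  by have /andP[/allP/(_ g gp)] := nz _ pss.
move=> V R vV; rewrite ME => -[p pss pR] d; have [AR lR _] := pR.
apply: (principal_stalk vV d lR.1 _ (st _ _ pss pR)).
have := nz _ pss; case: (p.2) => [|a l]; first by rewrite andbF.
by rewrite /= => /andP[/andP[-> _] _].
Qed.

Lemma div_neq0 (a b : K) : a != 0 -> b != 0 -> a / b != 0.
Proof. by move=> a0 b0; rewrite mulf_neq0 ?invr_eq0. Qed.

Lemma step1 : covers Y1 [:: C1 K; C2 K; C30] /\ principal_stalks X3 origin.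
Proof.
apply: (blowup_step (ss := [:: ([:: x; y; z], [:: x; y; z])])).
- exact: cover_X3.
- by move=> p R; rewrite inE => /eqP-> /=; apply: origin_stalk.
- by move=> p; rewrite inE => /eqP-> /=; rewrite x0 y0 z0.
- by rewrite /= blow1_x blow1_y blow1_z.
Qed.

Lemma step2 : covers Y2 [:: C1 K; C2 K; CD; C3 K] /\ principal_stalks Y1 line1.
Proof.
apply: (blowup_step (ss := [:: (C1 K, [:: 1]); (C2 K, [:: 1]); (C30, [:: x / z; y / z])])).
- exact: step1.1.
- move=> p R; rewrite !inE => /or3P[]/eqP-> /=.
  + apply: (stalk_quo line1_local x0 line1_x line1_z); by rewrite !inE eqxx ?orbT.
  + apply: (stalk_quo line1_local y0 line1_y line1_z); by rewrite !inE eqxx ?orbT.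
  + exact: line1_stalk_C30.
- by move=> p; rewrite !inE => /or3P[]/eqP-> /=; rewrite ?oner_neq0 ?div_neq0.
- by rewrite /= !blow_one blow2_x blow2_y.
Qed.

Lemma step3 : covers Y3 [:: C1 K; C2 K; C5 K; C4 K; C3 K] /\ principal_stalks Y2 line2.
Proof.
apply: (blowup_step (ss := [:: (C1 K, [:: 1]); (C2 K, [:: 1]); (CD, [:: x / z; y / x]); (C3 K, [:: 1])])).
- exact: step2.1.
- move=> p R; rewrite !inE => /or4P[]/eqP-> /=.
  + apply: (stalk_quo line2_local x0 line2_x line2_z); by rewrite !inE eqxx ?orbT.
  + apply: (stalk_quo line2_local y0 line2_y line2_z); by rewrite !inE eqxx ?orbT.
  + exact: line2_stalk_CD.
  (* The coordinate x/y of this chart is the inverse of y/x, which vanishes along [line2]; hence the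
     chart misses the centre. *)
  + have xy : x / y = 1 / (y / x) by field; rewrite x0 y0.
    apply: (stalk_quo (a := 1) line2_local (div_neq0 y0 x0) line2_yx (runit_one line2_local)).
    by rewrite -xy !inE eqxx.
- by move=> p; rewrite !inE => /or4P[]/eqP-> /=; rewrite ?oner_neq0 ?div_neq0.
- by rewrite /= !blow_one blow3_x blow3_y.
Qed.

Lemma good_X3 : good X3. Proof. exact: covers_good cover_X3. Qed.
Lemma good_Y1 : good Y1. Proof. exact: covers_good step1.1. Qed.
Lemma good_Y2 : good Y2. Proof. exact: covers_good step2.1. Qed.
Lemma good_Y3 : good Y3. Proof. exact: covers_good step3.1. Qed.

Lemma separated_X3 : separated X3.
Proof.
move=> V R1 R2 vV; rewrite cover_X3 => -[s1 /[!inE]/eqP-> p1] [s2 /[!inE]/eqP-> p2].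
by move=> d1 d2; apply: (separated_point vV p1 p2).
Qed.

Lemma separated_Y1 : separated Y1.
Proof. by apply: blowup_separated; [exact: good_X3 | exact: separated_X3]. Qed.
Lemma separated_Y2 : separated Y2.
Proof. by apply: blowup_separated; [exact: good_Y1 | exact: separated_Y1]. Qed.
Lemma separated_Y3 : separated Y3.
Proof. by apply: blowup_separated; [exact: good_Y2 | exact: separated_Y2]. Qed.

Lemma proper_Y3 : proper_birational Y3 X3.
Proof.
split=> [R3 /blowup_dom[R2 /blowup_dom[R1 /blowup_dom[R X3R d1] d2] d3]|V R vV X3R d].
  by exists R => //; apply: dominates_trans d1; apply: dominates_trans d2.
have [R1 YR1 d1] := blowup_proper good_X3 step1.2 vV X3R d.
have [R2 YR2 d2] := blowup_proper good_Y1 step2.2 vV YR1 d1.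
exact: (blowup_proper good_Y2 step3.2 vV YR2 d2).
Qed.

Lemma X3_coord R i : X3 R -> R (coord K i).
Proof.
move/specP => [//|AR _ _]; apply: AR; exact: alg_gen.
Qed.

Lemma Y1_coord R i : Y1 R -> R (coord K i).
Proof. by move/blowup_dom => [S XS [SR _]]; apply: SR; apply: X3_coord. Qed.
Lemma Y2_coord R i : Y2 R -> R (coord K i).
Proof. by move/blowup_dom => [S XS [SR _]]; apply: SR; apply: Y1_coord. Qed.
Lemma Y3_coord R i : Y3 R -> R (coord K i).
Proof. by move/blowup_dom => [S XS [SR _]]; apply: SR; apply: Y2_coord. Qed.

Lemma coord_eqD R : subring R -> (forall i, R (coord K i)) -> R (cubic x y z).
Proof.
move=> sR Rc; rewrite /cubic; do 2?apply: subringD => //; try apply: subringB => //;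
  by do ?[exact: Rc | apply: subringX | apply: subringM].
Qed.

Lemma ring_eqD R : subring R -> (forall i, R (coord K i)) -> R (eqD K).
Proof.
by move=> sR Rc; apply: subringM => //; apply: subringX => //; apply: coord_eqD.
Qed.

Lemma maxid_eqD L : local_ring L -> (forall i, L (coord K i)) -> maxid L y -> maxid L (eqD K).
Proof.
move=> lL Lc my; have sL := lL.1; apply: maxidMr => //; apply: subringX => //; exact: coord_eqD.
Qed.

Lemma line2_coord i : line2 (coord K i).
Proof.
by case: (ord3P i) => ->; [exact: maxid_in line2_x | exact: maxid_in line2_y | exact: runit_in line2_z].
Qed.

(** The function y, and with it [eqD], vanishes at the generic point of each of the three centres,
    so no blow-up affects the points where [eqD] is invertible. *)
Lemma iso_Y3 : [set R | Y3 R /\ runit R (eqD K)] = [set R | X3 R /\ runit R (eqD K)].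
Proof.
have mO : maxid origin (eqD K).
  have [AO lO _] := origin_point; apply: maxid_eqD => // [i|]; last exact: origin_maxid.
  by apply: AO; apply: alg_gen.
have m1 : maxid line1 (eqD K).
  have [AO lO _] := line1_point; apply: maxid_eqD => // [i|]; last exact: line1_y.
  by apply: AO; apply: alg_gen.
have m2 : maxid line2 (eqD K).
  apply: maxid_eqD; [exact: line2_local | exact: line2_coord | exact: line2_y].
have in0 S : X3 S -> S (eqD K).
  by move=> XS; apply: ring_eqD => [|i]; [exact: (good_X3 XS).1.1 | exact: X3_coord].
have in1 S : Y1 S -> S (eqD K).
  by move=> XS; apply: ring_eqD => [|i]; [exact: (good_Y1 XS).1.1 | exact: Y1_coord].
have in2 S : Y2 S -> S (eqD K).
  by move=> XS; apply: ring_eqD => [|i]; [exact: (good_Y2 XS).1.1 | exact: Y2_coord].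
apply/seteqP; split=> R /=.
  by move=> /(blowup_unit _ good_Y2 in2 m2)/(blowup_unit _ good_Y1 in1 m1)/(blowup_unit _ good_X3 in0 mO).
by move=> /(blowup_unit _ good_X3 in0 mO)/(blowup_unit _ good_Y1 in1 m1)/(blowup_unit _ good_Y2 in2 m2).
Qed.

Lemma not_setT_sub L f : f != 0 -> maxid L f -> ~ (setT : set K) `<=` L.
Proof. by move=> f0 [Lf nu] H; apply: nu; split=> //; apply: H. Qed.

Lemma setT_Y3 : Y3 setT.
Proof.
have XT : X3 setT.
  apply/specP => //; apply: pointW => //; first exact: local_setT.
  move=> h _; have [_ /(_ h)[a [b [Aa Ab b0 ->]]]] := fc.
  by exists a, b; split.
apply: blowup_out; [exact: good_Y2 | | exact: not_setT_sub x0 line2_x].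
apply: blowup_out; [exact: good_Y1 | | exact: not_setT_sub x0 line1_x].
by apply: blowup_out; [exact: good_X3 | | apply: (not_setT_sub x0); exact: (origin_maxid i0)].
Qed.

Lemma variety_Y3 : variety Y3.
Proof.
split; [exact: setT_Y3 | | exact: separated_Y3].
exists [:: C1 K; C2 K; C5 K; C4 K; C3 K]; rewrite step3.1.
apply/seteqP; split=> R [s ss pR]; exists s => //; first exact/specP.
by apply/(specP _ (subalg_subring _)).
Qed.

End Resolution.

Arguments X3 {k} K.
Arguments origin {k} K.
Arguments line1 {k} K.
Arguments line2 {k} K.
Arguments Y1 {k} K.
Arguments Y2 {k} K.
Arguments Y3 {k} K.

(** * Smoothness of the strict transforms *)

Section Nondegenerate.
Variable k : numClosedFieldType.
Implicit Types b c s t u q p v : k.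

Lemma natr_eq0_false m : m.+1%:R = 0 :> k -> False.
Proof. by apply/eqP; apply: natr_neq0. Qed.

(** The curve has no singular point: the hypotheses are the equation and its two partial
    derivatives. The multipliers eliminate the variables and leave a nonzero integer. In the five
    charts it is 93, 31, 31, 31 and 62, always a multiple of 31, a prime modulo which the plane
    cubic C = 0 acquires a singular point. *)
Lemma G1_smooth b c : G1 b c = 0 -> 2%:R * b * c - 1 = 0 -> c ^+ 2 + 3%:R * b ^+ 2 = 0 -> False.
Proof.
rewrite /G1 => g c2 c1; have bc : 2%:R * b * c = 1 by apply/eqP; rewrite -subr_eq0 c2.
have h1 : 12%:R * b ^+ 4 = -1.
  transitivity (4%:R * b ^+ 2 * (c ^+ 2 + 3%:R * b ^+ 2) - (2%:R * b * c) ^+ 2); first by ring.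
  by rewrite c1 bc; ring.
have h2 : 4%:R * b + 4%:R * b ^+ 4 = 1.
  transitivity (4%:R * b * (b * c ^+ 2 - c + 1 + b ^+ 3) - (2%:R * b * c) ^+ 2 + 2%:R * (2%:R * b * c)).
    by ring.
  by rewrite g bc; ring.
have h3 : 3%:R * b = 1.
  apply: (mulfI (natr_neq0 k 3)).
  transitivity (3%:R * (4%:R * b + 4%:R * b ^+ 4) - 12%:R * b ^+ 4); first by ring.
  by rewrite h1 h2; ring.
apply: (@natr_eq0_false 92).
transitivity (12%:R * (3%:R * b) ^+ 4 - 81%:R * (12%:R * b ^+ 4)); last by ring.
by rewrite h3 h1; ring.
Qed.

Lemma G2_smooth s t : G2 s t = 0 -> - 2%:R * s * t + 3%:R * s ^+ 2 = 0 -> 2%:R * t - s ^+ 2 = 0 -> False.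
Proof.
rewrite /G2 => g c1 c2.
have h1 : s ^+ 3 - 3%:R * s ^+ 2 = 0.
  transitivity (- (- 2%:R * s * t + 3%:R * s ^+ 2) - s * (2%:R * t - s ^+ 2)); first by ring.
  by rewrite c1 c2; ring.
have h2 : 3%:R * s ^+ 2 + 4%:R = 0.
  transitivity (4%:R * (t ^+ 2 - s ^+ 2 * t + s ^+ 3 + 1) - (2%:R * t - s ^+ 2) * (2%:R * t - s ^+ 2)
     + s * (s ^+ 3 - 3%:R * s ^+ 2) - (s ^+ 3 - 3%:R * s ^+ 2)); first by ring.
  by rewrite g h1 c2; ring.
have h3 : s = 3%:R.
  apply: (mulfI (natr_neq0 k 3)).
  transitivity (s * (3%:R * s ^+ 2 + 4%:R) - 3%:R * (s ^+ 3 - 3%:R * s ^+ 2) - 3%:R * (3%:R * s ^+ 2 + 4%:R) + 12%:R).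
    by ring.
  by rewrite h1 h2; ring.
by apply: (@natr_eq0_false 30); rewrite -[RHS]h2 h3; ring.
Qed.

Lemma G3_smooth s w : G3 s w = 0 -> - 2%:R * s * w + 3%:R * s ^+ 2 * w ^+ 2 = 0 ->
  - s ^+ 2 + 2%:R * (s ^+ 3 + 1) * w = 0 -> False.
Proof.
rewrite /G3 => g c1 c2.
have h1 : s ^+ 2 * w = 2%:R.
  transitivity (2%:R - 2%:R * (1 - s ^+ 2 * w + s ^+ 3 * w ^+ 2 + w ^+ 2) + w * (- s ^+ 2 + 2%:R * (s ^+ 3 + 1) * w)).
    by ring.
  by rewrite g c2; ring.
have h2 : s = 3%:R.
  apply: (mulfI (natr_neq0 k 3)).
  transitivity (- (s ^+ 2 * (- 2%:R * s * w + 3%:R * s ^+ 2 * w ^+ 2)) + 3%:R * (s ^+ 2 * w) ^+ 2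
     - 2%:R * s * (s ^+ 2 * w) + 4%:R * s); first by ring.
  by rewrite c1 h1; ring.
have h3 : 9%:R * w = 2%:R by rewrite -[RHS]h1 h2; ring.
rewrite h2 in g; apply: (@natr_eq0_false 30).
transitivity (81%:R * (1 - 3%:R ^+ 2 * w + 3%:R ^+ 3 * w ^+ 2 + w ^+ 2)
  - 28%:R * ((9%:R * w) ^+ 2 - 4%:R) + 81%:R * (9%:R * w - 2%:R)); first by ring.
by rewrite g h3; ring.
Qed.

Lemma G3_neq0 s w : G3 s w = 0 -> w != 0.
Proof.
rewrite /G3 => g; apply/eqP => w0; rewrite w0 in g; apply: (@natr_eq0_false 0).
by rewrite -[RHS]g; ring.
Qed.

Lemma G4_smooth p v : G4 p v = 0 -> - 1 + 2%:R * p * (v + v ^+ 4) = 0 ->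
  p ^+ 2 * (1 + 4%:R * v ^+ 3) = 0 -> False.
Proof.
rewrite /G4 => g c1 c2.
have h1 : p = 2%:R.
  transitivity (- 2%:R * (1 - p + v * p ^+ 2 * (1 + v ^+ 3)) + p * (- 1 + 2%:R * p * (v + v ^+ 4)) + 2%:R).
    by ring.
  by rewrite g c1; ring.
have h2 : 1 + 4%:R * v ^+ 3 = 0.
  by apply: (mulfI (expf_neq0 2 (natr_neq0 k 1))); rewrite mulr0 -[RHS]c2 h1.
have h3 : 3%:R * v = 1.
  transitivity ((- 1 + 2%:R * p * (v + v ^+ 4)) - v * (1 + 4%:R * v ^+ 3) + 1); last by rewrite c1 h2; ring.
  by rewrite h1; ring.
apply: (@natr_eq0_false 30).
transitivity (27%:R + 4%:R * (3%:R * v) ^+ 3); first by rewrite h3; ring.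
by transitivity (27%:R * (1 + 4%:R * v ^+ 3)); [ring | rewrite h2 mulr0].
Qed.

Lemma G4_neq0 p v : G4 p v = 0 -> p != 0.
Proof.
rewrite /G4 => g; apply/eqP => p0; rewrite p0 in g; apply: (@natr_eq0_false 0).
by rewrite -[RHS]g; ring.
Qed.

(** On v = 0 the derivative of [G4] in p is -1. The strict transform is therefore transversal to
    this exceptional divisor, and the derivative in v matters only away from it. *)
Lemma G4_v_neq0 p v : - 1 + 2%:R * p * (v + v ^+ 4) = 0 -> v != 0.
Proof.
move=> c; apply/eqP => v0; rewrite v0 in c; apply: (@natr_eq0_false 0).
by rewrite -[RHS]oppr0 -[in RHS]c; ring.
Qed.

Lemma G5_smooth u q : G5 u q = 0 -> 1 + 4%:R * u ^+ 3 * q ^+ 3 = 0 ->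
  1 + 3%:R * u ^+ 4 * q ^+ 2 = 0 -> False.
Proof.
rewrite /G5 => g c1 c2.
have h1 : 2%:R * q = 1.
  transitivity (4%:R * (q - 1 + u + u ^+ 4 * q ^+ 3) - u * (1 + 4%:R * u ^+ 3 * q ^+ 3)
    - 3%:R * (q - 1 + u + u ^+ 4 * q ^+ 3) + q * (1 + 3%:R * u ^+ 4 * q ^+ 2) + 1); first by ring.
  by rewrite g c1 c2; ring.
have h2 : 3%:R * u = 2%:R.
  transitivity (3%:R * (q - 1 + u + u ^+ 4 * q ^+ 3) - q * (1 + 3%:R * u ^+ 4 * q ^+ 2) - 2%:R * q + 3%:R).
    by ring.
  by rewrite g c2 h1; ring.
apply: (@natr_eq0_false 61).
transitivity (54%:R + (3%:R * u) ^+ 3 * (2%:R * q) ^+ 3); first by rewrite h1 h2; ring.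
by transitivity (54%:R * (1 + 4%:R * u ^+ 3 * q ^+ 3)); [ring | rewrite c1 mulr0].
Qed.

Lemma G5_u0 u q : G5 u q = 0 -> u = 0 -> q = 1.
Proof.
rewrite /G5 => g u0; rewrite u0 in g; apply/eqP; rewrite -subr_eq0 -[X in _ == X]g; apply/eqP; ring.
Qed.

End Nondegenerate.

(** * Transversality of the strict transforms to the other components *)

Section SNC.
Variables (k : numClosedFieldType) (K : function_field 3 k).
Implicit Types (R : set K) (w : 'I_3 -> K) (a : 'I_3 -> k) (e : 'I_3 -> nat).

(** The condition under which g can serve as a local parameter in place of a coordinate whose zero
    locus is not a component of D through the point. *)
Definition nondegenerate w e (g : K) := forall R a, point (alg w) R ->
  (forall i, maxid R (shift w a i)) -> maxid R g ->
  exists j (q : 'I_3 -> K), [/\ e j = 0%N \/ a j != 0, runit R (q j),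
     forall i, R (q i) & g = \sum_i q i * shift w a i].

(** Here g involves two coordinates only. In the applications q1 and q2 are difference quotients,
    obtained by moving first one coordinate and then the other to its value at the point, and c1 and
    c2 are the partial derivatives of g there. *)
Lemma nondegenerate_intro w e g i j (q1 q2 : ('I_3 -> k) -> K) (c c1 c2 : ('I_3 -> k) -> k) :
  i != j ->
  (forall R a, local_ring R -> has_cst R -> (forall l, val R (w l) (a l)) ->
    [/\ val R g (c a), val R (q1 a) (c1 a) & val R (q2 a) (c2 a)]) ->
  (forall a, g - cst K (c a) = q1 a * (w i - cst K (a i)) + q2 a * (w j - cst K (a j))) ->
  (forall a, c a = 0 ->
    (c1 a != 0 /\ (e i = 0%N \/ a i != 0)) \/ (c2 a != 0 /\ (e j = 0%N \/ a j != 0))) ->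
  nondegenerate w e g.
Proof.
move=> ij Hv Eg Hc R a pR ma mg; have [AR lR _] := pR.
have cR : has_cst R by move=> b; apply: AR; apply: alg_cst.
have [|vg v1 v2] := Hv R a lR cR; first by move=> l; split; [apply: AR; apply: alg_gen | exact: ma].
have ca0 := val_maxid lR cR vg mg.
pose q l := if l == i then q1 a else if l == j then q2 a else 0.
have qi : q i = q1 a by rewrite /q eqxx.
have qj : q j = q2 a by rewrite /q eq_sym (negPf ij) eqxx.
have Rq l : R (q l).
  by rewrite /q; case: ifP => _; [case: v1 | case: ifP => _; [case: v2 | apply: subring0 lR.1]].
have Es : g = \sum_l q l * shift w a l.
  rewrite (bigD1 i) //= (bigD1 j) //=; last by rewrite eq_sym.
  rewrite big1 ?addr0 => [|l /andP[li lj]]; last by rewrite /q (negPf li) (negPf lj) mul0r.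
  by rewrite qi qj -Eg ca0 rmorph0 subr0.
case: (Hc a ca0) => -[c0 H]; [exists i, q | exists j, q]; split=> //; rewrite ?qi ?qj.
  exact: val_runit v1 c0.
exact: val_runit v2 c0.
Qed.

Let cst_morph := (rmorphD (cst K), rmorphN (cst K), rmorphXn (cst K), rmorphM (cst K), rmorph1 (cst K)).

Ltac val_poly := repeat first
  [match goal with H : forall l, val _ _ _ |- _ => exact: H end | exact: val1 | exact: val_cst
  | apply: valX | apply: valN | apply: valD | apply: valM].

Lemma nondegenerate_G1 w e i j : i != j -> e j = 0%N -> nondegenerate w e (G1 (w i) (w j)).
Proof.
move=> ij e0; apply: (nondegenerate_intro (c := fun a => G1 (a i) (a j))
  (q1 := fun a => w j ^+ 2 + (w i ^+ 2 + w i * cst K (a i) + cst K (a i) ^+ 2))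
  (q2 := fun a => cst K (a i) * (w j + cst K (a j)) - 1)
  (c1 := fun a => a j ^+ 2 + (a i ^+ 2 + a i * a i + a i ^+ 2))
  (c2 := fun a => a i * (a j + a j) - 1) ij) => [R a lR cR vw|a|a g0].
- by rewrite /G1; split; val_poly.
- by rewrite /G1 !cst_morph; ring.
(* Since [e j = 0], a nonzero derivative in w_j is enough. If it vanishes, then a_i is nonzero, so
   w_i = 0 does not pass through the point, and the derivative in w_i is nonzero by smoothness. *)
have [c20|] := eqVneq (a i * (a j + a j) - 1) 0; last by right; split=> //; left.
left; split; last first.
  right; apply/eqP => ai; apply: (@natr_eq0_false k 0).
  by rewrite ai mul0r sub0r in c20; rewrite -[RHS]oppr0 -[in RHS]c20 opprK.
apply/eqP => c10; apply: (G1_smooth g0); [rewrite -[RHS]c20 | rewrite -[RHS]c10]; ring.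
Qed.

Lemma nondegenerate_G2 w e i j : i != j -> e i = 0%N -> e j = 0%N -> nondegenerate w e (G2 (w i) (w j)).
Proof.
move=> ij ei ej; apply: (nondegenerate_intro (c := fun a => G2 (a i) (a j))
  (q1 := fun a => w i ^+ 2 + w i * cst K (a i) + cst K (a i) ^+ 2 - (w i + cst K (a i)) * w j)
  (q2 := fun a => w j + cst K (a j) - cst K (a i) ^+ 2)
  (c1 := fun a => a i ^+ 2 + a i * a i + a i ^+ 2 - (a i + a i) * a j)
  (c2 := fun a => a j + a j - a i ^+ 2) ij) => [R a lR cR vw|a|a g0].
- by rewrite /G2; split; val_poly.
- by rewrite /G2 !cst_morph; ring.
have [c20|] := eqVneq (a j + a j - a i ^+ 2) 0; last by right; split=> //; left.
left; split; last by left.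
apply/eqP => c10; apply: (G2_smooth g0); [rewrite -[RHS]c10 | rewrite -[RHS]c20]; ring.
Qed.

Lemma nondegenerate_G3 w e i j : i != j -> e i = 0%N -> nondegenerate w e (G3 (w i) (w j)).
Proof.
move=> ij e0; apply: (nondegenerate_intro (c := fun a => G3 (a i) (a j))
  (q1 := fun a => (w i ^+ 2 + w i * cst K (a i) + cst K (a i) ^+ 2) * w j ^+ 2 - (w i + cst K (a i)) * w j)
  (q2 := fun a => (cst K (a i) ^+ 3 + 1) * (w j + cst K (a j)) - cst K (a i) ^+ 2)
  (c1 := fun a => (a i ^+ 2 + a i * a i + a i ^+ 2) * a j ^+ 2 - (a i + a i) * a j)
  (c2 := fun a => (a i ^+ 3 + 1) * (a j + a j) - a i ^+ 2) ij) => [R a lR cR vw|a|a g0].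
- by rewrite /G3; split; val_poly.
- by rewrite /G3 !cst_morph; ring.
have [c10|] := eqVneq ((a i ^+ 2 + a i * a i + a i ^+ 2) * a j ^+ 2 - (a i + a i) * a j) 0; last by left; split=> //; left.
right; split; last by right; exact: G3_neq0 g0.
apply/eqP => c20; apply: (G3_smooth g0); [rewrite -[RHS]c10 | rewrite -[RHS]c20]; ring.
Qed.

Lemma nondegenerate_G4 w e i j : i != j -> nondegenerate w e (G4 (w i) (w j)).
Proof.
move=> ij; apply: (nondegenerate_intro (c := fun a => G4 (a i) (a j))
  (q1 := fun a => (w i + cst K (a i)) * (w j + w j ^+ 4) - 1)
  (q2 := fun a => cst K (a i) ^+ 2 * (1 + (w j ^+ 3 + w j ^+ 2 * cst K (a j) + w j * cst K (a j) ^+ 2 + cst K (a j) ^+ 3)))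
  (c1 := fun a => (a i + a i) * (a j + a j ^+ 4) - 1)
  (c2 := fun a => a i ^+ 2 * (1 + (a j ^+ 3 + a j ^+ 2 * a j + a j * a j ^+ 2 + a j ^+ 3))) ij) => [R a lR cR vw|a|a g0].
- by rewrite /G4; split; val_poly.
- by rewrite /G4 !cst_morph; ring.
have [c10|] := eqVneq ((a i + a i) * (a j + a j ^+ 4) - 1) 0; last first.
  by left; split=> //; right; exact: G4_neq0 g0.
have c1 : - 1 + 2%:R * a i * (a j + a j ^+ 4) = 0 by rewrite -[RHS]c10; ring.
right; split; last by right; exact: G4_v_neq0 c1.
by apply/eqP => c20; apply: (G4_smooth g0 c1); rewrite -[RHS]c20; ring.
Qed.

Lemma nondegenerate_G5 w e i j : i != j -> nondegenerate w e (G5 (w i) (w j)).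
Proof.
move=> ij; apply: (nondegenerate_intro (c := fun a => G5 (a i) (a j))
  (q1 := fun a => 1 + (w i ^+ 3 + w i ^+ 2 * cst K (a i) + w i * cst K (a i) ^+ 2 + cst K (a i) ^+ 3) * w j ^+ 3)
  (q2 := fun a => 1 + cst K (a i) ^+ 4 * (w j ^+ 2 + w j * cst K (a j) + cst K (a j) ^+ 2))
  (c1 := fun a => 1 + (a i ^+ 3 + a i ^+ 2 * a i + a i * a i ^+ 2 + a i ^+ 3) * a j ^+ 3)
  (c2 := fun a => 1 + a i ^+ 4 * (a j ^+ 2 + a j * a j + a j ^+ 2)) ij) => [R a lR cR vw|a|a g0].
- by rewrite /G5; split; val_poly.
- by rewrite /G5 !cst_morph; ring.
(* On u = 0 the curve has q = 1 and its derivative in q is 1. At q = 0 the derivative in u is 1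
   while u is nonzero. Elsewhere both coordinates are nonzero and smoothness suffices. *)
have [u0|u0] := eqVneq (a i) 0.
  right; rewrite u0 (G5_u0 g0 u0); split; last by right; rewrite oner_neq0.
  by rewrite (_ : _ + _ = 1) ?oner_neq0 //; ring.
have [q0|q0] := eqVneq (a j) 0.
  left; split; last by right.
  rewrite q0; by rewrite (_ : _ + _ = 1) ?oner_neq0 //; ring.
have [c10|] := eqVneq (1 + (a i ^+ 3 + a i ^+ 2 * a i + a i * a i ^+ 2 + a i ^+ 3) * a j ^+ 3) 0; last first.
  by left; split=> //; right.
right; split; last by right.
apply/eqP => c20; apply: (G5_smooth g0); [rewrite -[RHS]c10 | rewrite -[RHS]c20]; ring.
Qed.

End SNC.

(** * The divisor E_1 *)

Section FirstDivisor.
Variables (k : numClosedFieldType) (K : function_field 3 k).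
Implicit Types (A B R S V E L : set K) (M : set (set K)).
Local Notation x := (coord K i0).
Local Notation y := (coord K i1).
Local Notation z := (coord K i2).
Let x0 : x != 0 := x_neq0 K.
Let y0 : y != 0 := y_neq0 K.
Let z0 : z != 0 := z_neq0 K.
#[local] Hint Resolve subalg_subring alg_subring : core.
Ltac by_field := rewrite /=; field; rewrite ?x0 ?y0 ?z0.

Definition E1 : set K := prime_loc (alg (lw (C1 K))) x.

Let f1 : frame (lw (C1 K)). Proof. by case: (chart1 K). Qed.
Let px : prime_elt (alg (lw (C1 K))) x. Proof. exact: (coord_prime_elt i0 f1). Qed.

Lemma E1_dvr : dvr E1. Proof. exact: frame_prime_dvr. Qed.
Lemma E1_point : point (alg (lw (C1 K))) E1. Proof. exact: prime_loc_point. Qed.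
Lemma E1_maxid_x : maxid E1 x.
Proof. by apply/prime_loc_maxid => //; [exact: (alg_gen _ i0) | rewrite divff //; apply: subring1]. Qed.
Lemma E1_yx : E1 (y / x).
Proof. by have [AE _ _] := E1_point; apply: AE; apply: (alg_gen (lw (C1 K)) i1). Qed.
Lemma E1_zx : E1 (z / x).
Proof. by have [AE _ _] := E1_point; apply: AE; apply: (alg_gen (lw (C1 K)) i2). Qed.

Lemma E1_maxid i : maxid E1 (coord K i).
Proof.
have [[sE _] _] := E1_dvr; case: (ord3P i) => ->; first exact: E1_maxid_x.
  have -> : y = y / x * x by by_field.
  by apply: maxidM => //; [exact: E1_yx | exact: E1_maxid_x].
have -> : z = z / x * x by by_field.
by apply: maxidM => //; [exact: E1_zx | exact: E1_maxid_x].
Qed.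

Lemma E1_unique (Y : set (set K)) E : separated Y -> point (alg (lw (C1 K))) `<=` Y ->
  dvr E -> Y E -> maxid E x -> E (y / x) -> E (z / x) -> has_cst E -> E = E1.
Proof.
move=> sY AY dE YE mx Eyx Ezx cE; apply: (dvr_prime_loc_sep sY AY) => //.
rewrite alg_lw; apply: subalg_in => //; first exact: dE.1.1.
by rewrite /=; do !split => //; exact: maxid_in mx.
Qed.

(** Recognizes E1 in another chart: it is enough that x vanishes along w_i = 0 and that y/x and z/x
    are regular there, since the local ring then contains the algebra of [C1]. The variety Y is
    arbitrary because the comparison is made on Y1 as well as on Y3. *)
Lemma E1_coord (Y : set (set K)) (w : 'I_3 -> K) i (s : K) (E := prime_loc (alg w) (w i)) :
  frame w -> separated Y -> point (alg (lw (C1 K))) `<=` Y -> point (alg w) `<=` Y ->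
  E s -> x = s * w i -> E (y / x) -> E (z / x) -> E = E1.
Proof.
move=> fw sY AY BY Es Ex Eyx Ezx; have pw := coord_prime_elt i fw.
have dE : dvr E by apply: frame_prime_dvr.
have pE : point (alg w) E by apply: prime_loc_point.
apply: (E1_unique sY AY) => //; first exact: BY.
  by rewrite Ex; apply: maxidM => //; [exact: dE.1.1 | exact: prime_loc_coord_maxid].
by move=> c; have [AE _ _] := pE; apply: AE; apply: alg_cst.
Qed.

(** This chart of Y1 contains the centre of the second blow-up and is not a chart of Y3; it is used
    to find all prime divisors of Y1 over the origin. *)
Lemma frame_C30 : frame (lw [:: x / z; y / z; z]).
Proof.
have J : jac (lw [:: x / z; y / z; z]) * z ^+ 2 = 1.
  rewrite /jac det3 !mxE /lw /= !fderiv_div ?mulf_neq0 ?expf_neq0 //.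
  by rewrite !fderiv_xyz; field.
apply: frame_coord; first by apply/eqP => J0; move/eqP: J; rewrite J0 mul0r eq_sym oner_eq0.
rewrite alg_lw => i; case: (ord3P i) => ->.
- by apply: (subalg_mul_nth (i := 0) (j := 2)) => //; by_field.
- by apply: (subalg_mul_nth (i := 1) (j := 2)) => //; by_field.
- exact: (subalg_nth (s := [:: x / z; y / z; z]) (i := 2)).
Qed.

Lemma point_C s (Y : set (set K)) ss : covers Y ss -> s \in ss -> size s = 3 ->
  point (alg (lw s)) `<=` Y.
Proof.
move=> -> sss; case: s sss => [|a [|b [|c []]]] // sss _ R; rewrite alg_lw => pR.
by exists [:: a; b; c].
Qed.

Lemma coverP (Y : set (set K)) ss R : covers Y ss -> Y R -> all (fun s => size s == 3) ss ->
  exists2 s, s \in ss & point (alg (lw s)) R.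
Proof.
move=> -> [s sss pR] /allP/(_ s sss); case: s sss pR => [|a [|b [|c []]]] // sss pR _.
by exists [:: a; b; c]; rewrite ?alg_lw.
Qed.

Lemma point_Y3 s : s \in [:: C1 K; C2 K; C5 K; C4 K; C3 K] -> point (alg (lw s)) `<=` Y3 K.
Proof.
move=> sin; apply: (point_C (step3 K).1 sin).
by move: sin; rewrite !inE => /or4P[/eqP->|/eqP->|/eqP->|/orP[]/eqP->].
Qed.

Lemma Y3P R : Y3 K R -> exists2 s, s \in [:: C1 K; C2 K; C5 K; C4 K; C3 K] & point (alg (lw s)) R.
Proof. by move=> YR; apply: (coverP (step3 K).1 YR). Qed.

Lemma point_Y1 s : s \in [:: C1 K; C2 K; [:: x / z; y / z; z]] -> point (alg (lw s)) `<=` Y1 K.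
Proof.
move=> sin; apply: (point_C (step1 K).1 sin).
by move: sin; rewrite !inE => /or3P[]/eqP->.
Qed.

Lemma Y1P R : Y1 K R -> exists2 s, s \in [:: C1 K; C2 K; [:: x / z; y / z; z]] & point (alg (lw s)) R.
Proof. by move=> YR; apply: (coverP (step1 K).1 YR). Qed.

Ltac in_loc fw := repeat first [exact: (frame_prime_dvr fw (coord_prime_elt _ fw)).1.1
  | by apply: runit_in; apply: (prime_loc_coord_runit fw)
  | by apply: runit_in; apply: runitV; apply: (prime_loc_coord_runit fw)
  | apply: subringM].
Ltac in_loc_eq fw e := match goal with |- _ ?t => have -> : t = e by unfold_lw; by_field end; in_loc fw.

Let f2 : frame (lw (C2 K)). Proof. by case: (chart2 K). Qed.
Let f3 : frame (lw (C3 K)). Proof. by case: (chart3 K). Qed.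
Let f4 : frame (lw (C4 K)). Proof. by case: (chart4 K). Qed.
Let f5 : frame (lw (C5 K)). Proof. by case: (chart5 K). Qed.

Lemma E1_C2_gen (Y : set (set K)) : separated Y -> point (alg (lw (C1 K))) `<=` Y ->
  point (alg (lw (C2 K))) `<=` Y -> prime_loc (alg (lw (C2 K))) (lw (C2 K) i1) = E1.
Proof.
move=> sY AY BY; set w := lw (C2 K); apply: (E1_coord (s := w i0) f2 sY AY BY).
- by in_loc f2.
- by rewrite /w /lw; by_field.
- by in_loc_eq f2 ((w i0)^-1).
- by in_loc_eq f2 (w i2 * (w i0)^-1).
Qed.

Lemma E1_C2 : prime_loc (alg (lw (C2 K))) (lw (C2 K) i1) = E1.
Proof.
by apply: E1_C2_gen; [exact: separated_Y3 | apply: point_Y3; rewrite !inE eqxx ?orbT..].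
Qed.

Lemma E1_C3 : prime_loc (alg (lw (C3 K))) (lw (C3 K) i2) = E1.
Proof.
set w := lw (C3 K); apply: (E1_coord (s := w i0 * w i1) f3 (separated_Y3 (K := K))).
- by apply: point_Y3; rewrite !inE eqxx ?orbT.
- by apply: point_Y3; rewrite !inE eqxx ?orbT.
- by in_loc f3.
- by rewrite /w /lw; by_field.
- by in_loc_eq f3 ((w i0)^-1).
- by in_loc_eq f3 ((w i0)^-1 * (w i1)^-1).
Qed.

Lemma E1_C4 : prime_loc (alg (lw (C4 K))) (lw (C4 K) i2) = E1.
Proof.
set w := lw (C4 K); apply: (E1_coord (s := w i0 * w i1) f4 (separated_Y3 (K := K))).
- by apply: point_Y3; rewrite !inE eqxx ?orbT.
- by apply: point_Y3; rewrite !inE eqxx ?orbT.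
- by in_loc f4.
- by rewrite /w /lw; by_field.
- by in_loc_eq f4 (w i1).
- by in_loc_eq f4 ((w i0)^-1 * (w i1)^-1).
Qed.

Lemma E1_C5 : prime_loc (alg (lw (C5 K))) (lw (C5 K) i2) = E1.
Proof.
set w := lw (C5 K); apply: (E1_coord (s := w i0) f5 (separated_Y3 (K := K))).
- by apply: point_Y3; rewrite !inE eqxx ?orbT.
- by apply: point_Y3; rewrite !inE eqxx ?orbT.
- by in_loc f5.
- by rewrite /w /lw; by_field.
- by in_loc_eq f5 (w i0 * w i1).
- by in_loc_eq f5 ((w i0)^-1).
Qed.

Lemma E1_C30 : prime_loc (alg (lw [:: x / z; y / z; z])) (lw [:: x / z; y / z; z] i2) = E1.
Proof.
set w := lw _; apply: (E1_coord (s := w i0) frame_C30 (separated_Y1 (K := K))).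
- by apply: point_Y1; rewrite !inE eqxx ?orbT.
- by apply: point_Y1; rewrite !inE eqxx ?orbT.
- by in_loc frame_C30.
- by rewrite /w /lw; by_field.
- by in_loc_eq frame_C30 (w i1 * (w i0)^-1).
- by in_loc_eq frame_C30 ((w i0)^-1).
Qed.

Lemma E1_Y1 : Y1 K E1.
Proof. by apply: point_Y1 E1_point; rewrite !inE eqxx. Qed.

Lemma E1_Y3 : Y3 K E1.
Proof. by apply: point_Y3 E1_point; rewrite !inE eqxx. Qed.

Lemma dvrP (Y : set (set K)) E : good Y -> prime_divisor Y E <-> Y E /\ dvr E.
Proof. by move=> gY; split=> [[YE tE]|[YE [lE tE]]]; split=> //; split=> //; case: (gY _ YE). Qed.

Lemma kill_all n (p : {mpoly k[n]}) : exists c, kill predT p = c%:MP.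
Proof.
elim/mpoly_ring_ind: p => [c|i|p q [c Ec] [d Ed]|p q [c Ec] [d Ed]].
- by exists c; rewrite killC.
- by exists 0; rewrite killX.
- by exists (c + d); rewrite rmorphD /= Ec Ed mpolyCD.
- by exists (c * d); rewrite rmorphM /= Ec Ed mpolyCM.
Qed.

Lemma origin_const a : alg (coord K) a -> exists c, coord_ideal (coord K) predT (a - cst K c).
Proof.
move=> /algP[p ->]; have [c Ec] := kill_all p; exists c.
by have := coord_ideal_kill (coord K) predT p; rewrite Ec evC.
Qed.

(** A polynomial with nonzero constant term is a unit along E1, because x, y and z vanish there. *)
Lemma E1_origin : dominates E1 (origin K).
Proof.
have [lE _] := E1_dvr; have sE := lE.1; have [AE _ _] := E1_point.
have cE : has_cst E1 by move=> c; apply: AE; apply: alg_cst.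
have A0E : alg (coord K) `<=` E1.
  by apply: subalg_sub => // _ [i _ <-]; exact: maxid_in (E1_maxid i).
have mE : coord_ideal (coord K) predT `<=` maxid E1.
  by apply: ideal_of_maxid => // _ [i _ ->]; exact: E1_maxid.
have pI := coord_ideal_prime predT (frame_coordK K).
rewrite originE; have uE b : alg (coord K) b -> ~ coord_ideal (coord K) predT b -> runit E1 b.
  move=> Ab nb; have [c Ic] := origin_const Ab.
  rewrite -(subrK (cst K c) b) addrC; apply: runitD_maxid => //; last exact: mE.
  apply: cst_runit => //; apply/eqP => c0; apply: nb.
  by rewrite c0 rmorph0 subr0 in Ic.
split=> h.
  move=> [a [b [Aa Ab nb ->]]]; apply: subringM => //; first exact: A0E.
  by apply: runit_in; apply: runitV; apply: uE.
move=> mh; have [a [b [Aa Ab nb Eh]]] := maxid_in mh; move: mh; rewrite Eh.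
move=> /localize_maxid-/(_ (alg_subring _) pI Aa Ab nb) Ia.
by apply: maxidMr => //; [apply: runit_in; apply: runitV; apply: uE | exact: mE].
Qed.

(** In each of the three charts of Y1 the exceptional divisor is cut out by one of x, y, z, and all
    three vanish along a divisor over the origin. *)
Lemma E1_characterization E : (prime_divisor (Y1 K) E /\ dominates E (origin K)) <-> E = E1.
Proof.
rewrite dvrP; last exact: good_Y1; split=> [[[YE dE] dom]|->]; last first.
  by split; [split; [exact: E1_Y1 | exact: E1_dvr] | exact: E1_origin].
have mE i : maxid E (coord K i) by apply: dom.2; exact: origin_maxid.
have [s + pE] := Y1P YE; rewrite !inE => /or3P[]/eqP Es; rewrite {}Es in pE.
- exact: (dvr_prime_loc (alg_subring _) dE pE px (mE i0)).
- rewrite -E1_C2; exact: (dvr_prime_loc (alg_subring _) dE pE (coord_prime_elt i1 f2) (mE i1)).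
- rewrite -E1_C30; exact: (dvr_prime_loc (alg_subring _) dE pE (coord_prime_elt i2 frame_C30) (mE i2)).
Qed.

(** On X the quotient y/x would have a denominator b that is a unit along E1. The prime x would
    divide b y, hence b, although x vanishes along E1. *)
Lemma E1_not_X3 : ~ affine_space K E1.
Proof.
move=> /specP => /(_ (alg_subring (coord K)))[AE lE EE]; have sE := lE.1.
have := E1_yx; rewrite EE => -[a [b [Aa Ab ub Eab]]].
have fc := frame_coordK K; have [_ _ nx xP] := coord_prime_elt i0 fc.
have : alg (coord K) (b * y / x).
  by rewrite -mulrA Eab mulrCA divff ?mulr1 // (runit_neq0 ub).
move=> /(xP _ _ Ab (alg_gen _ i1))[bx|].
  apply: (maxid_nu _ ub); rewrite -(divfK x0 b); apply: maxidM => //; last exact: E1_maxid_x.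
  exact: AE.
have := at_gen (coord K) (fun l => (l == i1)%:R) i1; rewrite eqxx => /at_ndvd; apply=> //.
  exact: oner_neq0.
exact: (at_gen (coord K) (fun l => (l == i1)%:R) i0).
Qed.

Lemma E1_ord : ord E1 (eqD K) = 7.
Proof. exact: (chart_ord_coord (chart1 K) i0). Qed.

Lemma E1_relcan : relcan E1 = 2.
Proof. exact: (chart_relcan_coord (chart1 K) i0). Qed.

End FirstDivisor.

Arguments E1 {k} K.

(** * Multiplicities and jumping numbers *)

Section JumpingNumbers.
Variables (k : numClosedFieldType) (K : function_field 3 k).
Implicit Types (R E : set K) (w : 'I_3 -> K) (e kap : 'I_3 -> nat) (f g h : K).
Local Notation x := (coord K i0).
Local Notation y := (coord K i1).
Local Notation z := (coord K i2).
Local Notation Y3 := (Y3 K).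
Local Notation E1 := (E1 K).
Local Notation eqD := (eqD K).
#[local] Hint Resolve subalg_subring alg_subring : core.

Lemma smooth_Y3 : smooth Y3.
Proof.
move=> R [YR cR]; have [s _ pR] := Y3P YR; have [AR _ _] := pR.
have /choice[a Ha] : forall i, exists c, maxid R (lw s i - cst K c).
  by move=> i; apply: cR; apply: AR; apply: alg_gen.
by exists (shift (lw s) a); apply: shift_regular.
Qed.

Lemma Y3_charts E : Y3 E -> exists w e kap g, [/\ point (alg w) E, point (alg w) `<=` Y3,
  divisor_chart eqD w e kap g, nondegenerate w e g &
  forall i, [\/ e i = 0%N, prime_loc (alg w) (w i) = E1 |
    ((e i, kap i) \in [:: (1, 0); (3, 1); (6, 2)])%N]].
Proof.
move=> /Y3P[s + pE]; rewrite !inE => /or4P[/eqP Es|/eqP Es|/eqP Es|/orP[]/eqP Es]; rewrite {s}Es in pE.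
- exists (lw (C1 K)); do 3 eexists; split; [exact: pE | | exact: chart1 | exact: nondegenerate_G1 |].
    by apply: point_Y3; rewrite !inE eqxx ?orbT.
  by move=> i; case: (ord3P i) => ->; [constructor 2 | constructor 3 | constructor 1].
- exists (lw (C2 K)); do 3 eexists; split; [exact: pE | | exact: chart2 | exact: nondegenerate_G2 |].
    by apply: point_Y3; rewrite !inE eqxx ?orbT.
  by move=> i; case: (ord3P i) => ->; [constructor 1 | constructor 2; exact: E1_C2 | constructor 1].
- exists (lw (C5 K)); do 3 eexists; split; [exact: pE | | exact: chart5 | exact: nondegenerate_G5 |].
    by apply: point_Y3; rewrite !inE eqxx ?orbT.
  by move=> i; case: (ord3P i) => ->; [constructor 3 | constructor 3 | constructor 2; exact: E1_C5].
- exists (lw (C4 K)); do 3 eexists; split; [exact: pE | | exact: chart4 | exact: nondegenerate_G4 |].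
    by apply: point_Y3; rewrite !inE eqxx ?orbT.
  by move=> i; case: (ord3P i) => ->; [constructor 3 | constructor 3 | constructor 2; exact: E1_C4].
- exists (lw (C3 K)); do 3 eexists; split; [exact: pE | | exact: chart3 | exact: nondegenerate_G3 |].
    by apply: point_Y3; rewrite !inE eqxx ?orbT.
  by move=> i; case: (ord3P i) => ->; [constructor 1 | constructor 3 | constructor 2; exact: E1_C3].
Qed.

Lemma snc_Y3 : snc Y3 eqD.
Proof.
move=> R [YR cR]; have [w [e [kap [g [pR AY Hc nd _]]]]] := Y3_charts YR.
have [AR _ _] := pR; have /choice[a Ha] : forall i, exists c, maxid R (w i - cst K c).
  by move=> i; apply: cR; apply: AR; apply: alg_gen.
apply: (chart_snc Hc (a := a) (@good_Y3 _ K) (@separated_Y3 _ K) AY pR Ha).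
exact: nd.
Qed.

Lemma log_resolution_Y3 : log_resolution Y3 eqD.
Proof.
split; [exact: variety_Y3 | exact: proper_Y3 | exact: smooth_Y3 | exact: snc_Y3 | exact: iso_Y3].
Qed.

Lemma eqD_neq0 : eqD != 0.
Proof.
rewrite mulf_neq0 ?y_neq0 // expf_neq0 //; by case: (cubic_prime_elt K).
Qed.

Lemma Y3_eqD E : Y3 E -> E eqD.
Proof.
by move=> YE; apply: ring_eqD => [|i]; [exact: (good_Y3 YE).1.1 | exact: Y3_coord].
Qed.

(** Outside D there are infinitely many prime divisors. For them the inequality is enough: their
    multiplicity is 0, so they impose no more than the canonical divisor does. *)
Lemma divisor_data E : prime_divisor Y3 E -> E = E1 \/
  ((ord E eqD = 0 /\ 0 <= relcan E) \/
   ((ord E eqD, relcan E) \in ([:: (1, 0); (2, 0); (3, 1); (6, 2)] : seq (int * int)))).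
Proof.
move=> /(dvrP _ (@good_Y3 _ K))[YE dE].
have [w [e [kap [g [pE _ Hc _ He]]]]] := Y3_charts YE.
case: (runit_or (Y3_eqD YE)) => [u|m].
  by right; left; rewrite ord_runit //; split=> //; apply: (chart_relcan_ge0 Hc).
case: (chart_component Hc dE pE m) => [[i ei EE]|EE]; last first.
  by right; right; rewrite EE (chart_ord_g Hc) (chart_relcan_g Hc).
case: (He i) => [e0|E1E|]; first by rewrite e0 in ei.
  by left; rewrite EE.
move=> H; right; right; rewrite EE (chart_ord_coord Hc) (chart_relcan_coord Hc).
by move: H; rewrite !inE => /or3P[]/eqP[-> ->].
Qed.

Lemma E1_prime_divisor : prime_divisor Y3 E1.
Proof. by apply/dvrP; [exact: good_Y3 | split; [exact: E1_Y3 | exact: E1_dvr]]. Qed.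

Lemma E1_component : component Y3 eqD E1.
Proof. by split; [exact: E1_prime_divisor | rewrite E1_ord]. Qed.

(** By properness E, taken as a valuation ring, dominates a point R of Y3, which dominates a point S
    of X; separatedness gives S = E, so R = E. A prime divisor of X and its strict transform thus
    have the same local ring. *)
Lemma X3_dvr_Y3 E : dvr E -> X3 K E -> prime_divisor Y3 E.
Proof.
move=> dE XE; apply/dvrP; first exact: good_Y3; split=> //.
have [_ pr] := proper_Y3 K; have vE := dvr_valuation dE.
have [R YR [RE dR]] := pr E E vE XE (dominates_refl _).
have [pr' _] := proper_Y3 K; have [S XS dS] := pr' R YR.
have ES := separated_X3 vE XE XS (dominates_refl _) (dominates_trans (conj RE dR) dS).
suff -> : E = R by [].
by apply/seteqP; split=> //; rewrite {1}ES; case: dS.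
Qed.

(** Affine space itself as a chart, from which the multiplicity of D along C is read off. *)
Lemma chart0 : divisor_chart eqD (coord K) (nw [:: 0; 1; 0]) (nw [:: 0; 0; 0]) (cubic x y z).
Proof.
have fc := frame_coordK K; have pC := cubic_prime_elt K.
have at_cubic v : at_point (coord K) v (cubic x y z) (cubic (v i0) (v i1) (v i2)).
  exists (cubic_mpoly k); last exact: meval_cubic.
  by rewrite (cubic_morph (ev (coord K))) /= !evX.
split=> //.
(* C has the value 1 at (0, 1, 0) and at (1, 0, 0), and each coordinate plane contains one of these
   points. *)
- move=> i; pose v l : k := if (i == i0) then (l == i1)%:R else (l == i0)%:R.
  have := at_cubic v => /at_ndvd; apply=> //; first exact: frame_neq0.
    rewrite /v /cubic /=; case: ifP => _ /=; rewrite (_ : _ + _ = 1) ?oner_neq0 //; ring.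
  have vi : v i = 0 by rewrite /v; case: (ord3P i) => ->.
  by have := at_gen (coord K) v i; rewrite vi.
- by rewrite prod3 /nw /= !expr0 expr1 mulr1 mul1r.
exists 1; rewrite ?oner_neq0 // jac_coord prod3 /nw /= !expr0 !mulr1 rmorph1 //.
Qed.

Lemma X3_relcan E : dvr E -> X3 K E -> relcan E = 0.
Proof.
move=> dE /specP => /(_ (alg_subring (coord K))) pE.
rewrite (relcan_frame (frame_coordK K) dE pE) jac_coord ord_runit ?oppr0 //.
by apply: runit1; case: dE => -[].
Qed.

Lemma floor_eq (a : rat) (m : int) : m%:~R <= a -> a < (m + 1)%:~R -> Num.floor a = m.
Proof. by move=> ? ?; apply: floor_def; apply/andP. Qed.

Lemma floor_67 : ((Num.floor (6 / 7 * 1%:~R : rat) = 0) * (Num.floor (6 / 7 * 2%:~R : rat) = 1) *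
  (Num.floor (6 / 7 * 3%:~R : rat) = 2) * (Num.floor (6 / 7 * 6%:~R : rat) = 5) *
  (Num.floor (6 / 7 * 7%:~R : rat) = 6))%type.
Proof. by do 4?split; apply: floor_eq; lra. Qed.

(** The bound 1/42 comes from the multiplicity 6: as 36/7 exceeds the integer 5 by 1/7, the
    subtracted 6 e has to stay below 1/7. The other multiplicities leave more room, and 7, for which
    no e > 0 would do, is absent. *)
Lemma floor_67_sub (e : rat) : 0 < e < 42%:R^-1 ->
  ((Num.floor ((6 / 7 - e) * 1%:~R) = 0) * (Num.floor ((6 / 7 - e) * 2%:~R) = 1) *
  (Num.floor ((6 / 7 - e) * 3%:~R) = 2) * (Num.floor ((6 / 7 - e) * 6%:~R) = 5))%type.
Proof. by move=> /andP[e0 e1]; do 3?split; apply: floor_eq; lra. Qed.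

Lemma floor_37 : ((Num.floor (3 / 7 * 1%:~R : rat) = 0) * (Num.floor (3 / 7 * 2%:~R : rat) = 0) *
  (Num.floor (3 / 7 * 3%:~R : rat) = 1) * (Num.floor (3 / 7 * 6%:~R : rat) = 2) *
  (Num.floor (3 / 7 * 7%:~R : rat) = 3))%type.
Proof. by do 4?split; apply: floor_eq; lra. Qed.

Lemma floor_67_ge0 (a : int) : 0 <= a -> 0 <= Num.floor (6 / 7 * a%:~R : rat).
Proof. by move=> a0; rewrite floor_ge0; apply: mulr_ge0; [lra | rewrite ler0z]. Qed.

Definition EC : set K := prime_loc (alg (coord K)) (cubic x y z).
(** In this chart of the third blow-up the ideal of the centre is generated by y/x, so this is the
    exceptional divisor of that blow-up. *)
Definition E3 : set K := prime_loc (alg (lw (C4 K))) (lw (C4 K) i1).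

Lemma EC_X3 : X3 K EC.
Proof. by apply/specP => //; apply: prime_loc_point => //; exact: cubic_prime_elt. Qed.
Lemma EC_dvr : dvr EC.
Proof. exact: frame_prime_dvr (frame_coordK K) (cubic_prime_elt K). Qed.
Lemma EC_ord : ord EC eqD = 2. Proof. exact: (chart_ord_g chart0). Qed.

Let f4 : frame (lw (C4 K)). Proof. by case: (chart4 K). Qed.
Lemma E3_dvr : dvr E3.
Proof. exact: frame_prime_dvr f4 (coord_prime_elt i1 f4). Qed.
Lemma E3_prime_divisor : prime_divisor Y3 E3.
Proof.
apply/dvrP; first exact: good_Y3; split; last exact: E3_dvr.
have H : C4 K \in [:: C1 K; C2 K; C5 K; C4 K; C3 K] by rewrite !inE eqxx ?orbT.
by apply: (point_Y3 H); apply: prime_loc_point => //; apply: coord_prime_elt.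
Qed.
Lemma E3_ord : ord E3 eqD = 6. Proof. exact: (chart_ord_coord (chart4 K) i1). Qed.
Lemma E3_relcan : relcan E3 = 2. Proof. exact: (chart_relcan_coord (chart4 K) i1). Qed.

Lemma cubic_C4 : cubic x y z = lw (C4 K) i2 ^+ 3 * lw (C4 K) i0 * lw (C4 K) i1 ^+ 2 *
  G4 (lw (C4 K) i0) (lw (C4 K) i1).
Proof.
rewrite /cubic /G4 /lw /=; field.
by rewrite x_neq0 y_neq0 z_neq0.
Qed.

Lemma E3_cubic : ord E3 (cubic x y z) = 2.
Proof.
have pw := coord_prime_elt i1 f4; have sE := E3_dvr.1.1.
have -> : cubic x y z = lw (C4 K) i1 ^+ 2 * (lw (C4 K) i2 ^+ 3 * lw (C4 K) i0 * G4 (lw (C4 K) i0) (lw (C4 K) i1)).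
  by rewrite cubic_C4; ring.
apply: (ord_prime_loc 2 f4 pw); apply: runitM => //; last exact: (chart_coord_g (chart4 K)).
by apply: runitM => //; [apply: runitX => //|]; apply: prime_loc_coord_runit.
Qed.

Lemma E1_cubic : ord E1 (cubic x y z) = 3.
Proof.
rewrite -E1_C4; have pw := coord_prime_elt i2 f4.
have sE : subring (prime_loc (alg (lw (C4 K))) (lw (C4 K) i2)) by rewrite E1_C4; exact: (E1_dvr K).1.1.
have -> : cubic x y z = lw (C4 K) i2 ^+ 3 * (lw (C4 K) i0 * lw (C4 K) i1 ^+ 2 * G4 (lw (C4 K) i0) (lw (C4 K) i1)).
  by rewrite cubic_C4; ring.
apply: (ord_prime_loc 3 f4 pw); apply: runitM => //; last exact: (chart_coord_g (chart4 K)).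
by apply: runitM => //; [|apply: runitX => //]; apply: prime_loc_coord_runit.
Qed.

(* The centre of E3 on X is a line through the origin. *)
Lemma E3_center g : alg (coord K) g -> maxid E3 g -> maxid E1 g.
Proof.
move=> Ag; set w := lw (C4 K); have pw := coord_prime_elt i1 f4.
have [A4E _ _] := prime_loc_point (alg_subring w) pw.
have coordw i : exists2 s, alg w s & coord K i = s * w i2.
  have n := (x_neq0 K, y_neq0 K, z_neq0 K).
  case: (ord3P i) => ->.
  - exists (w i0 * w i1); first by apply: subringM => //; apply: alg_gen.
    by rewrite /w /lw /=; field; rewrite !n.
  - exists (w i0 * w i1 ^+ 2).
      by apply: subringM => //; [|apply: subringX => //]; apply: alg_gen.
    by rewrite /w /lw /=; field; rewrite !n.
  - by exists 1; rewrite ?mul1r //; apply: subring1.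
have A04 : alg (coord K) `<=` alg w.
  apply: alg_sub_coord => i; have [s As ->] := coordw i; apply: subringM => //; exact: alg_gen.
have w20 := frame_neq0 i2 f4; have w10 := frame_neq0 i1 f4.
move=> /(prime_loc_maxid (alg_subring w) pw (A04 _ Ag))/(at_alg (fun=> 0))[d gd].
have [c Ic] := origin_const Ag.
have /(at_alg (fun=> 0))[d' gd'] : alg w ((g - cst K c) / w i2).
  move: Ic; apply: (ideal_of_min (T := [set m | alg w (m / w i2)])) => /=.
  - by rewrite mul0r; apply: subring0.
  - move=> a _ /A04 Aa [i _ ->]; have [s As ->] := coordw i.
    by rewrite mulrA mulfK //; apply: subringM.
  - by move=> m1 m2 ? ?; rewrite mulrDl; apply: subringD.
(* At the chart origin, where w_1 = w_2 = 0, the multiple g of w_1 takes the value 0, while g - c is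
   a multiple of w_2 because x, y and z are. Comparing the values gives c = 0. *)
have c0 : c = 0.
  have g0 := atM gd (at_gen w (fun=> 0) i1); have g0' := atM gd' (at_gen w (fun=> 0) i2).
  rewrite /= !divfK // in g0 g0'.
  have := at_fun f4 (atD g0 (atN (at_cst w (fun=> 0) c))) g0'.
  by rewrite !mulr0 add0r => /eqP; rewrite oppr_eq0 => /eqP.
rewrite c0 rmorph0 subr0 in Ic; have [lE _] := E1_dvr K.
have AE : alg (coord K) `<=` E1.
  have [A1E _ _] := E1_point K; apply: subalg_sub; [exact: lE.1 | | ].
    by move=> a; apply: A1E; apply: alg_cst.
  by move=> _ [i _ <-]; exact: maxid_in (E1_maxid K i).
by apply: (ideal_of_maxid lE AE _ Ic) => _ [i _ ->]; exact: E1_maxid.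
Qed.

Lemma section_E1 h : h != 0 -> (forall E, prime_divisor Y3 E -> E <> E1 ->
  0 <= ord E h + multiplier_divisor eqD (6 / 7) E) -> 4 <= ord E1 h.
Proof.
move=> h0 H; rewrite /multiplier_divisor in H; have fc := frame_coordK K.
(* The prime divisors of X occur among those of Y3 other than E1, since E1 is not a point of X;
   their canonical multiplicity is 0. *)
have X3E E : X3 K E -> dvr E -> 0 <= ord E h + (0 - Num.floor (6 / 7 * (ord E eqD)%:~R : rat)).
  move=> XE dE; have := H E (X3_dvr_Y3 dE XE); rewrite (X3_relcan dE XE); apply.
  by move=> EE; apply: (@E1_not_X3 _ K); rewrite -EE.
have Ah : alg (coord K) h.
  apply: (hartogs fc) => g pg; set E := prime_loc _ g.
  have dE : dvr E by apply: frame_prime_dvr.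
  have XE : X3 K E by apply/specP => //; apply: prime_loc_point.
  apply/ord_ge0 => //; have := X3E _ XE dE.
  have : 0 <= Num.floor (6 / 7 * (ord E eqD)%:~R : rat).
    apply: floor_67_ge0; apply/(ord_ge0 dE eqD_neq0).
    exact: (Y3_eqD (X3_dvr_Y3 dE XE).1).
  by move: (Num.floor _) => m; lia.
have pC := cubic_prime_elt K; have [AC C0 _ _] := pC.
have Ag : alg (coord K) (h / cubic x y z).
  apply/(prime_loc_maxid (alg_subring _) pC Ah); apply/(ord_gt0 EC_dvr h0).
  have := X3E _ EC_X3 EC_dvr; rewrite EC_ord floor_67.
  by rewrite /EC; move: (ord _ h) => m; lia.
set g := h / cubic x y z in Ag; have Eh : h = g * cubic x y z by rewrite divfK.
have g0 : g != 0 by apply: contraNneq h0 => g0; rewrite Eh g0 mul0r.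
have m3 : maxid E3 g.
  apply/(ord_gt0 E3_dvr g0).
  (* The floor of 36/7 is 5 and the canonical multiplicity is 2, so the order required of h is 3. E3
     differs from E1 because their multiplicities in D are 6 and 7. *)
  have : 0 <= ord E3 h + (relcan E3 - Num.floor (6 / 7 * (ord E3 eqD)%:~R : rat)).
    by apply: H; [exact: E3_prime_divisor | move=> E; have := E1_ord K; rewrite -E E3_ord].
  rewrite E3_relcan E3_ord floor_67 Eh (ordM E3_dvr g0 C0) E3_cubic.
  by move: (ord _ g) => m; lia.
have /(ord_gt0 (E1_dvr K) g0) := E3_center Ag m3.
by rewrite Eh (ordM (E1_dvr K) g0 C0) E1_cubic; move: (ord _ g) => m; lia.
Qed.

(** The products of 6/7 with 1, 2, 3 and 6 are not integers, so their floors survive a small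
    decrease; a divisor outside D has multiplicity 0 and is not affected. *)
Lemma multiplier_stable (e : rat) E : 0 < e < 42%:R^-1 -> prime_divisor Y3 E -> E <> E1 ->
  multiplier_divisor eqD (6 / 7 - e) E = multiplier_divisor eqD (6 / 7) E.
Proof.
move=> He /divisor_data[//|D] _; rewrite /multiplier_divisor; congr (_ - _).
case: D => [[-> _]|]; first by rewrite !mulr0.
by rewrite !inE => /or4P[]/eqP[-> _]; rewrite floor_67 (floor_67_sub He).
Qed.

Lemma E1_multiplier : multiplier_divisor eqD (6 / 7) E1 = - 4.
Proof. by rewrite /multiplier_divisor E1_relcan E1_ord floor_67. Qed.

Lemma section_67 h : h != 0 -> (forall E, prime_divisor Y3 E -> E <> E1 ->
  0 <= ord E h + multiplier_divisor eqD (6 / 7) E) -> multiplier_ideal Y3 eqD (6 / 7) h.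
Proof.
move=> h0 H; right => E pE; have [->|EE] := pselect (E = E1); last exact: H.
by rewrite E1_multiplier; have := section_E1 h0 H; move: (ord _ h) => m; lia.
Qed.

(** For e below both e0 and 1/42 a section for 6/7 - e satisfies the conditions for 6/7 off E1,
    hence also the one at E1. The two ideals coincide and there is no jump. *)
Lemma not_jumping_67 : ~ jumping_number Y3 eqD (6 / 7).
Proof.
move=> [_ [e0 /andP[e00 _] H]]; pose e := Num.min e0 42%:R^-1 / 2%:R : rat.
have m0 : 0 < Num.min e0 42%:R^-1 by rewrite lt_min e00 /=; lra.
have e_pos : 0 < e by rewrite /e; lra.
have em : e < Num.min e0 42%:R^-1 by rewrite /e; lra.
move: (em); rewrite lt_min => /andP[ee0 e42].
have [|_] := H e; first by rewrite e_pos.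
apply=> h [->|Hh]; first by left.
have [->|h0] := eqVneq h 0; first by left.
apply: section_67 => // E pE EE; rewrite -(@multiplier_stable e) //; last by rewrite e_pos.
exact: Hh.
Qed.

(** Adding E1 relaxes only the condition at E1, and that condition follows from the others. *)
Lemma not_contributes_67 : ~ contributes Y3 eqD [set E1] (6 / 7).
Proof.
move=> [_ _ _ [_]]; apply=> h [->|Hh]; first by left.
have [->|h0] := eqVneq h 0; first by left.
apply: section_67 => // E pE EE; have := Hh E pE.
by rewrite (_ : (E \in [set E1]) = false) ?addr0 //; apply/negP; rewrite inE.
Qed.

Lemma contributes_37 : contributes Y3 eqD [set E1] (3 / 7).
Proof.
have m1 : multiplier_divisor eqD (3 / 7) E1 = -1.
  by rewrite /multiplier_divisor E1_relcan E1_ord floor_37.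
split.
- by move=> _ ->; split; [exact: E1_component | exact: E1_not_X3].
- exists E1; split; first exact: E1_component.
  (* 3/7 is the candidate (2 + 1) / 7 given by E1 itself. *)
  by exists 1 => //; rewrite E1_relcan E1_ord; lra.
- by move=> _ ->; rewrite E1_ord; apply/intrP; exists 3; lra.
split=> [h [->|Hh]|sub]; [by left | right => E pE |].
  have := Hh E pE; move: (multiplier_divisor _ _ _) => m.
  by case: (_ \in _) => /=; lia.
have : multiplier_ideal Y3 eqD (3 / 7) 1.
  apply: sub; right => E pE; have [_ dE] := (dvrP E (@good_Y3 _ K)).1 pE.
  rewrite ord_runit //; last by apply: runit1; case: dE => -[].
  have [->|EE] := pselect (E = E1).
    by rewrite m1 (_ : (_ \in _) = true) //; apply/idP; rewrite inE.
  rewrite (_ : (E \in [set E1]) = false) ?addr0 ?add0r; last by apply/negP; rewrite inE.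
  (* For the multiplicities 1, 2, 3, 6 the floors are 0, 0, 1, 2. They equal the canonical
     multiplicities, so these components have coefficient 0. *)
  rewrite /multiplier_divisor; case: (divisor_data pE) => [//|[[-> r0]|]].
    by rewrite mulr0 floor0 subr0.
  by rewrite !inE => /or4P[]/eqP[-> ->]; rewrite floor_37.
move=> [/eqP|/(_ E1 E1_prime_divisor)]; first by rewrite oner_eq0.
by rewrite m1 ord_runit //; [exact: E1_dvr | apply: runit1; exact: (E1_dvr K).1.1].
Qed.

End JumpingNumbers.

(** Collects the conclusions in one proposition, to be carried as a whole from the abstract field to
    the field of rational functions. *)
Definition contribution_claim n (k : numClosedFieldType) (K : function_field n k)
    (Y X : set (set K)) (O : set K) (f : K) :=
  log_resolution Y f /\
  exists E1 : set K,
    (forall E, prime_divisor X E /\ dominates E O <-> E = E1) /\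
    component Y f E1 /\
    [/\ ord E1 f = 7,
        contributes Y f [set E1] (3 / 7),
        1 - 1 / (ord E1 f)%:~R = 6 / 7 :> rat,
        ~ jumping_number Y f (6 / 7)
      & ~ contributes Y f [set E1] (6 / 7)].

Theorem contribution_abstract (k : numClosedFieldType) (K : function_field 3 k) :
  contribution_claim (Y3 K) (Y1 K) (origin K) (eqD K).
Proof.
split; first exact: log_resolution_Y3.
exists (E1 K); split; first exact: E1_characterization.
split; first exact: E1_component.
split; [exact: E1_ord | exact: contributes_37 | by rewrite E1_ord; lra | exact: not_jumping_67 |
  exact: not_contributes_67].
Qed.

End AbstractField.

(** * The field of rational functions *)

Lemma frac_cross (R : comNzRingType) (F : fieldType) (phi : {rmorphism R -> F}) a b a' b' :
  injective phi -> phi b != 0 -> phi b' != 0 -> phi a / phi b = phi a' / phi b' -> a * b' = a' * b.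
Proof.
move=> inj b0 b'0 /(congr1 ( *%R^~ (phi b * phi b'))).
rewrite mulrA divfK // [X in _ = X -> _]mulrCA divfK // -!rmorphM => /inj ->; exact: mulrC.
Qed.

(** * Extension of a derivation to a fraction field by the quotient rule *)

Section QuotientRule.
Variables (R : comNzRingType) (F : fieldType) (phi : {rmorphism R -> F}) (d : R -> R) (D : F -> F).
Hypothesis dD : forall a b, d (a + b) = d a + d b.
Hypothesis dM : forall a b, d (a * b) = d a * b + a * d b.
Hypothesis frac_phi : forall h, exists a b, phi b != 0 /\ h = phi a / phi b.

(** The derivative of a rational function is defined through a chosen representative;
    differentiating a b' = a' b shows that the choice is irrelevant. *)
Lemma quotient_rule_unique a b a' b' : phi b != 0 -> phi b' != 0 -> a * b' = a' * b ->
  phi (d a * b - a * d b) / phi b ^+ 2 = phi (d a' * b' - a' * d b') / phi b' ^+ 2.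
Proof.
move=> b0 b'0 E; have := congr1 d E; rewrite !dM => /(congr1 phi); have := congr1 phi E.
rewrite !rmorphB !rmorphD !rmorphM /= => e1 e2.
have -> : phi (d a) = (phi (d a') * phi b + phi a' * phi (d b) - phi a * phi (d b')) / phi b'.
  by rewrite -e2; field.
have -> : phi a = phi a' * phi b / phi b' by rewrite -e1; field.
by field; rewrite b0 b'0.
Qed.

Hypothesis Dfrac : forall (a b : R), phi b != 0 ->
  D (phi a / phi b) = phi (d a * b - a * d b) / phi b ^+ 2.

Lemma quotient_ruleD f g : D (f + g) = D f + D g.
Proof.
have [a [b [b0 ->]]] := frac_phi f; have [a' [b' [b'0 ->]]] := frac_phi g.
have bb : phi (b * b') != 0 by rewrite rmorphM mulf_neq0.
have -> : phi a / phi b + phi a' / phi b' = phi (a * b' + a' * b) / phi (b * b').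
  by rewrite rmorphD !rmorphM /=; field; rewrite b0 b'0.
rewrite !Dfrac // !(dD, dM) !(rmorphB phi, rmorphD phi, rmorphM phi).
by field; rewrite b0 b'0.
Qed.

Lemma quotient_ruleM f g : D (f * g) = D f * g + f * D g.
Proof.
have [a [b [b0 ->]]] := frac_phi f; have [a' [b' [b'0 ->]]] := frac_phi g.
have bb : phi (b * b') != 0 by rewrite rmorphM mulf_neq0.
have -> : phi a / phi b * (phi a' / phi b') = phi (a * a') / phi (b * b').
  by rewrite !rmorphM /=; field; rewrite b0 b'0.
rewrite !Dfrac // !(dD, dM) !(rmorphB phi, rmorphD phi, rmorphM phi).
by field; rewrite b0 b'0.
Qed.

Lemma quotient_rule_phi a : D (phi a) = phi (d a).
Proof.
have d1 : d 1 = 0.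
  by apply: (addrI (d 1)); rewrite addr0 -{3}(mulr1 1) dM mulr1 mul1r.
have := @Dfrac a 1; rewrite rmorph1 oner_neq0 => /(_ isT).
by rewrite divr1 expr1n divr1 d1 mulr0 subr0 mulr1.
Qed.

End QuotientRule.

Lemma frac_repr (R : idomainType) (h : {fraction R}) :
  h = tofrac (frac (repr h)).1 / tofrac (frac (repr h)).2.
Proof.
rewrite -{1}(reprK h); unlock FracField.tofrac.
rewrite -[X in _ = _ * X]FracField.pi_inv -[RHS]FracField.pi_mul.
rewrite /FracField.mulf /FracField.invf /= !numden_Ratio ?oner_neq0 ?denom_ratioP //.
by rewrite mulr1 mul1r Ratio_numden.
Qed.

Section RationalFunctions.
Variables (n : nat) (k : numClosedFieldType).
Local Notation K := (ratfun n k).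
Local Notation P := {mpoly k[n]}.
Local Notation phi := (@FracField.tofrac P : {rmorphism P -> {fraction P}}).

Lemma tofrac_inj : injective phi.
Proof. by move=> p q /eqP; rewrite tofrac_eq => /eqP. Qed.

Lemma tofrac_neq0 (p : P) : p != 0 -> phi p != 0.
Proof. by move=> p0; rewrite tofrac_eq0. Qed.

Lemma fderiv_frac i (a b : P) : phi b != 0 ->
  Defs.fderiv i (phi a / phi b) = phi (a^`M(i) * b - a * b^`M(i)) / phi b ^+ 2.
Proof.
move=> b0; rewrite /Defs.fderiv.
exact: (quotient_rule_unique (mderivM i) (tofrac_neq0 (denom_ratioP _)) b0
  (frac_cross tofrac_inj (tofrac_neq0 (denom_ratioP _)) b0 (esym (frac_repr _)))).
Qed.

Lemma frac_tofrac (h : {fraction P}) : exists a b, phi b != 0 /\ h = phi a / phi b.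
Proof.
exists (frac (repr h)).1, (frac (repr h)).2.
exact: (conj (tofrac_neq0 (denom_ratioP _)) (frac_repr h)).
Qed.

Lemma Defs_fderivD i (f g : {fraction P}) : Defs.fderiv i (f + g) = Defs.fderiv i f + Defs.fderiv i g.
Proof. exact: (quotient_ruleD (mderivD i) (mderivM i) frac_tofrac (@fderiv_frac i)). Qed.
Lemma Defs_fderivM i (f g : {fraction P}) : Defs.fderiv i (f * g) = Defs.fderiv i f * g + f * Defs.fderiv i g.
Proof. exact: (quotient_ruleM (mderivM i) frac_tofrac (@fderiv_frac i)). Qed.
Lemma Defs_fderiv_tofrac i (p : P) : Defs.fderiv i (phi p) = phi p^`M(i).
Proof. exact: (quotient_rule_phi (mderivM i) (@fderiv_frac i)). Qed.

Definition cst_morphism : {rmorphism k -> {fraction P}} := phi \o @mpolyC n k.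

Lemma fderiv_cst_morphism i c : Defs.fderiv i (cst_morphism c) = 0.
Proof. rewrite (Defs_fderiv_tofrac i c%:MP) mderivC; exact: (rmorph0 phi). Qed.

Lemma fderiv_coord_tofrac (i j : 'I_n) : Defs.fderiv i (Defs.coord k j) = (i == j)%:R.
Proof.
rewrite (Defs_fderiv_tofrac i 'X_j) mderivX mnm1E eq_sym; case: eqVneq => [->|_].
  rewrite scale1r; have -> : (U_(j) - U_(j))%MM = 0%MM by apply/mnmP => l; rewrite mnmBE mnm0E subnn.
  rewrite mpolyX0; exact: (rmorph1 phi).
rewrite scale0r; exact: (rmorph0 phi).
Qed.

Lemma mmap_tofrac (p : P) : mmap cst_morphism (@Defs.coord n k) p = phi p.
Proof.
elim/AbstractField.mpoly_ring_ind: p => [c|i|p q Ep Eq|p q Ep Eq].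
- by rewrite mmapC.
- by rewrite mmapX mmap1U.
- by rewrite mmapD Ep Eq -(rmorphD phi).
- transitivity (mmap cst_morphism (@Defs.coord n k) p * mmap cst_morphism (@Defs.coord n k) q).
    exact: (rmorphM (mmap cst_morphism (@Defs.coord n k))).
  by rewrite Ep Eq -(rmorphM phi).
Qed.

Lemma frac_coord_ratfun (h : {fraction P}) : exists p q,
  mmap cst_morphism (@Defs.coord n k) q != 0 /\
  h = mmap cst_morphism (@Defs.coord n k) p / mmap cst_morphism (@Defs.coord n k) q.
Proof.
by have [a [b H]] := frac_tofrac h; exists a, b; rewrite !mmap_tofrac.
Qed.

Lemma subalg_minimal (S T : set K) : (forall c, T (Defs.cst n c)) -> S `<=` T ->
  (forall f g, T f -> T g -> T (f + g)) -> (forall f g, T f -> T g -> T (f * g)) ->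
  Defs.subalg S `<=` T.
Proof.
move=> Tc ST TD TM f; elim=> [c|g Sg|g h _ Tg _ Th|g h _ Tg _ Th].
- exact: (Tc c).
- exact: (ST g Sg).
- exact: (TD g h Tg Th).
- exact: (TM g h Tg Th).
Qed.

Lemma ideal_of_minimal (A S T : set K) : T 0 -> (forall a f, A a -> S f -> T (a * f)) ->
  (forall f g, T f -> T g -> T (f + g)) -> Defs.ideal_of A S `<=` T.
Proof.
move=> T0 TM TD f; elim=> [|a g Aa Sg|g h _ Tg _ Th].
- exact: T0.
- exact: (TM a g Aa Sg).
- exact: (TD g h Tg Th).
Qed.

Definition rational_function_field : AbstractField.function_field n k :=
  @AbstractField.FunctionField n k {fraction P} cst_morphism (@Defs.coord n k) (@Defs.fderiv n k)
    (@Defs.subalg n k) (@Defs.ideal_of n k) fderiv_cst_morphism Defs_fderivD Defs_fderivM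
    fderiv_coord_tofrac frac_coord_ratfun (@Defs.subalg_cst n k) (@Defs.subalg_gen n k)
    (@Defs.subalg_add n k) (@Defs.subalg_mul n k) subalg_minimal (@Defs.ideal_of0 n k)
    (@Defs.ideal_of_gen n k) (@Defs.ideal_of_add n k) ideal_of_minimal.

Local Notation F := rational_function_field.

Lemma contribution_ratfun (Y X : set (set (ratfun n k))) O f :
  AbstractField.contribution_claim (K := F) Y X O f ->
  log_resolution Y f /\
  exists E1 : set (ratfun n k),
    (forall E, prime_divisor X E /\ dominates E O <-> E = E1) /\
    component Y f E1 /\
    [/\ ord E1 f = 7,
        contributes Y f [set E1] (3 / 7),
        1 - 1 / (ord E1 f)%:~R = 6 / 7 :> rat,
        ~ jumping_number Y f (6 / 7)
      & ~ contributes Y f [set E1] (6 / 7)].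
Proof.
(* Each notion is compared with its counterpart separately, by conversion; the statement is then
   transported by rewriting. *)
have E0 : AbstractField.log_resolution (K := F) Y f = log_resolution Y f by reflexivity.
have E1 E : AbstractField.prime_divisor (K := F) X E = prime_divisor X E by reflexivity.
have E2 E : AbstractField.dominates (K := F) E O = dominates E O by reflexivity.
have E3 E : AbstractField.component (K := F) Y f E = component Y f E by reflexivity.
have E4 E : AbstractField.ord (K := F) E f = ord E f by reflexivity.
have E5 s c : AbstractField.contributes (K := F) Y f s c = contributes Y f s c by reflexivity.
have E6 c : AbstractField.jumping_number (K := F) Y f c = jumping_number Y f c by reflexivity.
rewrite /AbstractField.contribution_claim E0 => -[H0 [E [H1 [H2 [H3 H4 H5 H6 H7]]]]]; split; first exact H0.
exists E; split; first by move=> E'; rewrite -E1 -E2; exact (H1 E').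
rewrite -E3 -E4 -E5 -E6 -E5; split; first exact H2.
by split; [exact H3 | exact H4 | exact H5 | exact H6 | exact H7].
Qed.

End RationalFunctions.

(** * Identification of the surface and of the blow-ups over the two fields *)

Section Bridge.
Variable R : realType.
Local Notation K := (rational_function_field 3 R[i]).

Lemma eqD_ratfun : AbstractField.eqD K = Defs.eqD R. Proof. reflexivity. Qed.
Lemma origin_ratfun : AbstractField.origin K = Defs.origin R. Proof. reflexivity. Qed.
Lemma line1_ratfun : AbstractField.line1 K = @Defs.line1 R. Proof. reflexivity. Qed.
Lemma line2_ratfun : AbstractField.line2 K = @Defs.line2 R. Proof. reflexivity. Qed.

Lemma blowup_ratfun (M : set (set (ratfun 3 R[i]))) L : AbstractField.blowup (K := K) M L = Defs.blowup M L.
Proof. reflexivity. Qed.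

Lemma X3_ratfun : AbstractField.X3 K = @Defs.X3 R. Proof. reflexivity. Qed.

Lemma Y1_ratfun : AbstractField.Y1 K = Defs.Y1 R.
Proof.
exact: (etrans (blowup_ratfun _ _) (f_equal2 (@Defs.blowup 3 R[i]) X3_ratfun origin_ratfun)).
Qed.

Lemma Y2_ratfun : AbstractField.Y2 K = Defs.Y2 R.
Proof.
exact: (etrans (blowup_ratfun _ _) (f_equal2 (@Defs.blowup 3 R[i]) Y1_ratfun line1_ratfun)).
Qed.

Lemma Y3_ratfun : AbstractField.Y3 K = Defs.Y3 R.
Proof.
exact: (etrans (blowup_ratfun _ _) (f_equal2 (@Defs.blowup 3 R[i]) Y2_ratfun line2_ratfun)).
Qed.

End Bridge.

Theorem mainTheorem6 (R : realType) :
  log_resolution (Y3 R) (eqD R) /\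
  exists E1 : set (ratfun 3 R[i]),
    (forall E, prime_divisor (Y1 R) E /\ dominates E (origin R) <-> E = E1) /\
    component (Y3 R) (eqD R) E1 /\
    [/\ ord E1 (eqD R) = 7,
        contributes (Y3 R) (eqD R) [set E1] (3 / 7),
        1 - 1 / (ord E1 (eqD R))%:~R = 6 / 7 :> rat,
        ~ jumping_number (Y3 R) (eqD R) (6 / 7)
      & ~ contributes (Y3 R) (eqD R) [set E1] (6 / 7)].
Proof.
have H := AbstractField.contribution_abstract (rational_function_field 3 R[i]).
rewrite Y3_ratfun eqD_ratfun Y1_ratfun origin_ratfun in H.
exact (contribution_ratfun H).
Qed.
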